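(* Let $K(z)$ be the diagonal solution of the reflection equation with parameters $(\xi,\mathcal M)$ and let $K^+(z)$ be the diagonal solution of the dual reflection equation with parameters $(\xi_+,\mathcal M_+)$. Let $b(w)=\mathrm{tr}\big(K^+(w)\mathcal B(w)\big)$ be the open-chain transfer matrix. Then $$[B_{ij}(0),\,b(w)]=0\qquad\text{for } i,j\le\mathcal M_+,$$ $$[\widehat B_{ij}(\infty),\,b(w)]=0\qquad\text{for } i,j>\mathcal M_+ .$$ Hence, with $\mathcal M_{ax}=\max(\mathcal M,\mathcal M_+)$ and $\mathcal M_{in}=\min(\mathcal M,\mathcal M_+)$, the open spin chain transfer matrix admits a $$\mathcal U_q(gl(\mathcal M_{in}))\oplus\mathcal U_q(gl(\mathcal M_{ax}-\mathcal M_{in}))\oplus\mathcal U_q(gl(\mathcal N-\mathcal M_{ax}))$$ symmetry algebra.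
   Context: $\mathcal N\ge2$, $q$ is a nonzero complex deformation parameter with $q^2\ne1$, $E_{ab}$ are elementary $\mathcal N\times\mathcal N$ matrices. The $R$-matrix is $$R_{12}(z)=\mathfrak a(z)\sum_{a}E_{aa}\otimes E_{aa}+\mathfrak b(z)\sum_{a\ne b}E_{aa}\otimes E_{bb}+(q-q^{-1})\sum_{a\neq b}z^{\mathrm{sgn}(b-a)}E_{ab}\otimes E_{ba},$$ with $\mathfrak a(z)=qz-q^{-1}z^{-1}$, $\mathfrak b(z)=z-z^{-1}$. $\widehat{\mathcal U}_q=\mathcal U_q(\widehat{gl}(\mathcal N))$ at $c=0$ is generated by the coefficients of $\mathcal L^{\pm}(z)=\sum_{n\ge0}\sum_{a,b}z^{\pm2n}E_{ab}\otimes L_{ab}^{(\pm n)}$ with relations $R_{12}(\frac zw)\mathcal L_1^{\pm}(z)\mathcal L_2^{\pm}(w)=\mathcal L_2^{\pm}(w)\mathcal L_1^{\pm}(z)R_{12}(\frac zw)$, $R_{12}(\frac zw)\mathcal L_1^{+}(z)\mathcal L_2^{-}(w)=\mathcal L_2^{-}(w)\mathcal L_1^{+}(z)R_{12}(\frac zw)$, $L^{(+0)}_{ab}=L^{(-0)}_{ba}=0$ for $a<b$, and $L^{(+0)}_{aa}L^{(-0)}_{aa}=L^{(-0)}_{aa}L^{(+0)}_{aa}=1$. The level-zero generators $\ell^{\mp}_{ab}=L^{(\pm0)}_{ab}$ generate $\mathcal U_q(gl(\mathcal N))$. For $N$ sites put $\mathcal T^{\pm}_0(z)=\mathcal L^{\pm}_{01}(z)\cdots\mathcal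 L^{\pm}_{0N}(z)\in \mathrm{End}(\mathbb C^{\mathcal N})\otimes\widehat{\mathcal U}_q^{\otimes N}[[z^{\pm2}]]$, which satisfies the same relations. Diagonal $K$ with parameters $(\xi,\mathcal M)$, $0\le\mathcal M\le\mathcal N$, $\xi\ne0$: $K(z)=\mathrm{diag}(\alpha,\dots,\alpha,\beta,\dots,\beta)$ with $\mathcal M$ entries $\alpha=z^2(z^2-\xi^2)$ followed by $\mathcal N-\mathcal M$ entries $\beta=1-\xi^2z^2$. Diagonal $K^+$ with parameters $(\xi_+,\mathcal M_+)$, $0\le\mathcal M_+\le\mathcal N$: $K^+(z)=q^{\mathcal N+1}\mathrm{diag}(q^{-2}\tilde\alpha,q^{-4}\tilde\alpha,\dots,q^{-2\mathcal M_+}\tilde\alpha,\;q^{-2\mathcal M_+-2}\tilde\beta,\dots,q^{-2\mathcal N}\tilde\beta)$ with $\tilde\alpha=1-(\rho\xi_+z)^2$, $\tilde\beta=(\rho z)^2((\rho z)^2-\xi_+^2)$, $\rho=q^{\mathcal N/2}$. The parameters of $K$ and $K^+$ are unrelated. Open monodromy matrix: $\mathcal B(z)=\sum_{a,b}E_{ab}\otimes B_{ab}(z)=\mathcal T^+(z)\,K(z)\,\mathcal T^-(z^{-1})^{-1}$, a power series in $z^2$; it satisfies $R_{12}(\frac zw)\mathcal B_1(z)R_{21}(zw)\mathcal B_2(w)=\mathcal B_2(w)R_{12}(zw)\mathcal B_1(z)R_{21}(\frac zw)$, where $R_{21}$ is $R_{12}$ with the two spaces exchanged. Put $\widehat{\mathcal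 B}(z)=z^{-2}\mathcal B(z^{-1})^{-1}=\sum_{a,b}E_{ab}\otimes\widehat B_{ab}(z)$, a series in $z^{-2}$; $\widehat{\mathcal B}(\infty)$ is its constant term. ''Symmetry algebra'' means an algebra of elements of $\widehat{\mathcal U}_q^{\otimes N}$ commuting with $b(w)$. The three summands are the algebras built on the generators $\ell^\pm_{ij}$ (embedded by the iterated coproduct) with $i,j\le\mathcal M_{in}$, with $\mathcal M_{in}<i,j\le\mathcal M_{ax}$, and with $i,j>\mathcal M_{ax}$, respectively; identifications of subalgebras generated by reflection-algebra entries with quantum algebras are up to adjoining square roots and inverses of some generators. *)

(* Defs.v *)
From HB Require Import structures.
From mathcomp Require Import all_boot all_order all_algebra.
From mathcomp Require Import boolp classical_sets.
From mathcomp Require Import mxtens.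

Set Implicit Arguments.
Unset Strict Implicit.
Unset Printing Implicit Defensive.

Import GRing.Theory.
Local Open Scope ring_scope.
Local Open Scope quotient_scope.

(** * Unital associative algebras, possibly trivial

    An F-algebra is a ring with a central ring morphism from F.  [algType] is
    not used, as it requires [1 != 0], which is not known a priori for an
    algebra given by generators and relations. *)

HB.mixin Record hasScalars (F : pzRingType) A of GRing.PzRing A := {
  scal : F -> A;
  scal1 : scal 1 = 1;
  scalD : {morph scal : c d / c + d};
  scalM : {morph scal : c d / c * d};
  scalC : forall (c : F) (x : A), scal c * x = x * scal c
}.

#[short(type="pzAlgType")]
HB.structure Definition PzAlgebra (F : pzRingType) :=
  {A of hasScalars F A & GRing.PzRing A}.

(** * Algebras given by generators and relations *)

Section Expressions.
Variables (F : fieldType) (X : Type).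

Inductive expr : Type :=
| EGen of X
| ECst of F
| EAdd of expr & expr
| EMul of expr & expr.

Variable r : expr -> expr -> Prop.

(* The least congruence containing [r] and the axioms of unital associative
   F-algebras, the scalar c standing for c times the unit. *)
Inductive cong : expr -> expr -> Prop :=
| cong_rel e e' of r e e' : cong e e'
| cong_refl e : cong e e
| cong_sym e e' of cong e e' : cong e' e
| cong_trans e e' e'' of cong e e' & cong e' e'' : cong e e''
| cong_add e e' f f' of cong e e' & cong f f' : cong (EAdd e f) (EAdd e' f')
| cong_mul e e' f f' of cong e e' & cong f f' : cong (EMul e f) (EMul e' f')
| cong_addA e f g : cong (EAdd e (EAdd f g)) (EAdd (EAdd e f) g)
| cong_addC e f : cong (EAdd e f) (EAdd f e)
| cong_add0 e : cong (EAdd (ECst 0) e) e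
| cong_mulA e f g : cong (EMul e (EMul f g)) (EMul (EMul e f) g)
| cong_mul1 e : cong (EMul (ECst 1) e) e
| cong_mul0 e : cong (EMul (ECst 0) e) (ECst 0)
| cong_mulDl e f g : cong (EMul (EAdd e f) g) (EAdd (EMul e g) (EMul f g))
| cong_mulDr e f g : cong (EMul e (EAdd f g)) (EAdd (EMul e f) (EMul e g))
| cong_cstD c d : cong (EAdd (ECst c) (ECst d)) (ECst (c + d))
| cong_cstM c d : cong (EMul (ECst c) (ECst d)) (ECst (c * d))
| cong_cstC c e : cong (EMul (ECst c) e) (EMul e (ECst c)).

Definition congb (e f : {classic expr}) : bool := `[< cong e f >].

Lemma congb_refl : reflexive congb.
Proof. by move=> e; apply/asboolP; exact: cong_refl. Qed.

Lemma congb_sym : symmetric congb.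
Proof. by move=> e f; apply/asboolP/asboolP; exact: cong_sym. Qed.

Lemma congb_trans : transitive congb.
Proof. by move=> f e g /asboolP ef /asboolP fg; apply/asboolP; exact: cong_trans fg. Qed.

Definition cong_equiv := EquivRel congb congb_refl congb_sym congb_trans.

Definition pquot : Type := {eq_quot cong_equiv}.

HB.instance Definition _ := Choice.on pquot.

Definition pcls (e : expr) : pquot := \pi_({eq_quot cong_equiv}) (e : {classic expr}).
Definition prep (u : pquot) : expr := repr (u : {eq_quot cong_equiv}).

Lemma prepK u : pcls (prep u) = u.
Proof. exact: reprK. Qed.

Lemma pclsP e f : pcls e = pcls f <-> cong e f.
Proof.
split=> [/eqmodP/asboolP //|ef].
by apply/eqmodP/asboolP.
Qed.

Lemma cong_prep e : cong (prep (pcls e)) e.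
Proof. by apply/pclsP; rewrite prepK. Qed.

Definition padd u v := pcls (EAdd (prep u) (prep v)).
Definition pmul u v := pcls (EMul (prep u) (prep v)).
Definition popp u := pcls (EMul (ECst (-1)) (prep u)).

Lemma paddE e f : padd (pcls e) (pcls f) = pcls (EAdd e f).
Proof. by apply/pclsP/cong_add; exact: cong_prep. Qed.

Lemma pmulE e f : pmul (pcls e) (pcls f) = pcls (EMul e f).
Proof. by apply/pclsP/cong_mul; exact: cong_prep. Qed.

Lemma poppE e : popp (pcls e) = pcls (EMul (ECst (-1)) e).
Proof. by apply/pclsP/cong_mul; [exact: cong_refl|exact: cong_prep]. Qed.

Lemma pquotP (P : pquot -> Prop) : (forall e, P (pcls e)) -> forall u, P u.
Proof. by move=> Pe u; rewrite -(prepK u). Qed.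

Fact paddA : associative padd.
Proof.
by do 3!elim/pquotP=> ?; rewrite !paddE; apply/pclsP; exact: cong_addA.
Qed.

Fact paddC : commutative padd.
Proof. by do 2!elim/pquotP=> ?; rewrite !paddE; apply/pclsP; exact: cong_addC. Qed.

Fact padd0 : left_id (pcls (ECst 0)) padd.
Proof. by elim/pquotP=> ?; rewrite paddE; apply/pclsP; exact: cong_add0. Qed.

Fact paddN : left_inverse (pcls (ECst 0)) popp padd.
Proof.
elim/pquotP=> e; rewrite poppE paddE; apply/pclsP.
have e1 : cong e (EMul (ECst 1) e) by apply/cong_sym/cong_mul1.
apply: (cong_trans (cong_add (cong_refl _) e1)).
apply: (cong_trans (cong_sym (cong_mulDl _ _ _))).
apply: (cong_trans (cong_mul (cong_cstD _ _) (cong_refl _))).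
by rewrite addNr; exact: cong_mul0.
Qed.

HB.instance Definition _ := GRing.isZmodule.Build pquot paddA paddC padd0 paddN.

Fact pmulA : associative pmul.
Proof. by do 3!elim/pquotP=> ?; rewrite !pmulE; apply/pclsP; exact: cong_mulA. Qed.

Fact pmul1l : left_id (pcls (ECst 1)) pmul.
Proof. by elim/pquotP=> ?; rewrite pmulE; apply/pclsP; exact: cong_mul1. Qed.

Fact pmul1r : right_id (pcls (ECst 1)) pmul.
Proof.
elim/pquotP=> ?; rewrite pmulE; apply/pclsP.
exact: cong_trans (cong_sym (cong_cstC _ _)) (cong_mul1 _).
Qed.

Fact pmulDl : left_distributive pmul padd.
Proof.
by do 3!elim/pquotP=> ?; rewrite paddE !pmulE paddE; apply/pclsP; exact: cong_mulDl.
Qed.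

Fact pmulDr : right_distributive pmul padd.
Proof.
by do 3!elim/pquotP=> ?; rewrite paddE !pmulE paddE; apply/pclsP; exact: cong_mulDr.
Qed.

HB.instance Definition _ :=
  GRing.Zmodule_isPzRing.Build pquot pmulA pmul1l pmul1r pmulDl pmulDr.

Definition pcst (c : F) : pquot := pcls (ECst c).

Fact pcst1 : pcst 1 = 1.
Proof. by []. Qed.

Fact pcstD : {morph pcst : c d / c + d}.
Proof. by move=> c d; rewrite [RHS]paddE; apply/pclsP/cong_sym/cong_cstD. Qed.

Fact pcstM : {morph pcst : c d / c * d}.
Proof. by move=> c d; rewrite [RHS]pmulE; apply/pclsP/cong_sym/cong_cstM. Qed.

Fact pcstC (c : F) (u : pquot) : pcst c * u = u * pcst c.
Proof.
elim/pquotP: u => e; rewrite [LHS]pmulE [RHS]pmulE; apply/pclsP.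
exact: cong_cstC.
Qed.

HB.instance Definition _ := hasScalars.Build F pquot pcst1 pcstD pcstM pcstC.

End Expressions.

(* The free algebra F<X>, and its quotient by the two-sided ideal generated by
   the differences u - v for r u v. *)
Definition freeAlg (F : fieldType) (X : Type) : pzAlgType F :=
  pquot (fun _ _ : expr F X => False).

Definition fgen (F : fieldType) (X : Type) (x : X) : freeAlg F X :=
  pcls _ (EGen F x).

Definition presAlg (F : fieldType) (X : Type)
    (r : freeAlg F X -> freeAlg F X -> Prop) : pzAlgType F :=
  pquot (fun e e' : expr F X => r (pcls _ e) (pcls _ e')).

Definition pgen (F : fieldType) (X : Type)
    (r : freeAlg F X -> freeAlg F X -> Prop) (x : X) : presAlg r :=
  pcls _ (EGen F x).

(** * Tensor product of a finite family of algebras *)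

Section Tensor.
Variables (F : fieldType) (I : finType) (A : I -> pzAlgType F).

(* The generator attached to x is the pure tensor of the x i. *)
Inductive tensor_rel :
    freeAlg F (forall i, A i) -> freeAlg F (forall i, A i) -> Prop :=
| tensor_lin (x : forall i, A i) i (c : F) (u v : A i) :
    tensor_rel (fgen F (dfwith x (scal c * u + v)))
               (scal c * fgen F (dfwith x u) + fgen F (dfwith x v))
| tensor_mul (x y : forall i, A i) :
    tensor_rel (fgen F x * fgen F y) (fgen F (fun i => x i * y i))
| tensor_one : tensor_rel (fgen F (fun i => 1 : A i)) 1.

Definition tensor : pzAlgType F := presAlg tensor_rel.

Definition pure (x : forall i, A i) : tensor := pgen tensor_rel x.

Definition tensor_in (i : I) (a : A i) : tensor :=
  pure (dfwith (fun j => 1 : A j) a).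

End Tensor.

(** * Formal power series with matrix coefficients

    A power series in one variable is the sequence of its coefficients. *)

Section MatrixSeries.
Variables (A : pzRingType) (n : nat).
Implicit Types f g : nat -> 'M[A]_n.

Definition smul f g : nat -> 'M[A]_n :=
  fun k => \sum_(i < k.+1) f i *m g (k - i)%N.

Definition sone : nat -> 'M[A]_n := fun k => (k == 0)%:R%:M.

(* The series reduced to its variable. *)
Definition svar : nat -> 'M[A]_n := fun k => (k == 1)%:R%:M.

(* Both are the zero series when the inverse does not exist. *)
Definition sinv f : nat -> 'M[A]_n :=
  xget (fun=> 0) [set g | smul f g = sone /\ smul g f = sone].

(* [svar] times the inverse of f among Laurent series with finite principal
   part, when this product is a power series: [svar] being central and
   regular, g = svar f^-1 iff f g = g f = svar. *)
Definition svarinv f : nat -> 'M[A]_n :=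
  xget (fun=> 0) [set g | smul f g = svar /\ smul g f = svar].

End MatrixSeries.

(** * The R-matrix *)

Section RMatrix.
Variables (F : fieldType) (q : F) (n : nat).

(* [Rcoef e] is the coefficient of z^e in R_12(z); e = 1 and e = -1 are the
   only exponents that occur. *)
Definition acoef (e : int) : F := q * (e == 1)%:R - q^-1 * (e == -1)%:R.
Definition bcoef (e : int) : F := (e == 1)%:R - (e == -1)%:R.

Definition Rcoef (e : int) : 'M[F]_(n * n) :=
  acoef e *: (\sum_(a < n) delta_mx a a *t delta_mx a a)
  + bcoef e *: (\sum_(a < n) \sum_(b < n | a != b) delta_mx a a *t delta_mx b b)
  + (q - q^-1) *: (\sum_(a < n) \sum_(b < n | a != b)
       (e == sgz (b%:Z - a%:Z))%:R *: (delta_mx a b *t delta_mx b a)).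

Variable A : pzAlgType F.

Definition RcoefA (e : int) : 'M[A]_(n * n) :=
  map_mx (fun c : F => scal c : A) (Rcoef e).

Definition in1 (X : 'M[A]_n) : 'M[A]_(n * n) := X *t (1%:M : 'M[A]_n).
Definition in2 (X : 'M[A]_n) : 'M[A]_(n * n) := (1%:M : 'M[A]_n) *t X.

(* Coefficients of z^m w^p in R_12(z/w) X_1(z) Y_2(w) and in
   Y_2(w) X_1(z) R_12(z/w), where X m is the coefficient of z^m in X(z). *)
Definition RXY (X Y : int -> 'M[A]_n) (m p : int) : 'M[A]_(n * n) :=
  \sum_(e <- [:: 1; -1]) RcoefA e *m in1 (X (m - e)) *m in2 (Y (p + e)).
Definition YXR (X Y : int -> 'M[A]_n) (m p : int) : 'M[A]_(n * n) :=
  \sum_(e <- [:: 1; -1]) in2 (Y (p + e)) *m in1 (X (m - e)) *m RcoefA e.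

(* The sum over k >= 0 of z^(2k) X k, or of z^(-2k) X k if s is false. *)
Definition zseries (s : bool) (X : nat -> 'M[A]_n) : int -> 'M[A]_n :=
  fun m => if (2 %| `|m|)%N && (if s then 0 <= m else m <= 0)
           then X (`|m| %/ 2)%N else 0.

End RMatrix.

(** * The quantum algebras

    A sign is a boolean, [true] standing for +. *)

Section QuantumAlgebras.
Variables (F : fieldType) (q : F) (n : nat).

Definition affgen : Type := (bool * nat * 'I_n * 'I_n)%type.

Definition fL (s : bool) (k : nat) : 'M[freeAlg F affgen]_n :=
  \matrix_(a, b) fgen F (s, k, a, b).

Inductive aff_rel : freeAlg F affgen -> freeAlg F affgen -> Prop :=
| aff_RLL s s' (m p : int) i j of (s, s') != (false, true) :
    aff_rel (RXY q (zseries s (fL s)) (zseries s' (fL s')) m p i j)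
            (YXR q (zseries s (fL s)) (zseries s' (fL s')) m p i j)
| aff_lower (a b : 'I_n) of (a < b)%N : aff_rel (fL true 0 a b) 0
| aff_upper (a b : 'I_n) of (a < b)%N : aff_rel (fL false 0 b a) 0
| aff_diag_pm a : aff_rel (fL true 0 a a * fL false 0 a a) 1
| aff_diag_mp a : aff_rel (fL false 0 a a * fL true 0 a a) 1.

(* U_q(gl^(n)) at c = 0, and the matrix of its generators L^(+-k)_ab. *)
Definition Uaff : pzAlgType F := presAlg aff_rel.

Definition Lgen (s : bool) (k : nat) : 'M[Uaff]_n :=
  \matrix_(a, b) pgen aff_rel (s, k, a, b).

Definition fingen : Type := (bool * 'I_n * 'I_n)%type.

(* [fL0 s] is the matrix of the L^(+-0)_ab, s being the sign of L: it stands
   for l^- when s is true and for l^+ when s is false. *)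
Definition fL0 (s : bool) : 'M[freeAlg F fingen]_n :=
  \matrix_(a, b) fgen F (s, a, b).

(* The relations of [aff_rel] that involve the L^(+-0) only.  In the mixed
   case, the coefficient z^-1 w of R L^+_1 L^-_2 = L^-_2 L^+_1 R is the only
   one whose terms are all of level zero. *)
Inductive fin_rel : freeAlg F fingen -> freeAlg F fingen -> Prop :=
| fin_RLL s (e : int) i j of e \in [:: 1; -1] :
    fin_rel ((RcoefA q n (freeAlg F fingen) e *m in1 (fL0 s) *m in2 (fL0 s)) i j)
            ((in2 (fL0 s) *m in1 (fL0 s) *m RcoefA q n (freeAlg F fingen) e) i j)
| fin_RLL_pm i j :
    fin_rel
      ((RcoefA q n (freeAlg F fingen) (-1) *m in1 (fL0 true) *m in2 (fL0 false)) i j)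
      ((in2 (fL0 false) *m in1 (fL0 true) *m RcoefA q n (freeAlg F fingen) (-1)) i j)
| fin_lower (a b : 'I_n) of (a < b)%N : fin_rel (fL0 true a b) 0
| fin_upper (a b : 'I_n) of (a < b)%N : fin_rel (fL0 false b a) 0
| fin_diag_pm a : fin_rel (fL0 true a a * fL0 false a a) 1
| fin_diag_mp a : fin_rel (fL0 false a a * fL0 true a a) 1.

(* U_q(gl(n)) *)
Definition Ufin : pzAlgType F := presAlg fin_rel.

(* [ell s] is the matrix of the l^s_ab, where l^-+ = L^(+-0). *)
Definition ell (s : bool) : 'M[Ufin]_n :=
  \matrix_(a, b) pgen fin_rel (~~ s, a, b).

End QuantumAlgebras.

(** * The open spin chain

    All series below are power series in x = z^2, except [Bhat], which is a
    power series in z^-2. *)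

Section OpenChain.
Variables (F : fieldType) (q : F) (n N : nat).

Definition chainAlg : pzAlgType F := tensor (fun _ : 'I_N => Uaff q n).

(* T^+(z) as a series in z^2 if s is true, T^-(z) as a series in z^-2, that is
   T^-(z^-1) as a series in z^2, if s is false. *)
Definition monodromy (s : bool) : nat -> 'M[chainAlg]_n :=
  \big[@smul chainAlg n/@sone chainAlg n]_(i < N)
    (fun k => map_mx (tensor_in (A := fun _ : 'I_N => Uaff q n) (i := i))
                     (Lgen q n s k)).

(* The iterated coproduct of l^s_ab; that of L^(+-k)_ab is the coefficient of
   z^(+-2k) in the entry a, b of T^+-(z). *)
Definition ell_chain (s : bool) : 'M[chainAlg]_n := monodromy (~~ s) 0.

Definition diag_series (d : 'I_n -> {poly F}) : nat -> 'M[chainAlg]_n :=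
  fun k => diag_mx (\row_a (scal ((d a)`_k) : chainAlg)).

(* Diagonal entries of K(z) and K^+(z), the polynomial variable being z^2 and
   rows being numbered from 0. *)
Definition Kdiag (xi : F) (M : nat) (a : 'I_n) : {poly F} :=
  if (a < M)%N then 'X * ('X - (xi ^+ 2)%:P) else 1 - xi ^+ 2 *: 'X.

Definition Kplusdiag (rho xip : F) (Mp : nat) (a : 'I_n) : {poly F} :=
  (q ^+ n.+1 * q ^- (2 * a.+1)) *:
  (if (a < Mp)%N then 1 - (rho * xip) ^+ 2 *: 'X
   else (rho ^+ 2 *: 'X) * (rho ^+ 2 *: 'X - (xip ^+ 2)%:P)).

Definition Bser (xi : F) (M : nat) : nat -> 'M[chainAlg]_n :=
  smul (smul (monodromy true) (diag_series (Kdiag xi M)))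
       (sinv (monodromy false)).

(* z^-2 B(z^-1)^-1, as a series in z^-2; its constant term is its value at
   infinity. *)
Definition Bhat (xi : F) (M : nat) : nat -> 'M[chainAlg]_n :=
  svarinv (Bser xi M).

(* Coefficients of the powers of w^2 in b(w). *)
Definition transfer (xi : F) (M : nat) (rho xip : F) (Mp : nat) : nat -> chainAlg :=
  fun k => \tr (smul (diag_series (Kplusdiag rho xip Mp)) (Bser xi M) k).

End OpenChain.

(** * Blocks

    {0, ..., n-1} is cut at [minn M Mp] and [maxn M Mp]. *)

Definition block_start (M Mp : nat) (k : 'I_3) : nat :=
  nth 0%N [:: 0; minn M Mp; maxn M Mp]%N k.

Definition block_size (n M Mp : nat) (k : 'I_3) : nat :=
  nth 0%N [:: minn M Mp; maxn M Mp - minn M Mp; n - maxn M Mp]%N k.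

(* U_q(gl(m)) (+) U_q(gl(m')) (+) U_q(gl(m'')): a direct sum at the level of Lie
   algebras, that is, the tensor product of the three quantum algebras. *)
Definition block_alg (F : fieldType) (q : F) (n M Mp : nat) : pzAlgType F :=
  tensor (fun k : 'I_3 => Ufin q (block_size n M Mp k)).

Definition block_ell (F : fieldType) (q : F) (n M Mp : nat) (k : 'I_3) (s : bool)
    (i j : 'I_(block_size n M Mp k)) : block_alg q n M Mp :=
  tensor_in (A := fun k : 'I_3 => Ufin q (block_size n M Mp k)) (i := k)
    (ell q (block_size n M Mp k) s i j).

(* Main.v *)
Require Import Defs.
From HB Require Import structures.
From mathcomp Require Import all_boot all_order all_algebra.
From mathcomp Require Import boolp classical_sets reals.
From mathcomp Require Import complex.
From mathcomp Require Import mxtens ring zify.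

(** Let l be one of the triangular matrices l^+, l^- of level-zero generators of
    the chain.  The limits z -> 0 and z -> oo of the RTT relations give
    R l_1 T_2(w) = T_2(w) l_1 R for T = T^+ and T = T^-, with R = R_12(0) or
    R_12(oo) rescaled.  For i, j in the same block, triangularity of l lets the
    entry (i, j) in the first space of R l_1 cross K(w), so that it commutes with
    B(w); in the trace with the weights q^(-2a) of K^+(w) the off-diagonal terms
    telescope, and l_ij commutes with b(w).  Both B(0) = l^- K(0) (l^+)^-1 and
    the value of z^-2 B(1/z)^-1 at infinity are products of triangular matrices:
    their entries in the statement only involve the middle block.

    For the injectivity, let Q be the tensor product of the three block algebras
    and U^+ the algebra generated by the l^-_ab.  The full algebra U_q(gl_n) acts
    on linear maps U^+ -> Q (a coinduced module): l^- by right translation, l^+ by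
    reordering and then through its diagonal blocks.  This action extends to the
    affine algebra by L^+(z) = l^- + z^2 l^+ and L^-(z) = z^-2 L^+(z), and to the
    chain by the counit on all sites but the first.  An element y of Q acts on the
    projection pi : U^+ -> Q on the diagonal blocks by y pi = pi(.) y, and
    evaluation at 1 recovers y, without any PBW theorem. *)

Set Implicit Arguments.
Unset Strict Implicit.
Unset Printing Implicit Defensive.

Import GRing.Theory.
Local Open Scope ring_scope.

(** * The Yang-Baxter equation in index form *)

Section PairOperators.
Variables (F : fieldType) (n : nat).
Implicit Types (p : F) (s : bool) (a b c i j k l : 'I_n).

(** What shapes the injectivity argument is that taking diagonal blocks respects each triangular
    half of U_q(gl_n) but not both halves together: for i, j in different blocks, the relation
    between l^- and l^+ would identify l^-_jj l^+_ii with l^+_jj l^-_ii. Sending generators to their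
    blocks is therefore not a retraction of the full algebra onto Q, and a module has to take its
    place. Its elements are the maps U^+ -> Q that turn left multiplication by l^-_aa into left
    multiplication by the image of l^-_aa in Q: U^+ lacks the inverses of these generators, and this
    equivariance makes them act invertibly. The operators on the module commute with right
    multiplication by Q, which extends y pi = pi(.) y from the generators to every y.

    The two constant R-matrices, at z = 0 and at infinity, are exchanged by R -> R_21^-1 up to sign,
    so each level-zero relation needs only one of them. They differ by (q - 1/q) times the
    permutation (Hecke relation), which is why l^- + z^2 l^+ satisfies the relation with the full
    R_12(z). *)

Definition lts s a b : bool := if s then (a < b)%N else (b < a)%N.
Definition cc p a b : F := if a == b then p else 1.
Definition rr p s a b : F := if lts s a b then p - p^-1 else 0.

Lemma ltsC s a b : lts (~~ s) a b = lts s b a.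
Proof. by case: s. Qed.

Lemma ltsxx s a : lts s a a = false.
Proof. by case: s; rewrite /= ltnn. Qed.

Lemma lts_trans s a b c : lts s a b -> lts s b c -> lts s a c.
Proof. by case: s => /= h1 h2; lia. Qed.

Lemma lts_total s a b : a != b -> lts s a b || lts s b a.
Proof. by rewrite -val_eqE neq_ltn; case: s => //=; rewrite orbC. Qed.

Lemma ltsF s a b : lts s a b -> lts s b a = false.
Proof. by case: s => /=; lia. Qed.

Lemma lts_neq s a b : lts s a b -> a != b.
Proof. by case: eqVneq => // ->; rewrite ltsxx. Qed.

Lemma ccC p a b : cc p a b = cc p b a.
Proof. by rewrite /cc eq_sym. Qed.

Lemma ccxx p a : cc p a a = p.
Proof. by rewrite /cc eqxx. Qed.

Lemma rrC p s a b : rr p (~~ s) a b = rr p s b a.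
Proof. by rewrite /rr ltsC. Qed.

Lemma rrV p s a b : rr p^-1 s a b = - rr p s a b.
Proof. by rewrite /rr; case: ifP; rewrite ?invrK ?opprB ?oppr0. Qed.

(** A constant R-matrix applied to the table T, seen as a vector with two tensor indices: [cc] is
    its diagonal part, [rr] its triangular part, and s says which triangle. The action is a
    parameter so that scalar identities can be transported to tables with values in an algebra. *)
Definition rop (V : nmodType) (act : F -> V -> V) p s (T : 'I_n -> 'I_n -> V) a b : V :=
  act (cc p a b) (T a b) + act (rr p s a b) (T b a).

Variables (V : nmodType) (act : F -> V -> V).
Definition op12 p s (T : 'I_n -> 'I_n -> 'I_n -> V) a b c :=
  rop act p s (fun a b => T a b c) a b.
Definition op13 p s (T : 'I_n -> 'I_n -> 'I_n -> V) a b c :=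
  rop act p s (fun a c => T a b c) a c.
Definition op23 p s (T : 'I_n -> 'I_n -> 'I_n -> V) a b c :=
  rop act p s (fun b c => T a b c) b c.
End PairOperators.

Arguments lts {n} s a b.
Arguments cc {F n} p a b.
Arguments rr {F n} p s a b.

Section ScalarYangBaxter.
Variables (F : fieldType) (n : nat).

(** The coefficients only depend on the relative order of the three indices, so each possible order
    leaves an identity of rational functions in p. *)
Lemma YBE_scalar p s (T : 'I_n -> 'I_n -> 'I_n -> F) a b c : p != 0 ->
  op12 *%R p s (op13 *%R p s (op23 *%R p s T)) a b c =
  op23 *%R p s (op13 *%R p s (op12 *%R p s T)) a b c.
Proof.
move=> p0; rewrite /op12 /op13 /op23 /rop /cc /rr /lts -!val_eqE /=.
case: s; case: (ltngtP a b) => ab; case: (ltngtP a c) => ac;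
  case: (ltngtP b c) => bc; try (exfalso; lia);
  repeat match goal with H : nat_of_ord ?x = nat_of_ord ?y |- _ =>
    move/ord_inj: H => H; subst end; by field.
Qed.

(** On pairs of distinct indices the operator is unipotent with square-zero part [rr], which changes
    sign under p -> 1/p; on equal indices it is the scalar p. The triangle s stays the same. *)
Lemma rop_scalarK p s (T : 'I_n -> 'I_n -> F) a b : p != 0 ->
  rop *%R p^-1 s (rop *%R p s T) a b = T a b.
Proof.
move=> p0; rewrite /rop /cc /rr /lts -!val_eqE /=.
case: s; case: (ltngtP a b) => ab;
  repeat match goal with H : nat_of_ord ?x = nat_of_ord ?y |- _ =>
    move/ord_inj: H => H; subst end; rewrite ?invrK; by field.
Qed.
End ScalarYangBaxter.

Section AlgebraYangBaxter.
Variables (F : fieldType) (A : pzAlgType F) (n : nat).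
Implicit Types (p : F) (s : bool) (a b c i j k l : 'I_n).

Lemma scal0 : scal (0 : F) = 0 :> A.
Proof. by apply: (addIr (scal (0 : F) : A)); rewrite -scalD !add0r. Qed.

Lemma scalN (c : F) : scal (- c) = - scal c :> A.
Proof. by apply: (addIr (scal c : A)); rewrite -scalD !addNr scal0. Qed.

Definition act (c : F) (x : A) : A := scal c * x.

(* An F-linear identity between combinations of the values of a table T holds as
   soon as it holds for the indicator functions of its entries. *)
Definition lcomb (T : 'I_n -> 'I_n -> 'I_n -> A) (v : 'I_n -> 'I_n -> 'I_n -> F) : A :=
  \sum_x \sum_y \sum_z scal (v x y z) * T x y z.

Lemma lcombD T v w : lcomb T v + lcomb T w = lcomb T (fun x y z => v x y z + w x y z).
Proof.
rewrite /lcomb -big_split; apply: eq_bigr => x _; rewrite -big_split.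
apply: eq_bigr => y _; rewrite -big_split; apply: eq_bigr => z _ /=.
by rewrite scalD mulrDl.
Qed.

Lemma lcombZ T d v : act d (lcomb T v) = lcomb T (fun x y z => d * v x y z).
Proof.
rewrite /act /lcomb mulr_sumr; apply: eq_bigr => x _; rewrite mulr_sumr.
apply: eq_bigr => y _; rewrite mulr_sumr; apply: eq_bigr => z _ /=.
by rewrite scalM mulrA.
Qed.

Lemma lcomb_delta T a b c :
  T a b c = lcomb T (fun x y z => [&& a == x, b == y & c == z]%:R).
Proof.
rewrite /lcomb (bigD1 a) //= (bigD1 b) //= (bigD1 c) //= !eqxx scal1 mul1r.
rewrite big1 ?addr0 => [|z]; last by rewrite eq_sym => /negPf->; rewrite scal0 mul0r.
rewrite big1 ?addr0 => [|y]; last first.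
  by rewrite eq_sym => /negPf->; rewrite big1 // => z _; rewrite scal0 mul0r.
rewrite big1 ?addr0 // => x; rewrite eq_sym => /negPf->.
by rewrite big1 // => y _; rewrite big1 // => z _; rewrite scal0 mul0r.
Qed.

Lemma lcomb_rop T p s (w : 'I_n -> 'I_n -> 'I_n -> 'I_n -> 'I_n -> F) a b :
  rop act p s (fun a b => lcomb T (w a b)) a b =
  lcomb T (fun x y z => rop *%R p s (fun a b => w a b x y z) a b).
Proof. by rewrite /rop !lcombZ lcombD. Qed.

Lemma YBE p s T a b c : p != 0 ->
  op12 act p s (op13 act p s (op23 act p s T)) a b c =
  op23 act p s (op13 act p s (op12 act p s T)) a b c.
Proof.
move=> p0; pose d a b c (x y z : 'I_n) : F := [&& a == x, b == y & c == z]%:R.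
have -> : T = fun a b c => lcomb T (d a b c).
  by do 3![apply: funext => ?]; exact: lcomb_delta.
have E12 w : op12 act p s (fun a b c => lcomb T (w a b c)) =
    fun a b c => lcomb T (fun x y z => op12 *%R p s (fun a b c => w a b c x y z) a b c).
  by do 3![apply: funext => ?]; rewrite /op12 lcomb_rop.
have E13 w : op13 act p s (fun a b c => lcomb T (w a b c)) =
    fun a b c => lcomb T (fun x y z => op13 *%R p s (fun a b c => w a b c x y z) a b c).
  by do 3![apply: funext => ?]; rewrite /op13 lcomb_rop.
have E23 w : op23 act p s (fun a b c => lcomb T (w a b c)) =
    fun a b c => lcomb T (fun x y z => op23 *%R p s (fun a b c => w a b c x y z) a b c).
  by do 3![apply: funext => ?]; rewrite /op23 lcomb_rop.
rewrite E23 E13 E12 E12 E13 E23; congr lcomb.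
by do 3![apply: funext => ?]; rewrite YBE_scalar.
Qed.

Lemma ropK p s (T : 'I_n -> 'I_n -> A) a b : p != 0 ->
  rop act p^-1 s (rop act p s T) a b = T a b.
Proof.
move=> p0; pose S := fun a b (c : 'I_n) => T a b.
have ES a' b' : T a' b' = S a' b' a by [].
have -> : T = fun a' b' => lcomb S (fun x y z => [&& a' == x, b' == y & a == z]%:R).
  by do 2![apply: funext => ?]; rewrite -lcomb_delta.
rewrite [LHS](_ : _ = rop act p^-1 s (fun a' b' => lcomb S (fun x y z =>
  rop *%R p s (fun a' b' => [&& a' == x, b' == y & a == z]%:R) a' b')) a b); last first.
  by congr (rop act _ _ _ _ _); do 2![apply: funext => ?]; rewrite lcomb_rop.
rewrite lcomb_rop; congr lcomb; do 3![apply: funext => ?].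
by rewrite rop_scalarK.
Qed.

Lemma ropVK p s (T : 'I_n -> 'I_n -> A) a b : p != 0 ->
  rop act p s (rop act p^-1 s T) a b = T a b.
Proof. by move=> p0; rewrite -{1}(invrK p) ropK ?invr_eq0. Qed.

End AlgebraYangBaxter.

(** * RLL relations *)

Section RLLRelation.
Variables (F : fieldType) (A : pzAlgType F) (n : nat).
Implicit Types (p : F) (s : bool) (a b c i j k l : 'I_n) (X Y : 'M[A]_n).

Lemma actD (d : F) : {morph (@act F A) d : x y / x + y}.
Proof. by move=> x y; rewrite /act mulrDr. Qed.

Lemma act0 (d : F) : act d 0 = 0 :> A.
Proof. by rewrite /act mulr0. Qed.

Lemma actN (d : F) (x : A) : act d (- x) = - act d x.
Proof. by rewrite /act mulrN. Qed.

Lemma act_sum (d : F) I (r : seq I) (P : pred I) (f : I -> A) :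
  act d (\sum_(i <- r | P i) f i) = \sum_(i <- r | P i) act d (f i).
Proof. by rewrite /act mulr_sumr. Qed.

Lemma actMl (d : F) (x y : A) : act d (x * y) = act d x * y.
Proof. by rewrite /act mulrA. Qed.

Lemma actMr (d : F) (x y : A) : act d (x * y) = x * act d y.
Proof. by rewrite /act mulrA scalC mulrA. Qed.

Lemma act1 (x : A) : act 1 x = x.
Proof. by rewrite /act scal1 mul1r. Qed.

Lemma act0l (x : A) : act 0 x = 0.
Proof. by rewrite /act scal0 mul0r. Qed.

Lemma actA (c d : F) (x : A) : act c (act d x) = act (c * d) x.
Proof. by rewrite /act scalM mulrA. Qed.

Lemma actDl (c d : F) (x : A) : act (c + d) x = act c x + act d x.
Proof. by rewrite /act scalD mulrDl. Qed.

Lemma actNl (d : F) (x : A) : act (- d) x = - act d x.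
Proof. by rewrite /act scalN mulNr. Qed.

Lemma rop_sum p s I (r : seq I) (P : pred I) (f : I -> 'I_n -> 'I_n -> A) a b :
  rop (@act F A) p s (fun a b => \sum_(i <- r | P i) f i a b) a b =
  \sum_(i <- r | P i) rop (@act F A) p s (f i) a b.
Proof. by rewrite /rop !act_sum -big_split. Qed.

Lemma rop_mulr p s (f : 'I_n -> 'I_n -> A) x a b :
  rop (@act F A) p s (fun a b => f a b * x) a b = rop (@act F A) p s f a b * x.
Proof. by rewrite /rop !actMl mulrDl. Qed.

Lemma rop_mull p s (f : 'I_n -> 'I_n -> A) x a b :
  rop (@act F A) p s (fun a b => x * f a b) a b = x * rop (@act F A) p s f a b.
Proof. by rewrite /rop !actMr mulrDr. Qed.

Lemma rop_rop p s p' s' (T : 'I_n -> 'I_n -> 'I_n -> 'I_n -> A) a b c d :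
  rop (@act F A) p s (fun a b => rop (@act F A) p' s' (T a b) c d) a b =
  rop (@act F A) p' s' (fun c d => rop (@act F A) p s (fun a b => T a b c d) a b) c d.
Proof.
by rewrite /rop !actD !actA addrACA ![_ * cc p a b]mulrC ![_ * rr p s a b]mulrC.
Qed.

(* The entry ((i, k), (j, l)) of R X_1 Y_2 = Y_2 X_1 R, where R is the coefficient
   of z (p = q, s = true) or minus that of 1/z (p = 1/q, s = false) in R_12(z). *)
Definition RLL p s X Y := forall i k j l,
  rop (@act F A) p s (fun i k => X i j * Y k l) i k =
  rop (@act F A) p (~~ s) (fun j l => Y k l * X i j) j l.

(** Multiplying by R^-1 on both sides exchanges X and Y and inverts p; exchanging the two spaces
    then reverses the triangle. Hence the coefficients of z and 1/z in R_12(z) give equivalent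
    relations, with X and Y exchanged. *)
Lemma RLL_flip p s X Y : p != 0 -> RLL p s X Y -> RLL p^-1 (~~ s) Y X.
Proof.
move=> p0 XY i k j l; rewrite negbK.
have flip r u (T : 'I_n -> 'I_n -> A) a b :
    rop (@act F A) r (~~ u) T a b = rop (@act F A) r u (fun a b => T b a) b a.
  by rewrite /rop rrC ccC.
rewrite flip [RHS](_ : _ = rop (@act F A) p^-1 (~~ s) (fun l j => X k l * Y i j) l j); last first.
  by rewrite flip.
pose rX := rop (@act F A) p^-1 s
  (fun k i => rop (@act F A) p^-1 (~~ s) (fun l j => rop (@act F A) p s (fun k i => X k l * Y i j) k i) l j) k i.
have -> : rop (@act F A) p^-1 (~~ s) (fun l j => X k l * Y i j) l j = rX.
  rewrite /rX rop_rop; congr (rop _ _ _ _ _ _); apply: funext => l'; apply: funext => j'.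
  by rewrite ropK.
have E1 : (fun k' i' => rop (@act F A) p^-1 (~~ s)
             (fun l j => rop (@act F A) p s (fun k i => X k l * Y i j) k' i') l j)
    = fun k' i' => Y i' j * X k' l.
  apply: funext => k'; apply: funext => i'.
  rewrite -[RHS](ropK (~~ s) (fun l j => Y i' j * X k' l) l j p0).
  congr (rop _ _ _ _ _ _); apply: funext => l'; apply: funext => j'.
  exact: XY.
by rewrite /rX E1.
Qed.

Lemma rop_sum2 p s (f : 'I_n -> 'I_n -> 'I_n -> 'I_n -> A) a b :
  rop (@act F A) p s (fun a b => \sum_m \sum_t f a b m t) a b =
  \sum_m \sum_t rop (@act F A) p s (fun a b => f a b m t) a b.
Proof. by rewrite rop_sum; apply: eq_bigr => m _; rewrite rop_sum. Qed.

(** Exchanging the two summation indices transposes the triangular part of R. This lets R pass from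
    the column indices of one product to the row indices of the next. *)
Lemma rop_adjoint p s (f g : 'I_n -> 'I_n -> A) :
  \sum_m \sum_t rop (@act F A) p (~~ s) f m t * g m t =
  \sum_m \sum_t f m t * rop (@act F A) p s g m t.
Proof.
rewrite /rop.
under eq_bigr do (under eq_bigr do rewrite mulrDl; rewrite big_split /=).
rewrite big_split /= [X in _ + X]exchange_big -big_split /=.
apply: eq_bigr => m _; rewrite -big_split; apply: eq_bigr => t _ /=.
by rewrite rrC -!actMl !actMr -mulrDr.
Qed.

(** Compatibility with the coproduct: R crosses X_1 Y_2, then X'_1 Y'_2, and the commutation
    hypotheses, satisfied by distinct sites, regroup the factors. *)
Lemma RLL_mul p s X Y X' Y' : RLL p s X Y -> RLL p s X' Y' ->
    (forall i j k l, GRing.comm (X i j) (Y' k l)) ->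
    (forall i j k l, GRing.comm (X' i j) (Y k l)) ->
  RLL p s (X *m X') (Y *m Y').
Proof.
move=> XY XY' cXY' cX'Y i k j l.
transitivity (\sum_m \sum_t rop (@act F A) p s (fun i k => X i m * Y k t) i k * (X' m j * Y' t l)).
  rewrite [LHS](_ : _ = rop (@act F A) p s
    (fun i k => \sum_m \sum_t (X i m * Y k t) * (X' m j * Y' t l)) i k).
    rewrite rop_sum2; apply: eq_bigr => m _; apply: eq_bigr => t _.
    by rewrite rop_mulr.
  congr (rop _ _ _ _ _ _); apply: funext => i'; apply: funext => k'.
  rewrite !mxE mulr_suml; apply: eq_bigr => m _.
  rewrite mulr_sumr; apply: eq_bigr => t _.
  by rewrite -!mulrA; congr (_ * _); rewrite !mulrA cX'Y.
under eq_bigr do under eq_bigr do rewrite XY.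
rewrite rop_adjoint.
under eq_bigr do under eq_bigr do rewrite XY' -rop_mull.
rewrite -rop_sum2; congr (rop _ _ _ _ _ _); apply: funext => j'; apply: funext => l'.
rewrite exchange_big !mxE mulr_suml; apply: eq_bigr => t _ /=.
rewrite mulr_sumr; apply: eq_bigr => m _.
by rewrite -!mulrA; congr (_ * _); rewrite !mulrA cXY'.
Qed.

(** The Hecke relation R - R_21^-1 = (p - 1/p) P, with P the permutation: inverting p and reversing
    s turns R into R_21^-1. *)
Lemma rop_sub p s (T : 'I_n -> 'I_n -> A) a b : p != 0 ->
  rop (@act F A) p s T a b - rop (@act F A) p^-1 (~~ s) T a b = act (p - p^-1) (T b a).
Proof.
move=> p0; rewrite /rop opprD addrACA -!actNl -!actDl rrC rrV opprK /cc /rr.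
case: (eqVneq a b) => [->|ab]; first by rewrite ltsxx addr0 act0l addr0.
rewrite subrr act0l add0r; case/orP: (lts_total s ab) => h.
  by rewrite h (ltsF h) addr0.
by rewrite h (ltsF h) add0r.
Qed.

(** By the Hecke relation each of the four terms can be moved to a side of a known RLL relation, at
    the cost of a permuted product; these products cancel. This is the coefficient to which both
    powers of z in R_12(z) contribute, needed for the evaluation morphism. *)
Lemma RLL_mixed p s X Y : p != 0 -> RLL p^-1 (~~ s) X Y -> forall i k j l,
  rop (@act F A) p s (fun i k => X i j * Y k l) i k -
    rop (@act F A) p^-1 (~~ s) (fun i k => Y i j * X k l) i k =
  rop (@act F A) p (~~ s) (fun j l => Y k l * X i j) j l -
    rop (@act F A) p^-1 s (fun j l => X k l * Y i j) j l.
Proof.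
move=> p0 XY i k j l.
have pV0 : p^-1 != 0 by rewrite invr_eq0.
have YX := RLL_flip pV0 XY; rewrite invrK negbK in YX.
have sr t (T : 'I_n -> 'I_n -> A) a b := rop_sub t T a b p0.
have E1 := sr s (fun i k => X i j * Y k l) i k.
have E2 := sr s (fun i k => Y i j * X k l) i k.
have E3 := sr (~~ s) (fun j l => Y k l * X i j) j l.
have E4 := sr (~~ s) (fun j l => X k l * Y i j) j l.
move/eqP: E1; rewrite subr_eq => /eqP ->.
move/eqP: E3; rewrite subr_eq => /eqP ->.
move: E2 E4 (XY i k j l); rewrite !negbK YX => E2 E4 ->.
set u := rop _ p _ _ _ _ in E2 E4.
have -> : rop (@act F A) p^-1 (~~ s) (fun i k => Y i j * X k l) i k =
  u - act (p - p^-1) (Y k j * X i l) by rewrite -E2 opprB addrC subrK.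
have -> : rop (@act F A) p^-1 s (fun j l => X k l * Y i j) j l =
  u - act (p - p^-1) (X k j * Y i l) by rewrite -E4 opprB addrC subrK.
rewrite !opprB; set x := act _ _; set y := act _ _; set v := rop _ _ _ _ _ _.
by rewrite addrACA [x + y]addrC addrACA.
Qed.
End RLLRelation.

Section RLLMorphism.
Variables (F : fieldType) (A B : pzAlgType F) (n : nat) (phi : {rmorphism A -> B}).
Hypothesis phi_scal : forall c : F, phi (scal c) = scal c.

Lemma rop_morph p s (T : 'I_n -> 'I_n -> A) a b :
  phi (rop (@act F A) p s T a b) = rop (@act F B) p s (fun a b => phi (T a b)) a b.
Proof. by rewrite /rop rmorphD /act !rmorphM !phi_scal. Qed.

Lemma RLL_map p s (X Y : 'M[A]_n) : RLL p s X Y -> RLL p s (map_mx phi X) (map_mx phi Y).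
Proof.
move=> XY i k j l; have:= congr1 phi (XY i k j l); rewrite !rop_morph.
rewrite /rop !mxE !rmorphM; exact.
Qed.
End RLLMorphism.

(** * Coefficients of R_12(z) as constant R-matrices *)

Section RMatrixEntries.
Variables (F : fieldType) (q : F) (n : nat) (A : pzAlgType F).
Implicit Types (X Y : 'M[A]_n).

(** The coefficient of z^([rexp s]) in R_12(z) is [rsgn s] times the constant R-matrix of parameter
    [rpar s] and triangle s; the sign normalises the entries E_aa (x) E_bb with a != b to 1. *)
Definition rexp (s : bool) : int := if s then 1 else -1.
Definition rpar (s : bool) : F := if s then q else q^-1.
Definition rsgn (s : bool) : F := if s then 1 else -1.

Lemma Rcoef_entry s (i k j l : 'I_n) :
  Rcoef q n (rexp s) (mxtens_index (i, k)) (mxtens_index (j, l)) =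
  rsgn s * (cc (rpar s) i k * ((i == j) && (k == l))%:R
            + rr (rpar s) s i k * ((i == l) && (k == j))%:R).
Proof.
rewrite /Rcoef !mxE !summxE.
under eq_bigr do rewrite tensmxE !mxE.
rewrite [X in bcoef _ _ * X](_ : _ = \sum_(a < n) \sum_(b < n | a != b)
    ((i == a) && (j == a))%:R * ((k == b) && (l == b))%:R); last first.
  by apply: eq_bigr => a _; rewrite summxE; apply: eq_bigr => b _; rewrite tensmxE !mxE.
rewrite [X in (q - q^-1) * X](_ : _ = \sum_(a < n) \sum_(b < n | a != b)
    (rexp s == sgz (b%:Z - a%:Z))%:R *
      (((i == a) && (j == b))%:R * ((k == b) && (l == a))%:R)); last first.
  by apply: eq_bigr => a _; rewrite summxE; apply: eq_bigr => b _; rewrite mxE tensmxE !mxE.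
have -> : \sum_(a < n) ((i == a) && (j == a))%:R * ((k == a) && (l == a))%:R =
   [&& i == j, k == l & i == k]%:R :> F.
  rewrite (bigD1 i) //= eqxx big1 ?addr0; last first.
    by move=> a; rewrite eq_sym => /negPf->; rewrite mul0r.
  rewrite -natrM mulnb; congr (nat_of_bool _)%:R.
  by apply/and3P/and3P => -[/eqP h1 /eqP h2 /eqP h3]; subst; rewrite ?eqxx; split.

have -> : \sum_(a < n) \sum_(b < n | a != b)
     ((i == a) && (j == a))%:R * ((k == b) && (l == b))%:R =
   [&& i == j, k == l & i != k]%:R :> F.
  rewrite (bigD1 i) //= [X in _ + X]big1 ?addr0; last first.
    by move=> a; rewrite eq_sym => /negPf->; rewrite big1 // => b _; rewrite mul0r.
  rewrite (bigID (pred1 k)) /= [X in _ + X]big1 ?addr0; last first.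
    by move=> b /andP[_ /negPf bk]; rewrite [k == b]eq_sym bk mulr0.
  under eq_bigl do rewrite andbC.
  case: (eqVneq i k) => [<-|ik]; first by rewrite !andbF big_pred0 // => b; case: eqP => // ->; rewrite eqxx.
  rewrite (big_pred1 k) => [|b]; last by rewrite /= andb_idr // => /eqP->.
  by rewrite -natrM mulnb !eqxx /= andbT [j == i]eq_sym [l == k]eq_sym.
have -> : \sum_(a < n) \sum_(b < n | a != b)
     (rexp s == sgz (b%:Z - a%:Z))%:R * (((i == a) && (j == b))%:R * ((k == b) && (l == a))%:R) =
   [&& i == l, k == j & lts s i k]%:R :> F.
  rewrite (bigD1 i) //= [X in _ + X]big1 ?addr0; last first.
    by move=> a; rewrite eq_sym => /negPf->; rewrite big1 // => b _; rewrite mul0r mulr0.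
  rewrite (bigID (pred1 k)) /= [X in _ + X]big1 ?addr0; last first.
    by move=> b /andP[_ /negPf bk]; rewrite [k == b]eq_sym bk !mulr0.
  under eq_bigl do rewrite andbC.
  case: (eqVneq i k) => [<-|ik].
    by rewrite ltsxx !andbF big_pred0 // => b; case: eqP => // ->; rewrite eqxx.
  rewrite (big_pred1 k) => [|b]; last by rewrite /= andb_idr // => /eqP->.
  rewrite -!natrM !mulnb !eqxx /= [l == i]eq_sym [j == k]eq_sym.
  have -> : (rexp s == sgz (k%:Z - i%:Z)) = lts s i k.
    by rewrite /rexp /lts; case: s; move: ik; rewrite -val_eqE /=; lia.
  by case: (i == l); case: (k == j); case: lts.
rewrite /acoef /bcoef /rsgn /rpar /rr /cc.
case: s => /=; case: (eqVneq i k) => [<-|ik]; rewrite ?ltnn ?andbF ?andbT /=;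
  case: (i == j); case: (k == l); case: (i == l); case: (k == j) => //=;
  try (case: ltngtP => _ /=); rewrite ?invrK; ring.
Qed.
End RMatrixEntries.

Section RLLMatrix.
Variables (F : fieldType) (q : F) (n : nat) (A : pzAlgType F).
Implicit Types (X Y : 'M[A]_n).

Lemma sum_mxtens (V : nmodType) (f : 'I_(n * n) -> V) :
  \sum_u f u = \sum_i \sum_k f (mxtens_index (i, k)).
Proof.
rewrite pair_big (reindex (@mxtens_index n n)) /=.
  by apply: eq_bigr => -[i k].
by exists (@mxtens_unindex n n) => u _; rewrite ?mxtens_indexK ?mxtens_unindexK.
Qed.

Lemma in1_in2_entry X Y i k j l :
  (in1 X *m in2 Y) (mxtens_index (i, k)) (mxtens_index (j, l)) = X i j * Y k l.
Proof.
rewrite !mxE sum_mxtens (bigD1 j) //= (bigD1 k) //= !tensmxE !mxE !eqxx.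
rewrite mulr1 mul1r big1 ?addr0 => [|k' /negPf kk']; last first.
  by rewrite !tensmxE !mxE eq_sym kk' mulr0 mul0r.
rewrite big1 ?addr0 // => j' /negPf jj'; rewrite big1 // => k' _.
by rewrite !tensmxE !mxE jj' mul0r mulr0.
Qed.

Lemma in2_in1_entry X Y i k j l :
  (in2 Y *m in1 X) (mxtens_index (i, k)) (mxtens_index (j, l)) = Y k l * X i j.
Proof.
rewrite !mxE sum_mxtens (bigD1 i) //= (bigD1 l) //= !tensmxE !mxE !eqxx.
rewrite mulr1 mul1r big1 ?addr0 => [|k' /negPf kk']; last first.
  by rewrite !tensmxE !mxE kk' mulr0 mulr0.
rewrite big1 ?addr0 // => j' /negPf jj'; rewrite big1 // => k' _.
by rewrite !tensmxE !mxE eq_sym jj' mul0r mul0r.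
Qed.

Lemma RcoefA_entry s i k j l :
  RcoefA q n A (rexp s) (mxtens_index (i, k)) (mxtens_index (j, l)) =
  scal (rsgn F s) * (scal (cc (rpar q s) i k) * ((i == j) && (k == l))%:R
                   + scal (rr (rpar q s) s i k) * ((i == l) && (k == j))%:R).
Proof.
have natS (b : bool) : scal (b%:R : F) = b%:R :> A by case: b; rewrite ?scal1 ?scal0.
by rewrite mxE Rcoef_entry scalM scalD !scalM !natS.
Qed.

Lemma RXY_entry s X Y i k j l :
  (RcoefA q n A (rexp s) *m in1 X *m in2 Y) (mxtens_index (i, k)) (mxtens_index (j, l)) =
  act (rsgn F s) (rop (@act F A) (rpar q s) s (fun i k => X i j * Y k l) i k).
Proof.
rewrite -mulmxA mxE sum_mxtens.
under eq_bigr do under eq_bigr do rewrite in1_in2_entry RcoefA_entry -mulrA mulrDl -!mulrA.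
under eq_bigr do rewrite -mulr_sumr big_split -!mulr_sumr /=.
rewrite -mulr_sumr; congr (_ * _).
rewrite big_split -!mulr_sumr /=; congr (_ * _ + _ * _).
  rewrite (bigD1 i) //= (bigD1 k) //= !eqxx mul1r big1 ?addr0 => [|k' /negPf kk']; last first.
    by rewrite eq_sym kk' mul0r.
  rewrite big1 ?addr0 // => i' /negPf ii'; rewrite big1 // => k' _.
  by rewrite eq_sym ii' mul0r.
rewrite (bigD1 k) //= (bigD1 i) //= !eqxx mul1r big1 ?addr0 => [|k' /negPf kk']; last first.
  by rewrite [i == _]eq_sym kk' mul0r.
rewrite big1 ?addr0 // => i' /negPf ii'; rewrite big1 // => k' _.
by rewrite [k == _]eq_sym ii' andbF mul0r.
Qed.

Lemma YXR_entry s X Y i k j l :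
  (in2 Y *m in1 X *m RcoefA q n A (rexp s)) (mxtens_index (i, k)) (mxtens_index (j, l)) =
  act (rsgn F s) (rop (@act F A) (rpar q s) (~~ s) (fun j l => Y k l * X i j) j l).
Proof.
rewrite mxE sum_mxtens.
have swap x c1 c2 c3 (b1 b2 : bool) : x * (scal c1 * (scal c2 * b1%:R + scal c3 * b2%:R))
   = (scal c1 : A) * (scal c2 * (x * b1%:R) + scal c3 * (x * b2%:R)).
  by rewrite mulrA -scalC -mulrA mulrDr !mulrA -!scalC.
under eq_bigr do under eq_bigr do rewrite in2_in1_entry RcoefA_entry swap.
under eq_bigr do rewrite -mulr_sumr big_split /=.
rewrite -mulr_sumr; congr (_ * _).
rewrite big_split /=; congr (_ + _).
  rewrite (bigD1 j) //= (bigD1 l) //= !eqxx mulr1 big1 ?addr0 => [|k' /negPf kk']; last first.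
    by rewrite kk' andbF !mulr0.
  rewrite big1 ?addr0 // => i' /negPf ii'; rewrite big1 // => k' _.
  by rewrite ii' !mulr0.
rewrite (bigD1 l) //= (bigD1 j) //= !eqxx mulr1 big1 ?addr0 => [|k' /negPf kk']; last first.
  by rewrite kk' andbF !mulr0.
rewrite big1 ?addr0 => [|i' /negPf ii'].
  by rewrite rrC.
by rewrite big1 // => k' _; rewrite ii' !mulr0.
Qed.

Lemma rsgnK s (x : A) : act (rsgn F s) (act (rsgn F s) x) = x.
Proof.
by rewrite actA /rsgn; case: s; rewrite ?mulrNN mulr1 act1.
Qed.

Lemma RLL_mx s X Y :
  RLL (rpar q s) s X Y <->
  RcoefA q n A (rexp s) *m in1 X *m in2 Y = in2 Y *m in1 X *m RcoefA q n A (rexp s).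
Proof.
split=> [XY|XY i k j l].
  apply/matrixP => u v; case: (mxtens_indexP u) => i k; case: (mxtens_indexP v) => j l.
  by rewrite RXY_entry YXR_entry XY.
have := congr1 (fun M : 'M_(n * n) => M (mxtens_index (i, k)) (mxtens_index (j, l))) XY.
by rewrite RXY_entry YXR_entry => /(congr1 (act (rsgn F s))); rewrite !rsgnK.
Qed.

End RLLMatrix.

Section RLLMatrixMorphism.
Variables (F : fieldType) (q : F) (n : nat) (A B : pzAlgType F) (phi : {rmorphism A -> B}).
Hypothesis phi_scal : forall c : F, phi (scal c) = scal c.

Lemma map_RcoefA e : map_mx phi (RcoefA q n A e) = RcoefA q n B e.
Proof. by apply/matrixP => i j; rewrite !mxE phi_scal. Qed.

Lemma map_in1 (X : 'M[A]_n) : map_mx phi (in1 X) = in1 (map_mx phi X).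
Proof. by apply/matrixP => i j; rewrite !mxE rmorphM rmorphMn rmorph1. Qed.

Lemma map_in2 (X : 'M[A]_n) : map_mx phi (in2 X) = in2 (map_mx phi X).
Proof. by apply/matrixP => i j; rewrite !mxE rmorphM rmorphMn rmorph1. Qed.

Lemma map_RXY (X Y : int -> 'M[A]_n) m p :
  map_mx phi (RXY q X Y m p) = RXY q (fun m => map_mx phi (X m)) (fun p => map_mx phi (Y p)) m p.
Proof.
rewrite /RXY; elim/big_rec2: _ => [|e x y _ <-]; first by rewrite map_mx0.
by rewrite map_mxD !map_mxM map_RcoefA map_in1 map_in2.
Qed.

Lemma map_YXR (X Y : int -> 'M[A]_n) m p :
  map_mx phi (YXR q X Y m p) = YXR q (fun m => map_mx phi (X m)) (fun p => map_mx phi (Y p)) m p.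
Proof.
rewrite /YXR; elim/big_rec2: _ => [|e x y _ <-]; first by rewrite map_mx0.
by rewrite map_mxD !map_mxM map_RcoefA map_in1 map_in2.
Qed.

Lemma map_zseries s (X : nat -> 'M[A]_n) m :
  map_mx phi (zseries s X m) = zseries s (fun k => map_mx phi (X k)) m.
Proof. by rewrite /zseries; case: ifP; rewrite ?map_mx0. Qed.
End RLLMatrixMorphism.

(** * Presented algebras and tensor products *)

Section PresentationLift.
Variables (F : fieldType) (X : Type) (B : pzAlgType F) (g : X -> B).

Fixpoint eval (e : expr F X) : B :=
  match e with
  | EGen x => g x
  | ECst c => scal c
  | EAdd e f => eval e + eval f
  | EMul e f => eval e * eval f
  end.

Section Lift.
Variable r : expr F X -> expr F X -> Prop.
Hypothesis r_eval : forall e f, r e f -> eval e = eval f.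

Lemma cong_eval e f : cong r e f -> eval e = eval f.
Proof.
elim=> //= {e f}.
- by move=> e f g' _ -> _ ->.
- by move=> e e' f f' _ -> _ ->.
- by move=> e e' f f' _ -> _ ->.
- by move=> e f g'; rewrite addrA.
- by move=> e f; rewrite addrC.
- by move=> e; rewrite scal0 add0r.
- by move=> e f g'; rewrite mulrA.
- by move=> e; rewrite scal1 mul1r.
- by move=> e; rewrite scal0 mul0r.
- by move=> e f g'; rewrite mulrDl.
- by move=> e f g'; rewrite mulrDr.
- by move=> c d; rewrite scalD.
- by move=> c d; rewrite scalM.
- by move=> c e; rewrite scalC.
Qed.

Definition plift (u : pquot r) : B := eval (prep u).

Lemma plift_cls e : plift (pcls r e) = eval e.
Proof. exact/cong_eval/cong_prep. Qed.

Lemma pquot_lift : exists phi : {rmorphism pquot r -> B},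
  (forall x, phi (pcls r (EGen F x)) = g x) /\ (forall c : F, phi (scal c) = scal c).
Proof.
have padditive : zmod_morphism plift.
  move=> u v; elim/pquotP: u => e; elim/pquotP: v => f.
  have -> : pcls r e - pcls r f = pcls r (EAdd e (EMul (ECst X (-1)) f)).
    by rewrite -[- pcls r f]/(popp (pcls r f)) poppE -[LHS]/(padd _ _) paddE.
  by rewrite !plift_cls /= scalN scal1 mulN1r.
have pmultiplicative : monoid_morphism plift.
  split=> [|u v]; first by rewrite -[1]/(pcls r (ECst X 1)) plift_cls /= scal1.
  elim/pquotP: u => e; elim/pquotP: v => f.
  by rewrite -[pcls r e * _]/(pmul _ _) pmulE !plift_cls.
pose phiA := GRing.isZmodMorphism.Build _ _ plift padditive.
pose phiM := GRing.isMonoidMorphism.Build _ _ plift pmultiplicative.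
pose phi : {rmorphism pquot r -> B} := HB.pack plift phiA phiM.
exists phi; split=> [x|c]; first exact: plift_cls.
exact: (plift_cls (ECst X c)).
Qed.
End Lift.

Lemma freeAlg_lift : exists phi : {rmorphism freeAlg F X -> B},
  [/\ forall x, phi (fgen F x) = g x, forall c : F, phi (scal c) = scal c
    & forall e, phi (pcls _ e) = eval e].
Proof.
have r0 (e f : expr F X) : False -> eval e = eval f by [].
have [phi [phig phic]] := pquot_lift r0.
exists phi; split=> //; elim=> //= [e IHe f IHf|e IHe f IHf].
  by rewrite -IHe -IHf -rmorphD -paddE.
by rewrite -IHe -IHf -rmorphM -pmulE.
Qed.

(** The relations are stated in the free algebra, so they are tested through an arbitrary morphism
    that extends g; such a morphism is only available through an existence statement. *)
Lemma presAlg_lift (r : freeAlg F X -> freeAlg F X -> Prop) :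
    (forall phi : {rmorphism freeAlg F X -> B},
       (forall x, phi (fgen F x) = g x) -> (forall c : F, phi (scal c) = scal c) ->
       forall u v, r u v -> phi u = phi v) ->
  exists phi : {rmorphism presAlg r -> B},
    (forall x, phi (pgen r x) = g x) /\ (forall c : F, phi (scal c) = scal c).
Proof.
move=> rB; have [phi [phig phic phiE]] := freeAlg_lift.
apply: pquot_lift => e f /(rB phi phig phic).
by rewrite !phiE.
Qed.
End PresentationLift.

Section PresentationInduction.
Variables (F : fieldType) (X : Type) (r : freeAlg F X -> freeAlg F X -> Prop).

Lemma presAlg_rel u v : r u v -> forall (phi : {rmorphism freeAlg F X -> presAlg r}),
  (forall x, phi (fgen F x) = pgen r x) -> (forall c : F, phi (scal c) = scal c) ->
  phi u = phi v.
Proof.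
move=> ruv phi phig phic.
have phiE e : phi (pcls _ e) = pcls _ e.
  elim: e => [x|c|e IHe f IHf|e IHe f IHf]; [exact: phig|exact: phic| |].
    by rewrite -paddE rmorphD IHe IHf -[LHS]/(padd _ _) paddE.
  by rewrite -pmulE rmorphM IHe IHf -[LHS]/(pmul _ _) pmulE.
elim/pquotP: u ruv => e; elim/pquotP: v => f ref.
by rewrite !phiE; apply/pclsP/cong_rel.
Qed.

Lemma presAlg_map : exists phi : {rmorphism freeAlg F X -> presAlg r},
  [/\ forall x, phi (fgen F x) = pgen r x, forall c : F, phi (scal c) = scal c
    & forall u v, r u v -> phi u = phi v].
Proof.
have [phi [phig phic _]] := freeAlg_lift (fun x => pgen r x).
by exists phi; split=> // u v ruv; exact: presAlg_rel.
Qed.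

(** Words grow on the right: the operators of the coinduced module are known at u * x, for a
    generator x, through values at u. *)
Lemma presAlg_right_ind (P : presAlg r -> Prop) :
    P 1 -> (forall u v, P u -> P v -> P (u + v)) ->
    (forall c u, P u -> P (u * scal c)) -> (forall u x, P u -> P (u * pgen r x)) ->
  forall u, P u.
Proof.
move=> P1 PD Pc Px u; rewrite -[u]mul1r; elim/pquotP: u => e.
elim: e 1 P1 => [x|c|e IHe f IHf|e IHe f IHf] v Pv; [exact: Px|exact: Pc| |].
  have -> : pcls _ (EAdd e f) = (pcls _ e : presAlg r) + pcls _ f by rewrite -paddE.
  by rewrite mulrDr; apply: PD; [exact: IHe|exact: IHf].
have -> : pcls _ (EMul e f) = (pcls _ e : presAlg r) * pcls _ f by rewrite -pmulE.
by rewrite mulrA; apply/IHf/IHe.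
Qed.

Lemma presAlg_ind (P : presAlg r -> Prop) :
    (forall c, P (scal c)) -> (forall u v, P u -> P v -> P (u + v)) ->
    (forall u v, P u -> P v -> P (u * v)) -> (forall x, P (pgen r x)) ->
  forall u, P u.
Proof.
move=> Pc PD PM Px; elim/pquotP; elim=> [x|c|e Pe f Pf|e Pe f Pf]; [exact: Px|exact: Pc| |].
  by rewrite -paddE; exact: PD.
by rewrite -pmulE; exact: PM.
Qed.
End PresentationInduction.

(** * Universal property of the tensor product *)

Section TensorTheory.
Variables (F : fieldType) (I : finType) (A : I -> pzAlgType F).

Lemma pure_lin (x : forall i, A i) i (c : F) (u v : A i) :
  pure (dfwith x (scal c * u + v)) = scal c * pure (dfwith x u) + pure (dfwith x v).
Proof.
have [phi [phig phic phir]] := presAlg_map (@tensor_rel F I A).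
by have := phir _ _ (tensor_lin x c u v); rewrite rmorphD rmorphM !phig phic.
Qed.

Lemma pure_mul (x y : forall i, A i) : pure x * pure y = pure (fun i => x i * y i).
Proof.
have [phi [phig phic phir]] := presAlg_map (@tensor_rel F I A).
by have := phir _ _ (tensor_mul x y); rewrite rmorphM !phig.
Qed.

Lemma pure_one : pure (fun i => 1 : A i) = 1.
Proof.
have [phi [phig phic phir]] := presAlg_map (@tensor_rel F I A).
by have := phir _ _ (tensor_one A); rewrite rmorph1 !phig.
Qed.

Lemma dfwith_self (x : forall i, A i) i : dfwith x (x i) = x.
Proof.
by apply: functional_extensionality_dep => j; case: dfwithP.
Qed.

Lemma tensor_in1 i : tensor_in (1 : A i) = 1.
Proof. by rewrite /tensor_in (dfwith_self (fun j => 1 : A j)) pure_one. Qed.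

Lemma tensor_inM i : {morph @tensor_in F I A i : u v / u * v}.
Proof.
move=> u v; rewrite /tensor_in pure_mul; congr pure.
apply: functional_extensionality_dep => j; case: dfwithP => [|j' ij]; first by rewrite !dfwith_in.
by rewrite !dfwith_out // mulr1.
Qed.

Lemma tensor_in0 i : tensor_in (0 : A i) = 0.
Proof.
have := pure_lin (fun j => 1 : A j) 1 (0 : A i) 0; rewrite mulr0 addr0 scal1 mul1r => E.
by apply: (addIr (tensor_in (0 : A i))); rewrite add0r -[LHS]E.
Qed.

Lemma tensor_inD i : {morph @tensor_in F I A i : u v / u + v}.
Proof.
move=> u v; have := pure_lin (fun j => 1 : A j) 1 u v.
by rewrite !scal1 !mul1r.
Qed.

Lemma tensor_in_scal i c : tensor_in (scal c : A i) = scal c.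
Proof.
have := pure_lin (fun j => 1 : A j) c (1 : A i) 0.
by rewrite mulr1 addr0 -/(tensor_in _) => ->; rewrite -!/(tensor_in _) tensor_in1 tensor_in0 mulr1 addr0.
Qed.

Lemma tensor_in_morph i : exists iota : {rmorphism A i -> tensor A},
  (forall u, iota u = tensor_in u) /\ forall c : F, iota (scal c) = scal c.
Proof.
have tadd : zmod_morphism (@tensor_in F I A i).
  move=> u v; apply: (addIr (tensor_in v)); rewrite -tensor_inD !subrK //.
have tmul : monoid_morphism (@tensor_in F I A i) by split; [exact: tensor_in1|exact: tensor_inM].
pose tA := GRing.isZmodMorphism.Build _ _ _ tadd.
pose tM := GRing.isMonoidMorphism.Build _ _ _ tmul.
pose iota : {rmorphism A i -> tensor A} := HB.pack (@tensor_in F I A i) tA tM.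
by exists iota; split=> // c; exact: tensor_in_scal.
Qed.

Lemma tensor_in_comm i j (u : A i) (v : A j) : i != j -> GRing.comm (tensor_in u) (tensor_in v).
Proof.
move=> ij; rewrite /GRing.comm /tensor_in !pure_mul; congr pure.
apply: functional_extensionality_dep => k.
case: dfwithP => [|k' ik]; first by rewrite dfwith_out 1?eq_sym // mul1r mulr1.
by rewrite mul1r mulr1.
Qed.

Lemma pure_prod (x : forall i, A i) : pure x = \prod_(i <- enum I) tensor_in (x i).
Proof.
have E (r : seq I) : uniq r ->
    \prod_(i <- r) tensor_in (x i) = pure (fun i => if i \in r then x i else 1).
  elim: r => [|i r IHr] /=; first by rewrite big_nil pure_one.
  case/andP=> ir /IHr{}IHr; rewrite big_cons IHr /tensor_in pure_mul; congr pure.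
  apply: functional_extensionality_dep => j; rewrite inE.
  case: dfwithP => [|k ik]; first by rewrite eqxx (negPf ir) mulr1.
  by rewrite [k == i]eq_sym (negPf ik) mul1r.
rewrite E ?enum_uniq //; congr pure; apply: functional_extensionality_dep => i.
by rewrite mem_enum.
Qed.

Lemma tensor_ind (P : tensor A -> Prop) :
    (forall c, P (scal c)) -> (forall u v, P u -> P v -> P (u + v)) ->
    (forall u v, P u -> P v -> P (u * v)) -> (forall i (a : A i), P (tensor_in a)) ->
  forall u, P u.
Proof.
move=> Pc PD PM Pt; apply: presAlg_ind => // x; rewrite -[pgen _ x]/(pure x) pure_prod.
by elim/big_ind: _ => //; rewrite -scal1.
Qed.

Variables (B : pzAlgType F) (f : forall i, {rmorphism A i -> B}).
Hypothesis f_scal : forall i c, f i (scal c) = scal c.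
Hypothesis f_comm : forall i j (u : A i) (v : A j), i != j -> GRing.comm (f i u) (f j v).

Let lift_pure (x : forall i, A i) : B := \prod_(i <- enum I) f i (x i).

Let comm_prod i (u : A i) (x : forall i, A i) (r : seq I) : i \notin r ->
  GRing.comm (f i u) (\prod_(j <- r) f j (x j)).
Proof.
elim: r => [|j r IHr]; first by rewrite big_nil => _; exact: commr1.
rewrite inE negb_or => /andP[ij ir]; rewrite big_cons.
by apply: commrM; [exact: f_comm|exact: IHr].
Qed.

Let lift_pureM (x y : forall i, A i) :
  lift_pure x * lift_pure y = lift_pure (fun i => x i * y i).
Proof.
rewrite /lift_pure; elim: (enum I) (enum_uniq I) => [|i r IHr] /=; first by rewrite !big_nil mulr1.
case/andP=> ir ur; rewrite !big_cons -IHr // rmorphM -!mulrA; congr (_ * _).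
by rewrite !mulrA; congr (_ * _); rewrite comm_prod.
Qed.

(** Isolates the only factor that depends on u, between constants y and z. This gives
    multilinearity, and for the constant family 1 the value on [tensor_in]. *)
Let lift_pure_with i (x : forall i, A i) :
  exists y z : B, (forall u : A i, lift_pure (dfwith x u) = y * f i u * z) /\
    ((forall j, x j = 1) -> y = 1 /\ z = 1).
Proof.
have [r1 [r2 [Er r1i r2i]]] : exists r1 r2, [/\ enum I = r1 ++ i :: r2, i \notin r1 & i \notin r2].
  have := enum_uniq I; have : i \in enum I by rewrite mem_enum.
  case/splitPr=> r1 r2; rewrite uniq_catC /= mem_cat negb_or => /andP[/andP[i2 i1] _].
  by exists r1, r2.
have out r (u : A i) : i \notin r ->
    \prod_(j <- r) f j (dfwith x u j) = \prod_(j <- r) f j (x j).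
  elim: r => [|j r IHr]; first by rewrite !big_nil.
  by rewrite inE negb_or => /andP[ij ir]; rewrite !big_cons IHr // dfwith_out.
exists (\prod_(j <- r1) f j (x j)), (\prod_(j <- r2) f j (x j)).
split=> [u|x1]; last by rewrite !big1 // => j _; rewrite x1 rmorph1.
by rewrite /lift_pure Er big_cat big_cons /= !out // dfwith_in mulrA.
Qed.

Lemma tensor_lift : exists phi : {rmorphism tensor A -> B},
  (forall i (u : A i), phi (tensor_in u) = f i u) /\ (forall c : F, phi (scal c) = scal c).
Proof.
have [|phi [phig phic]] := presAlg_lift (g := lift_pure) (r := @tensor_rel F I A).
  move=> phi phig phic u v; case=> {u v} [x i c u v|x y|].
  - have [y [z [E _]]] := lift_pure_with i x.
    rewrite rmorphD rmorphM phic !phig !E rmorphD rmorphM f_scal !mulrDr !mulrDl.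
    by rewrite !mulrA scalC.
  - by rewrite rmorphM !phig lift_pureM.
  - by rewrite rmorph1 phig /lift_pure big1 // => i _; rewrite rmorph1.
exists phi; split=> // i u; rewrite [LHS]phig.
have [y [z [-> []]]] := lift_pure_with i (fun k => 1) => // -> ->.
by rewrite mul1r mulr1.
Qed.
End TensorTheory.

(** * Level-zero relations and the evaluation morphism *)

Section QuantumAlgebraTheory.
Variables (F : fieldType) (q : F) (n : nat).
Hypothesis q0 : q != 0.

Lemma zseries_pos (A : pzAlgType F) s (X : nat -> 'M[A]_n) k :
  zseries s X (if s then k.*2%:Z else - k.*2%:Z) = X k.
Proof.
rewrite /zseries; case: s; rewrite ?abszN absz_nat dvdn2 odd_double -muln2 mulnK //=.
by rewrite ifT //; lia.
Qed.

Lemma zseries_neg (A : pzAlgType F) s (X : nat -> 'M[A]_n) k : (0 < k)%N ->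
  zseries s X (if s then - k%:Z else k%:Z) = 0.
Proof. by move=> k0; rewrite /zseries; case: s => /=; rewrite ifF //; apply/negbTE; lia. Qed.

Let qV0 : q^-1 != 0. Proof. by rewrite invr_eq0. Qed.

Lemma Uaff_map : exists phi : {rmorphism freeAlg F (affgen n) -> Uaff q n},
  [/\ forall s k, map_mx phi (fL F n s k) = Lgen q n s k, forall c : F, phi (scal c) = scal c
    & forall u v, aff_rel q u v -> phi u = phi v].
Proof.
have [phi [phig phic phir]] := presAlg_map (@aff_rel F q n).
by exists phi; split=> // s k; apply/matrixP => a b; rewrite !mxE.
Qed.

Lemma Lgen_RXY s s' m p : (s, s') != (false, true) ->
  RXY q (zseries s (Lgen q n s)) (zseries s' (Lgen q n s')) m p =
  YXR q (zseries s (Lgen q n s)) (zseries s' (Lgen q n s')) m p.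
Proof.
move=> ss'; have [phi [phiL phic phir]] := Uaff_map.
have : map_mx phi (RXY q (zseries s (fL F n s)) (zseries s' (fL F n s')) m p) =
       map_mx phi (YXR q (zseries s (fL F n s)) (zseries s' (fL F n s')) m p).
  by apply/matrixP => i j; rewrite !mxE; apply: phir; exact: aff_RLL.
rewrite (map_RXY q phic) (map_YXR q phic).
have E t : (fun m => map_mx phi (zseries t (fL F n t) m)) = zseries t (Lgen q n t).
  by apply: funext => m'; rewrite map_zseries; congr zseries; apply: funext => k.
by rewrite !E.
Qed.

Lemma in1_0 (A : pzAlgType F) : in1 (0 : 'M[A]_n) = 0.
Proof. exact: tens0mx. Qed.

Lemma in2_0 (A : pzAlgType F) : in2 (0 : 'M[A]_n) = 0.
Proof. exact: tensmx0. Qed.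

Lemma zseries0 (A : pzAlgType F) s (X : nat -> 'M[A]_n) : zseries s X 0 = X 0%N.
Proof. by rewrite -(zseries_pos s X 0); case: s. Qed.

Lemma RLL_Lgen_plus s k : RLL q^-1 false (Lgen q n true 0) (Lgen q n s k).
Proof.
apply/(RLL_mx q false).
(* In the coefficient of z^-1, the term in z of R would need z^-2 in L^+(z), which is zero; only the
   term in 1/z and the constant term of L^+ remain. This is the limit z -> 0. *)
have := @Lgen_RXY true s (-1) (if s then k.*2%:Z + 1 else - k.*2%:Z + 1).
rewrite /RXY /YXR !big_cons !big_nil /= !addr0 => /(_ isT).
have -> : -1 - 1 = - 2%:Z by [].
rewrite (@zseries_neg _ true _ 2) // opprK addNr zseries0.
have -> : (if s then k.*2%:Z + 1 else - k.*2%:Z + 1) - 1 = if s then k.*2%:Z else - k.*2%:Z.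
  by case: s; rewrite addrK.
by rewrite zseries_pos !in1_0 !mulmx0 !mul0mx !add0r.
Qed.

Lemma RLL_Lgen_minus s k : RLL q^-1 false (Lgen q n s k) (Lgen q n false 0).
Proof.
apply/(RLL_mx q false).
(* Symmetrically, in the coefficient of w^1 the term z/w of R would need w^2 in L^-(w); only w/z
   remains. This is the limit w -> oo. *)
have := @Lgen_RXY s false (if s then k.*2%:Z - 1 else - k.*2%:Z - 1) 1.
rewrite /RXY /YXR !big_cons !big_nil /= !addr0; case: (boolP ((s, false) != (false, true))) => [_ /(_ isT)|]; last by case: s.
rewrite (@zseries_neg _ false _ 2) // opprK subrr zseries0.
have -> : (if s then k.*2%:Z - 1 else - k.*2%:Z - 1) + 1 = if s then k.*2%:Z else - k.*2%:Z.
  by case: s; rewrite subrK.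
by rewrite zseries_pos !in2_0 !mulmx0 !mul0mx !add0r.
Qed.

Lemma Lgen_lower (a b : 'I_n) : (a < b)%N -> Lgen q n true 0 a b = 0.
Proof.
move=> ab; have [phi [phiL phic phir]] := Uaff_map.
by have := phir _ _ (aff_lower q ab); rewrite -phiL !mxE rmorph0.
Qed.

Lemma Lgen_upper (a b : 'I_n) : (b < a)%N -> Lgen q n false 0 a b = 0.
Proof.
move=> ab; have [phi [phiL phic phir]] := Uaff_map.
by have := phir _ _ (aff_upper q ab); rewrite -phiL !mxE rmorph0.
Qed.

Lemma Lgen_diag s (a : 'I_n) : Lgen q n s 0 a a * Lgen q n (~~ s) 0 a a = 1.
Proof.
have [phi [phiL phic phir]] := Uaff_map; rewrite -!phiL !mxE -rmorphM.
have := if s as t return phi (fL F n t 0 a a * fL F n (~~ t) 0 a a) = 1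
  then etrans (phir _ _ (aff_diag_pm q a)) (rmorph1 _)
  else etrans (phir _ _ (aff_diag_mp q a)) (rmorph1 _).
by rewrite !mxE.
Qed.

(* The data of a level-zero representation of U_q(gl_n): P stands for L^(+0) and
   M for L^(-0). *)
Record level_zero (A : pzAlgType F) (P M : 'M[A]_n) : Prop := LevelZero {
  lz_pp : RLL q^-1 false P P;
  lz_mm : RLL q^-1 false M M;
  lz_pm : RLL q^-1 false P M;
  lz_lower : forall a b : 'I_n, (a < b)%N -> P a b = 0;
  lz_upper : forall a b : 'I_n, (b < a)%N -> M a b = 0;
  lz_diagPM : forall a, P a a * M a a = 1;
  lz_diagMP : forall a, M a a * P a a = 1
}.

Lemma Lgen_level_zero : level_zero (Lgen q n true 0) (Lgen q n false 0).
Proof.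
split; [exact: RLL_Lgen_plus|exact: RLL_Lgen_minus|exact: RLL_Lgen_plus| | | |].
- exact: Lgen_lower.
- exact: Lgen_upper.
- exact: (Lgen_diag true).
- exact: (Lgen_diag false).
Qed.

(** * The evaluation morphism from the affine algebra *)

Section Evaluation.
Variables (A : pzAlgType F) (P M : 'M[A]_n).
Hypothesis PM : level_zero P M.

(* L^+(z) = P + z^2 M and L^-(z) = M + z^-2 P = z^-2 L^+(z). *)
Definition evalL (s : bool) (k : nat) : 'M[A]_n :=
  if k == 0%N then (if s then P else M)
  else if k == 1%N then (if s then M else P) else 0.

Definition evalshift (s : bool) : int := if s then 0 else -2.

Lemma zseries_evalL s m :
  zseries s (evalL s) m = if m == evalshift s then P else if m == evalshift s + 2 then M else 0.
Proof.
case: m => m; rewrite /zseries /evalL /evalshift.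
  case: s => /=.
    case: m => [|[|[|m]]] //=; case: ifP => // /andP[m2 _].
    by rewrite ifF ?ifF //; lia.
  by case: m => [|m] //=; rewrite andbF.
case: s => /=; first by rewrite andbF.
case: m => [|[|m]] //=; case: ifP => // /andP[m2 _].
by rewrite ifF ?ifF //; lia.
Qed.

Let Rp := RcoefA q n A 1.
Let Rm := RcoefA q n A (-1).

Let RpE (X Y : 'M[A]_n) : RLL q true X Y -> Rp *m in1 X *m in2 Y = in2 Y *m in1 X *m Rp.
Proof. by move/(RLL_mx q true). Qed.

Let RmE (X Y : 'M[A]_n) : RLL q^-1 false X Y -> Rm *m in1 X *m in2 Y = in2 Y *m in1 X *m Rm.
Proof. by move/(RLL_mx q false). Qed.

Let flipE (X Y : 'M[A]_n) : RLL q^-1 false X Y -> RLL q true Y X.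
Proof. by move=> XY; have := RLL_flip qV0 XY; rewrite invrK. Qed.

(** The middle coefficient of the relation for P + z^2 M, the only one that involves both powers of
    R. *)
Let mixE : Rp *m in1 P *m in2 M + Rm *m in1 M *m in2 P =
           in2 M *m in1 P *m Rp + in2 P *m in1 M *m Rm.
Proof.
apply/matrixP => u v; case: (mxtens_indexP u) => i k; case: (mxtens_indexP v) => j l.
rewrite [LHS]mxE [RHS]mxE.
rewrite (RXY_entry q true) (RXY_entry q false) (YXR_entry q true) (YXR_entry q false).
rewrite /rsgn /rpar /= !act1 !actNl !act1.
exact: (RLL_mixed (s := true) q0 (lz_pm PM)).
Qed.

Lemma RXY_evalL s s' m p :
  RXY q (zseries s (evalL s)) (zseries s' (evalL s')) m p =
  YXR q (zseries s (evalL s)) (zseries s' (evalL s')) m p.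
Proof.
rewrite /RXY /YXR !big_cons !big_nil !addr0 !zseries_evalL -/Rp -/Rm.
move: (evalshift s) (evalshift s') => a b.
(* P and M sit at the exponents a and a + 2 of z, and R shifts exponents by 1 or -1: only a - 1, a +
   1 and a + 3 contribute, and likewise for w around b. As L^- is a shift of L^+, all pairs of signs
   are treated at once. *)
have cas (x c : int) : [\/ x = c - 1, x = c + 1, x = c + 3 | [/\ x != c - 1, x != c + 1 & x != c + 3]].
  case: (eqVneq x (c - 1)) => [|h1]; first by constructor 1.
  case: (eqVneq x (c + 1)) => [|h2]; first by constructor 2.
  by case: (eqVneq x (c + 3)) => [|h3]; [constructor 3|constructor 4].
have ppE := lz_pp PM; have mmE := lz_mm PM; have pmE := lz_pm PM.
by case: (cas m a) => [->|->|->|[? ? ?]]; case: (cas p b) => [->|->|->|[? ? ?]];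
  repeat match goal with |- context [if ?c then _ else _] =>
    first [have -> : c = true by lia | have -> : c = false by lia] end;
  rewrite ?in1_0 ?in2_0 ?mulmx0 ?mul0mx ?addr0 ?add0r ?mixE ?mul0mx //;
  first [exact: RpE (flipE ppE) | exact: RpE (flipE mmE) | exact: RpE (flipE pmE)
   | exact: RmE ppE | exact: RmE mmE | exact: RmE pmE].
Qed.

Lemma Uaff_lift : exists phi : {rmorphism Uaff q n -> A},
  [/\ map_mx phi (Lgen q n true 0) = P, map_mx phi (Lgen q n false 0) = M,
    forall s k, map_mx phi (Lgen q n s k) = evalL s k & forall c : F, phi (scal c) = scal c].
Proof.
have [|phi [phig phic]] := presAlg_lift (r := @aff_rel F q n) (B := A)
  (g := fun x : affgen n => evalL x.1.1.1 x.1.1.2 x.1.2 x.2).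
  move=> phi phig phic.
  have phiL s k : map_mx phi (fL F n s k) = evalL s k.
    by apply/matrixP => a b; rewrite !mxE phig.
  have phiLE s k a b : phi (fL F n s k a b) = evalL s k a b by rewrite -phiL [RHS]mxE.
  move=> u v; case=> {u v} [s s' m p i j _|a b ab|a b ab|a|a].
  - have -> : forall M' : 'M[_]_(n * n), phi (M' i j) = map_mx phi M' i j by move=> ?; rewrite mxE.
    have -> : forall M' : 'M[_]_(n * n), phi (M' i j) = map_mx phi M' i j by move=> ?; rewrite mxE.
    rewrite (map_RXY q phic) (map_YXR q phic).
    have E t : (fun m => map_mx phi (zseries t (fL F n t) m)) = zseries t (evalL t).
      by apply: funext => m'; rewrite map_zseries; congr zseries; apply: funext => k.
    by rewrite !E RXY_evalL.
  - by rewrite phiLE rmorph0 (lz_lower PM).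
  - by rewrite phiLE rmorph0 (lz_upper PM).
  - by rewrite rmorphM !phiLE rmorph1 (lz_diagPM PM).
  - by rewrite rmorphM !phiLE rmorph1 (lz_diagMP PM).
have phiL s k : map_mx phi (Lgen q n s k) = evalL s k.
  by apply/matrixP => a b; rewrite !mxE phig.
by exists phi; split=> //; rewrite phiL.
Qed.
End Evaluation.

(** The counit of U_q(gl_n) on level-zero generators; it will be used at all sites but one. *)
Lemma level_zero1 (A : pzAlgType F) : level_zero (1%:M : 'M[A]_n) 1%:M.
Proof.
have R1 : RLL q^-1 false (1%:M : 'M[A]_n) 1%:M.
  apply/(RLL_mx q false).
  have -> : in1 (1%:M : 'M[A]_n) = 1%:M.
    apply/matrixP => u v; case: (mxtens_indexP u) => i k; case: (mxtens_indexP v) => j l.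
    rewrite tensmxE !mxE -natrM mulnb; congr (nat_of_bool _)%:R.
    by rewrite (can_eq (@mxtens_indexK n n)).
  have -> : in2 (1%:M : 'M[A]_n) = 1%:M.
    apply/matrixP => u v; case: (mxtens_indexP u) => i k; case: (mxtens_indexP v) => j l.
    rewrite tensmxE !mxE -natrM mulnb; congr (nat_of_bool _)%:R.
    by rewrite (can_eq (@mxtens_indexK n n)).
  by rewrite !mulmx1 mul1mx.
split=> // a; first 2 last; rewrite ?mxE ?eqxx ?mulr1 //.
  by move=> b ab; rewrite mxE; case: eqP ab => // ->; rewrite ltnn.
by move=> b ab; rewrite mxE; case: eqP ab => // ->; rewrite ltnn.
Qed.

Lemma level_zero_map (A B : pzAlgType F) (phi : {rmorphism A -> B}) (P M : 'M[A]_n) :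
  (forall c : F, phi (scal c) = scal c) ->
  level_zero P M -> level_zero (map_mx phi P) (map_mx phi M).
Proof.
move=> phic [pp mm pm lo up dp dm].
split; try exact: RLL_map.
- by move=> a b ab; rewrite mxE lo // rmorph0.
- by move=> a b ab; rewrite mxE up // rmorph0.
- by move=> a; rewrite !mxE -rmorphM dp rmorph1.
- by move=> a; rewrite !mxE -rmorphM dm rmorph1.
Qed.

Lemma Ufin_map : exists phi : {rmorphism freeAlg F (fingen n) -> Ufin q n},
  [/\ forall s, map_mx phi (fL0 F n s) = ell q n (~~ s), forall c : F, phi (scal c) = scal c
    & forall u v, fin_rel q u v -> phi u = phi v].
Proof.
have [phi [phig phic phir]] := presAlg_map (@fin_rel F q n).
by exists phi; split=> // s; apply/matrixP => a b; rewrite !mxE phig negbK.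
Qed.

Lemma ell_level_zero : level_zero (ell q n false) (ell q n true).
Proof.
have [phi [phiL phic phir]] := Ufin_map.
have phiE s s' e : map_mx phi (RcoefA q n _ e *m in1 (fL0 F n s) *m in2 (fL0 F n s')) =
    RcoefA q n _ e *m in1 (ell q n (~~ s)) *m in2 (ell q n (~~ s')).
  by rewrite !map_mxM (map_RcoefA _ _ phic) map_in1 map_in2 !phiL.
have phiE' s s' e : map_mx phi (in2 (fL0 F n s') *m in1 (fL0 F n s) *m RcoefA q n _ e) =
    in2 (ell q n (~~ s')) *m in1 (ell q n (~~ s)) *m RcoefA q n _ e.
  by rewrite !map_mxM (map_RcoefA _ _ phic) map_in1 map_in2 !phiL.
have entry s a b : ell q n (~~ s) a b = phi (fL0 F n s a b) by rewrite -phiL [LHS]mxE.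
split.
- apply/(RLL_mx q false)/matrixP => i j.
  by rewrite -(phiE true true) -(phiE' true true) [LHS]mxE [RHS]mxE; apply: phir; exact: fin_RLL.
- apply/(RLL_mx q false)/matrixP => i j.
  by rewrite -(phiE false false) -(phiE' false false) [LHS]mxE [RHS]mxE; apply: phir; exact: fin_RLL.
- apply/(RLL_mx q false)/matrixP => i j.
  by rewrite -(phiE true false) -(phiE' true false) [LHS]mxE [RHS]mxE; apply: phir; exact: fin_RLL_pm.
- by move=> a b ab; rewrite (entry true) (phir _ _ (fin_lower q ab)) rmorph0.
- by move=> a b ab; rewrite (entry false) (phir _ _ (fin_upper q ab)) rmorph0.
- by move=> a; rewrite (entry true) (entry false) -rmorphM (phir _ _ (fin_diag_pm q a)) rmorph1.
- by move=> a; rewrite (entry true) (entry false) -rmorphM (phir _ _ (fin_diag_mp q a)) rmorph1.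
Qed.

Lemma Ufin_lift (A : pzAlgType F) (P M : 'M[A]_n) : level_zero P M ->
  exists phi : {rmorphism Ufin q n -> A},
  (forall s, map_mx phi (ell q n s) = if s then M else P) /\ (forall c : F, phi (scal c) = scal c).
Proof.
move=> PM.
have [|phi [phig phic]] := presAlg_lift (r := @fin_rel F q n) (B := A)
  (g := fun x : fingen n => (if x.1.1 then P else M) x.1.2 x.2).
  move=> phi phig phic.
  have phiL s : map_mx phi (fL0 F n s) = if s then P else M.
    by apply/matrixP => a b; rewrite !mxE phig.
  have phiLE s a b : phi (fL0 F n s a b) = (if s then P else M) a b by rewrite -phiL [RHS]mxE.
  have mapE (M' : 'M[freeAlg F (fingen n)]_(n * n)) i j : phi (M' i j) = map_mx phi M' i j.
    by rewrite mxE.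
  move=> u v; case=> {u v} [s e i j es|i j|a b ab|a b ab|a|a].
  - rewrite !mapE !map_mxM (map_RcoefA _ _ phic) map_in1 map_in2 !phiL.
    have ss : RLL q^-1 false (if s then P else M) (if s then P else M).
      by case: s; [exact: lz_pp PM|exact: lz_mm PM].
    move: es; rewrite !inE => /orP[/eqP->|/eqP->].
      (* The presentation asks for both powers of z; [level_zero] records that of 1/z, and
         [RLL_flip] provides the other. *)
      have /(RLL_mx q true) -> // : RLL q true (if s then P else M) (if s then P else M).
      by have := RLL_flip qV0 ss; rewrite invrK.
    by have /(RLL_mx q false) -> // := ss.
  - rewrite !mapE !map_mxM (map_RcoefA _ _ phic) map_in1 map_in2 !phiL.
    by have /(RLL_mx q false) -> // := lz_pm PM.
  - by rewrite phiLE rmorph0 (lz_lower PM).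
  - by rewrite phiLE rmorph0 (lz_upper PM).
  - by rewrite rmorphM !phiLE rmorph1 (lz_diagPM PM).
  - by rewrite rmorphM !phiLE rmorph1 (lz_diagMP PM).
exists phi; split=> // s; apply/matrixP => a b; rewrite !mxE [LHS]phig /=.
by case: s.
Qed.
End QuantumAlgebraTheory.

(** * The coinduced module *)

Section InverseYangBaxter.
Variables (F : fieldType) (A : pzAlgType F) (n : nat) (p : F) (s : bool).
Hypothesis p0 : p != 0.
Implicit Types T : 'I_n -> 'I_n -> 'I_n -> A.
Notation o12 p T := (op12 (@act F A) p s T).
Notation o13 p T := (op13 (@act F A) p s T).
Notation o23 p T := (op23 (@act F A) p s T).

Let YBE_fun T : o12 p (o13 p (o23 p T)) = o23 p (o13 p (o12 p T)).
Proof. by do 3![apply: funext => ?]; rewrite YBE. Qed.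

Let o12K T : o12 p^-1 (o12 p T) = T.
Proof. by do 3![apply: funext => ?]; exact: (ropK s (fun a b => T a b _)). Qed.
Let o13K T : o13 p^-1 (o13 p T) = T.
Proof. by do 3![apply: funext => ?]; exact: (ropK s (fun a b => T a _ b)). Qed.
Let o23K T : o23 p^-1 (o23 p T) = T.
Proof. by do 3![apply: funext => ?]; exact: (ropK s (fun a b => T _ a b)). Qed.
Let o12VK T : o12 p (o12 p^-1 T) = T.
Proof. by do 3![apply: funext => ?]; exact: (ropVK s (fun a b => T a b _)). Qed.
Let o13VK T : o13 p (o13 p^-1 T) = T.
Proof. by do 3![apply: funext => ?]; exact: (ropVK s (fun a b => T a _ b)). Qed.
Let o23VK T : o23 p (o23 p^-1 T) = T.
Proof. by do 3![apply: funext => ?]; exact: (ropVK s (fun a b => T _ a b)). Qed.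

(** The Yang-Baxter equation multiplied by R_13^-1 and R_23^-1: reordering generators past L
    produces inverse R-matrices in the row indices. *)
Lemma YBE_inv12 T : o12 p (o23 p^-1 (o13 p^-1 T)) = o13 p^-1 (o23 p^-1 (o12 p T)).
Proof.
rewrite -[T in RHS]o13VK -[o13 p^-1 T in RHS]o23VK.
by rewrite YBE_fun o23K o13K.
Qed.

Lemma YBE_inv23 T : o23 p (o12 p^-1 (o13 p^-1 T)) = o13 p^-1 (o12 p^-1 (o23 p T)).
Proof.
rewrite -[T in RHS]o13VK -[o13 p^-1 T in RHS]o12VK.
by rewrite -YBE_fun o12K o13K.
Qed.
End InverseYangBaxter.

Section MatrixAlgebra.
Variables (F : fieldType) (A : pzAlgType F) (n : nat).

Let mscal (c : F) : 'M[A]_n := (scal c)%:M.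

Fact mscal1 : mscal 1 = 1.
Proof. by rewrite /mscal scal1. Qed.
Fact mscalD : {morph mscal : c d / c + d}.
Proof. by move=> c d; rewrite /mscal scalD raddfD. Qed.
Fact mscalM : {morph mscal : c d / c * d}.
Proof. by move=> c d; rewrite /mscal scalM scalar_mxM. Qed.
Fact mscalC (c : F) (x : 'M[A]_n) : mscal c * x = x * mscal c.
Proof.
apply/matrixP => i j; rewrite /mscal !mxE (bigD1 i) //= [RHS](bigD1 j) //= !mxE !eqxx !mulr1n.
rewrite [X in _ + X]big1 => [|k /negPf ki]; last by rewrite mxE eq_sym ki mul0r.
rewrite [X in _ = _ + X]big1 => [|k /negPf kj]; last by rewrite mxE kj mulr0.
by rewrite !addr0 scalC.
Qed.
HB.instance Definition _ := hasScalars.Build F 'M[A]_n mscal1 mscalD mscalM mscalC.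

Lemma act_mxE (c : F) (X : 'M[A]_n) i j : act c X i j = act c (X i j).
Proof.
rewrite /act mxE (bigD1 i) //= mxE eqxx mulr1n big1 ?addr0 // => k /negPf ki.
by rewrite mxE eq_sym ki mul0r.
Qed.

Lemma rop_mxE m p s (T : 'I_m -> 'I_m -> 'M[A]_n) a b i j :
  rop (@act F 'M[A]_n) p s T a b i j = rop (@act F A) p s (fun a b => T a b i j) a b.
Proof. by rewrite /rop mxE !act_mxE. Qed.

(* Right multiplication by [twist p s Z l] applies [rop p s] to the pair formed
   by l and the column index. *)
Definition twist p s (Z : 'I_n -> A) (l : 'I_n) : 'M[A]_n :=
  \matrix_(t, j) rop (@act F A) p s (fun l j => (t == j)%:R * Z l) l j.

Lemma mul_twist p s Z l (Y : 'M[A]_n) a j :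
  (Y *m twist p s Z l) a j = rop (@act F A) p s (fun l j => Y a j * Z l) l j.
Proof.
rewrite mxE; under eq_bigr do rewrite mxE -rop_mull.
rewrite -rop_sum; congr (rop _ _ _ _ _ _); apply: funext => l'; apply: funext => j'.
rewrite (bigD1 j') //= eqxx mul1r big1 ?addr0 // => t /negPf tj.
by rewrite tj mul0r mulr0.
Qed.

Lemma twist0 p s (Z : 'I_n -> A) l :
  Z l = 0 -> (forall j, lts s l j -> Z j = 0) -> twist p s Z l = 0.
Proof.
move=> Zl Zj; apply/matrixP => t j; rewrite !mxE /rop Zl mulr0 act0 add0r /rr.
by case: ifP => [/Zj->|_]; rewrite ?mulr0 ?act0 ?act0l.
Qed.

Lemma twist_diag p s (Z : 'I_n -> A) a t j : (forall j, lts s a j -> Z j = 0) ->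
  twist p s Z a t j = act (cc p a j) ((t == j)%:R * Z a).
Proof.
move=> Zj; rewrite !mxE /rop /rr.
by case: ifP => [/Zj->|_]; rewrite ?mulr0 ?act0 ?act0l addr0.
Qed.
End MatrixAlgebra.

(** * A triangular half and its twisted morphisms into matrices *)

Section PlusAlgebra.
Variables (F : fieldType) (q : F) (n : nat).
Hypothesis q0 : q != 0.
Notation p := (q^-1).

Definition plusgen : Type := ('I_n * 'I_n)%type.
Definition fX (i j : 'I_n) : freeAlg F plusgen := fgen F (i, j).

Inductive plus_rel : freeAlg F plusgen -> freeAlg F plusgen -> Prop :=
| plus_RLL i k j l :
    plus_rel (rop (@act F _) p false (fun i k => fX i j * fX k l) i k)
             (rop (@act F _) p true (fun j l => fX k l * fX i j) j l)
| plus_lower (a b : 'I_n) of (a < b)%N : plus_rel (fX a b) 0.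

(* Stands for the subalgebra generated by the L^(+0)_ab; the inverses of the
   L^(+0)_aa are left out. *)
Definition Uplus : pzAlgType F := presAlg plus_rel.
Definition Xplus : 'M[Uplus]_n := \matrix_(i, j) pgen plus_rel (i, j).

Lemma Uplus_lift (A : pzAlgType F) (X : 'I_n -> 'I_n -> A) :
    (forall i k j l, rop (@act F A) p false (fun i k => X i j * X k l) i k =
       rop (@act F A) p true (fun j l => X k l * X i j) j l) ->
    (forall a b : 'I_n, (a < b)%N -> X a b = 0) ->
  exists phi : {rmorphism Uplus -> A},
    (forall i j, phi (Xplus i j) = X i j) /\ (forall c : F, phi (scal c) = scal c).
Proof.
move=> XX Xl; have [|phi [phig phic]] := presAlg_lift (r := plus_rel) (B := A)
  (g := fun x : plusgen => X x.1 x.2).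
  move=> phi phig phic u v; case=> {u v} [i k j l|a b ab].
    by rewrite !(rop_morph phic); have := XX i k j l; rewrite /rop !rmorphM !phig.
  by rewrite phig rmorph0 /= Xl.
by exists phi; split=> // i j; rewrite mxE phig.
Qed.

Lemma Xplus_RLL : RLL p false Xplus Xplus.
Proof.
have [phi [phig phic phir]] := presAlg_map plus_rel.
move=> i k j l; have := phir _ _ (plus_RLL i k j l).
by rewrite !(rop_morph phic) /rop !rmorphM !phig !mxE.
Qed.

Lemma Xplus_lower (a b : 'I_n) : (a < b)%N -> Xplus a b = 0.
Proof.
have [phi [phig phic phir]] := presAlg_map plus_rel.
by move=> ab; have := phir _ _ (plus_lower ab); rewrite phig rmorph0 mxE.
Qed.

Let p0 : p != 0. Proof. by rewrite invr_eq0. Qed.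

(* X_1 |-> X_1 R_13; the columns of R_13 act on the index of the new matrix. *)
Lemma theta1_exists : exists th : {rmorphism Uplus -> 'M[Uplus]_n},
  (forall i j, th (Xplus i j) = twist p true (Xplus i) j) /\ (forall c : F, th (scal c) = scal c).
Proof.
apply: Uplus_lift => [i k j l|a b ab]; last first.
  by apply: twist0 => [|j /= bj]; rewrite Xplus_lower // (ltn_trans ab).
apply/matrixP => a b; rewrite !rop_mxE.
(* The product of two twisted generators is R_13 and R_23 applied to D, which carries the column
   index of the new matrix. Yang-Baxter brings R_12 next to the untwisted product, where [Xplus_RLL]
   applies. *)
pose D i k j l (b : 'I_n) := (a == b)%:R * (Xplus i j * Xplus k l).
pose D' i k j l (b : 'I_n) := (a == b)%:R * (Xplus k l * Xplus i j).
have -> : (fun i k => (twist p true (Xplus i) j * twist p true (Xplus k) l) a b) =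
    fun i k => op23 (@act F _) p true (op13 (@act F _) p true (D i k)) j l b.
  do 2![apply: funext => ?]; rewrite mul_twist; congr (rop _ _ _ _ _ _).
  do 2![apply: funext => ?]; rewrite mxE -rop_mulr; congr (rop _ _ _ _ _ _).
  by do 2![apply: funext => ?]; rewrite /D mulrA.
have -> : (fun j l => (twist p true (Xplus k) l * twist p true (Xplus i) j) a b) =
    fun j l => op13 (@act F _) p true (op23 (@act F _) p true (D' i k)) j l b.
  do 2![apply: funext => ?]; rewrite mul_twist; congr (rop _ _ _ _ _ _).
  do 2![apply: funext => ?]; rewrite mxE -rop_mulr; congr (rop _ _ _ _ _ _).
  by do 2![apply: funext => ?]; rewrite /D' mulrA.
rewrite [RHS](YBE true (D' i k)) // /op23 rop_rop.
congr (rop _ _ _ _ _ _); do 2![apply: funext => ?].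
rewrite /op13 rop_rop; congr (rop _ _ _ _ _ _); do 2![apply: funext => ?].
by rewrite /op12 /D /D' !rop_mull Xplus_RLL.
Qed.

(* X_1 |-> R_13^-1 X_1, transposed in the third space. *)
Lemma theta2_exists : exists th : {rmorphism Uplus -> 'M[Uplus]_n},
  (forall i j, th (Xplus i j) = twist p^-1 false (fun i => Xplus i j) i) /\
  (forall c : F, th (scal c) = scal c).
Proof.
apply: (Uplus_lift (X := fun i j => twist p^-1 false (fun i => Xplus i j) i)) => [i k j l|a b ab]; last first.
  by apply: twist0 => [|j /= ja]; rewrite Xplus_lower // (ltn_trans ja).
apply/matrixP => a b; rewrite !rop_mxE.
pose D j l i k (b : 'I_n) := (a == b)%:R * (Xplus i j * Xplus k l).
pose D' j l i k (b : 'I_n) := (a == b)%:R * (Xplus k l * Xplus i j).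
pose tw i j := twist p^-1 false (fun i => Xplus i j) i.
have -> : (fun i k => (tw i j * tw k l) a b) =
    fun i k => op23 (@act F _) p^-1 false (op13 (@act F _) p^-1 false (D j l)) i k b.
  do 2![apply: funext => ?]; rewrite mul_twist; congr (rop _ _ _ _ _ _).
  do 2![apply: funext => ?]; rewrite mxE -rop_mulr; congr (rop _ _ _ _ _ _).
  by do 2![apply: funext => ?]; rewrite /D mulrA.
have -> : (fun j l => (tw k l * tw i j) a b) =
    fun j l => op13 (@act F _) p^-1 false (op23 (@act F _) p^-1 false (D' j l)) i k b.
  do 2![apply: funext => ?]; rewrite mul_twist; congr (rop _ _ _ _ _ _).
  do 2![apply: funext => ?]; rewrite mxE -rop_mulr; congr (rop _ _ _ _ _ _).
  by do 2![apply: funext => ?]; rewrite /D' mulrA.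
have := YBE_inv12 false p0 (D j l).
move/(congr1 (fun T => T i k b)); rewrite {1}/op12 => ->.
rewrite /op13 [RHS]rop_rop; congr (rop _ _ _ _ _ _); do 2![apply: funext => ?].
rewrite /op23 [RHS]rop_rop; congr (rop _ _ _ _ _ _); do 2![apply: funext => ?].
by rewrite /op12 /D /D' !rop_mull Xplus_RLL.
Qed.
End PlusAlgebra.

(** * Equivariant maps and their right-linear endomorphisms *)

Section Functionals.
Variables (F : fieldType) (B Q : pzAlgType F) (n : nat) (k : 'I_n -> B) (kappa : 'I_n -> Q).

(** The elements of the coinduced module. Equivariance under the [k a] replaces the missing inverses
    of the diagonal generators: at 1, translation by [k a] is multiplication by the invertible
    [kappa a]. *)
Record functional : Type := Functional {
  fval :> B -> Q;
  fvalD : forall x y, fval (x + y) = fval x + fval y;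
  fvalZ : forall c x, fval (scal c * x) = scal c * fval x;
  fval_k : forall a x, fval (k a * x) = kappa a * fval x
}.

Lemma functional_eq (f g : functional) : (forall x, f x = g x) -> f = g.
Proof.
case: f => f fD fZ fk; case: g => g gD gZ gk /= fg.
have E : f = g by exact: funext.
by case: g / E gD gZ gk {fg} => gD gZ gk; congr Functional; exact: Prop_irrelevance.
Qed.

HB.instance Definition _ := gen_eqMixin functional.
HB.instance Definition _ := gen_choiceMixin functional.

Program Definition fzero : functional := @Functional (fun=> 0) _ _ _.
Next Obligation. by rewrite addr0. Qed.
Next Obligation. by rewrite mulr0. Qed.
Next Obligation. by rewrite mulr0. Qed.

Program Definition fadd (f g : functional) : functional :=
  @Functional (fun x => f x + g x) _ _ _.
Next Obligation. by rewrite !fvalD addrACA. Qed.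
Next Obligation. by rewrite !fvalZ mulrDr. Qed.
Next Obligation. by rewrite !fval_k mulrDr. Qed.

Program Definition fopp (f : functional) : functional :=
  @Functional (fun x => - f x) _ _ _.
Next Obligation. by rewrite !fvalD opprD. Qed.
Next Obligation. by rewrite !fvalZ mulrN. Qed.
Next Obligation. by rewrite !fval_k mulrN. Qed.

Fact faddA : associative fadd.
Proof. by move=> f g h; apply: functional_eq => x /=; rewrite addrA. Qed.
Fact faddC : commutative fadd.
Proof. by move=> f g; apply: functional_eq => x /=; rewrite addrC. Qed.
Fact fadd0 : left_id fzero fadd.
Proof. by move=> f; apply: functional_eq => x /=; rewrite add0r. Qed.
Fact faddN : left_inverse fzero fopp fadd.
Proof. by move=> f; apply: functional_eq => x /=; rewrite addNr. Qed.
HB.instance Definition _ := GRing.isZmodule.Build functional faddA faddC fadd0 faddN.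

Program Definition fmulr (f : functional) (y : Q) : functional :=
  @Functional (fun x => f x * y) _ _ _.
Next Obligation. by rewrite !fvalD mulrDl. Qed.
Next Obligation. by rewrite !fvalZ mulrA. Qed.
Next Obligation. by rewrite !fval_k mulrA. Qed.

Lemma fval_act (f : functional) c x : f (act c x) = act c (f x).
Proof. exact: fvalZ. Qed.

Lemma fval_rop (f : functional) p s (T : 'I_n -> 'I_n -> B) a b :
  f (rop (@act F B) p s T a b) = rop (@act F Q) p s (fun a b => f (T a b)) a b.
Proof. by rewrite /rop fvalD !fval_act. Qed.

Lemma fval0 (f : functional) : f 0 = 0.
Proof. by apply: (addIr (f 0)); rewrite -fvalD !add0r. Qed.

(** Since Q is not commutative, linearity is over the right action of Q, which commutes with the
    operators coming from U_q(gl_n). *)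
Record endo : Type := Endo {
  efun :> functional -> functional;
  efunD : forall f g, efun (f + g) = efun f + efun g;
  efunM : forall f y, efun (fmulr f y) = fmulr (efun f) y
}.

Lemma endo_eq (g h : endo) : (forall f x, g f x = h f x) -> g = h.
Proof.
case: g => g gD gM; case: h => h hD hM /= gh.
have E : g = h by apply: funext => f; exact: functional_eq.
by case: h / E hD hM {gh} => hD hM; congr Endo; exact: Prop_irrelevance.
Qed.

HB.instance Definition _ := gen_eqMixin endo.
HB.instance Definition _ := gen_choiceMixin endo.

Lemma fmulrD f g y : fmulr (f + g) y = fmulr f y + fmulr g y.
Proof. by apply: functional_eq => x /=; rewrite mulrDl. Qed.

Lemma fmulrA f y z : fmulr (fmulr f y) z = fmulr f (y * z).
Proof. by apply: functional_eq => x /=; rewrite mulrA. Qed.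

Program Definition ezero : endo := @Endo (fun=> 0) _ _.
Next Obligation. by rewrite addr0. Qed.
Next Obligation. by apply: functional_eq => x /=; rewrite mul0r. Qed.

Program Definition eadd (g h : endo) : endo := @Endo (fun f => g f + h f) _ _.
Next Obligation. by rewrite !efunD addrACA. Qed.
Next Obligation. by rewrite !efunM fmulrD. Qed.

Program Definition eopp (g : endo) : endo := @Endo (fun f => - g f) _ _.
Next Obligation. by rewrite !efunD opprD. Qed.
Next Obligation. by rewrite !efunM; apply: functional_eq => x /=; rewrite mulNr. Qed.

Program Definition eone : endo := @Endo id _ _.

Program Definition emul (g h : endo) : endo := @Endo (fun f => g (h f)) _ _.
Next Obligation. by rewrite !efunD. Qed.
Next Obligation. by rewrite !efunM. Qed.

Fact eaddA : associative eadd.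
Proof. by move=> f g h; apply: endo_eq => u x /=; rewrite addrA. Qed.
Fact eaddC : commutative eadd.
Proof. by move=> f g; apply: endo_eq => u x /=; rewrite addrC. Qed.
Fact eadd0 : left_id ezero eadd.
Proof. by move=> f; apply: endo_eq => u x /=; rewrite add0r. Qed.
Fact eaddN : left_inverse ezero eopp eadd.
Proof. by move=> f; apply: endo_eq => u x /=; rewrite addNr. Qed.
HB.instance Definition _ := GRing.isZmodule.Build endo eaddA eaddC eadd0 eaddN.

Fact emulA : associative emul.
Proof. by move=> f g h; apply: endo_eq. Qed.
Fact emul1l : left_id eone emul.
Proof. by move=> f; apply: endo_eq. Qed.
Fact emul1r : right_id eone emul.
Proof. by move=> f; apply: endo_eq. Qed.
Fact emulDl : left_distributive emul eadd.
Proof. by move=> f g h; apply: endo_eq. Qed.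
Fact emulDr : right_distributive emul eadd.
Proof. by move=> f g h; apply: endo_eq => u x /=; rewrite efunD. Qed.
HB.instance Definition _ :=
  GRing.Zmodule_isPzRing.Build endo emulA emul1l emul1r emulDl emulDr.

(** Scalars act through the right action of Q, so that right linearity of endomorphisms makes them
    central. *)
Program Definition escal (c : F) : endo := @Endo (fun f => fmulr f (scal c)) _ _.
Next Obligation. exact: fmulrD. Qed.
Next Obligation. by rewrite !fmulrA scalC. Qed.

Fact escal1 : escal 1 = 1.
Proof. by apply: endo_eq => u x /=; rewrite scal1 mulr1. Qed.
Fact escalD : {morph escal : c d / c + d}.
Proof. by move=> c d; apply: endo_eq => u x /=; rewrite scalD mulrDr. Qed.
Fact escalM : {morph escal : c d / c * d}.
Proof. by move=> c d; apply: endo_eq => u x /=; rewrite scalM scalC mulrA. Qed.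
Fact escalC (c : F) (g : endo) : escal c * g = g * escal c.
Proof. by apply: endo_eq => u x /=; rewrite efunM. Qed.
HB.instance Definition _ := hasScalars.Build F endo escal1 escalD escalM escalC.

Lemma endoM (g h : endo) f : (g * h) f = g (h f).
Proof. by []. Qed.

Lemma endo_rop p s (T : 'I_n -> 'I_n -> endo) a b f x :
  rop (@act F endo) p s T a b f x = rop (@act F Q) p s (fun a b => T a b f x) a b.
Proof. by congr (_ + _); apply/esym/scalC. Qed.
End Functionals.

(** * The action of U_q(gl_n) on the coinduced module *)

Section VermaAction.
Variables (F : fieldType) (q : F) (n : nat) (Q : pzAlgType F) (P M : 'M[Q]_n).
Hypothesis q0 : q != 0.
Notation p := (q^-1).
Notation U := (Uplus q n).
Notation X := (Xplus q n).

Hypothesis MM : RLL p false M M.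
Hypothesis M_upper : forall a b : 'I_n, (b < a)%N -> M a b = 0.
Hypothesis diagPM : forall a, P a a * M a a = 1.
(** The weight of M i j under the diagonal generators. It cancels the factors of [th1_k] and
    [th2_k], which keeps [Lfun i j f] equivariant. *)
Hypothesis P_M : forall a i j,
  P a a * M i j = act (cc p^-1 a i) (act (cc p a j) (M i j * P a a)).

Let p0 : p != 0. Proof. by rewrite invr_eq0. Qed.

Notation V := (functional (fun a => X a a) (fun a => P a a)).
Notation E := (endo (fun a => X a a) (fun a => P a a)).

Variables (th1 th2 : {rmorphism U -> 'M[U]_n}).
Hypothesis th1X : forall i j, th1 (X i j) = twist p true (X i) j.
Hypothesis th1c : forall c : F, th1 (scal c) = scal c.
Hypothesis th2X : forall i j, th2 (X i j) = twist p^-1 false (fun i => X i j) i.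
Hypothesis th2c : forall c : F, th2 (scal c) = scal c.

Program Definition Xfun i j (f : V) : V := @Functional _ _ _ _ _ _ (fun x => f (x * X i j)) _ _ _.
Next Obligation. by rewrite mulrDl fvalD. Qed.
Next Obligation. by rewrite -mulrA fvalZ. Qed.
Next Obligation. by rewrite -mulrA fval_k. Qed.

Program Definition Xend i j : E := @Endo _ _ _ _ _ _ (Xfun i j) _ _.
Next Obligation. by apply: functional_eq. Qed.
Next Obligation. by apply: functional_eq. Qed.


Lemma th1_k a (x : U) i j : th1 (X a a * x) i j = act (cc p a i) (X a a * th1 x i j).
Proof.
rewrite rmorphM th1X [LHS]mxE (bigD1 i) //= twist_diag => [|b /= ab]; last by rewrite Xplus_lower.
rewrite eqxx mul1r big1 ?addr0 ?actMl // => b /negPf bi.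
rewrite twist_diag => [|b' /= ab]; last by rewrite Xplus_lower.
by rewrite eq_sym bi mul0r act0 mul0r.
Qed.

Lemma th2_k a (x : U) i j : th2 (X a a * x) i j = act (cc p^-1 a i) (X a a * th2 x i j).
Proof.
rewrite rmorphM th2X [LHS]mxE (bigD1 i) //= twist_diag => [|b /= ab]; last by rewrite Xplus_lower.
rewrite eqxx mul1r big1 ?addr0 ?actMl // => b /negPf bi.
rewrite twist_diag => [|b' /= ab]; last by rewrite Xplus_lower.
by rewrite eq_sym bi mul0r act0 mul0r.
Qed.

Lemma th_act (th : {rmorphism U -> 'M[U]_n}) (thc : forall c : F, th (scal c) = scal c) c x i j :
  th (act c x) i j = act c (th x i j).
Proof. by rewrite /act rmorphM thc; exact: act_mxE. Qed.

(* (L_ij f)(x) = f(x L_ij), where x L_ij is rewritten as a sum of L_bc y, with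
   y = Theta_(bc,ij)(x), by the relation X_1 L_2 = R^-1 L_2 X_1 R, and L_bc acts
   on values through M; Theta is [th2] after [th1]. *)
Program Definition Lfun i j (f : V) : V :=
  @Functional _ _ _ _ _ _ (fun x => \sum_b \sum_c M b c * f (th2 (th1 x c j) b i)) _ _ _.
Next Obligation.
rewrite -big_split; apply: eq_bigr => b _; rewrite -big_split; apply: eq_bigr => c _ /=.
by rewrite rmorphD mxE rmorphD mxE fvalD mulrDr.
Qed.
Next Obligation.
rewrite mulr_sumr; apply: eq_bigr => b _; rewrite mulr_sumr; apply: eq_bigr => d _ /=.
by rewrite -/(act c x) (th_act th1c) (th_act th2c) fval_act /act mulrA -scalC mulrA.
Qed.
Next Obligation.
rewrite mulr_sumr; apply: eq_bigr => b _; rewrite mulr_sumr; apply: eq_bigr => d _ /=.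
rewrite th1_k (th_act th2c) th2_k !fval_act fval_k [RHS]mulrA P_M.
by rewrite actA mulrC -actA -!actMl -!actMr mulrA.
Qed.

Program Definition Lend i j : E := @Endo _ _ _ _ _ _ (Lfun i j) _ _.
Next Obligation.
apply: functional_eq => x /=; rewrite -big_split; apply: eq_bigr => b _.
by rewrite -big_split; apply: eq_bigr => c _ /=; rewrite mulrDr.
Qed.
Next Obligation.
apply: functional_eq => x /=; rewrite mulr_suml; apply: eq_bigr => b _.
by rewrite mulr_suml; apply: eq_bigr => c _ /=; rewrite mulrA.
Qed.

Lemma Lend1 i j (f : V) : Lend i j f 1 = M i j * f 1.
Proof.
rewrite /= (bigD1 i) //= (bigD1 j) //= rmorph1 mxE eqxx rmorph1 mxE eqxx.
rewrite big1 ?addr0 => [|c /negPf cj]; last by rewrite mxE cj rmorph0 mxE fval0 mulr0.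
rewrite big1 ?addr0 // => b /negPf bi; rewrite big1 // => c _.
by rewrite mxE; case: (c == j); rewrite ?rmorph1 ?rmorph0 !mxE ?bi fval0 mulr0.
Qed.

(** Holds by construction: evaluating at x * X k l, the multiplicativity of [th1] and [th2] splits
    off the last generator and leaves one R-matrix on the column indices and one inverse on the row
    indices. *)
Lemma Lend_exchange i j k l :
  Xend k l * Lend i j = rop (@act F E) p^-1 false (fun k i =>
    rop (@act F E) p true (fun l j => Lend i j * Xend k l) l j) k i.
Proof.
apply: endo_eq => f x; rewrite endo_rop.
transitivity (rop (@act F Q) p^-1 false (fun k i =>
    rop (@act F Q) p true (fun l j => (Lend i j * Xend k l) f x) l j) k i); last first.
  by congr (rop _ _ _ _ _ _); do 2![apply: funext => ?]; rewrite endo_rop.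
transitivity (\sum_b \sum_c rop (@act F Q) p^-1 false (fun k i =>
    rop (@act F Q) p true (fun l j => M b c * f (th2 (th1 x c j) b i * X k l)) l j) k i).
  apply: eq_bigr => b _; apply: eq_bigr => c _.
  rewrite rmorphM th1X mul_twist (rop_morph th2c) rop_mxE.
  transitivity (M b c * f (rop (@act F U) p true (fun l j =>
    rop (@act F U) p^-1 false (fun k i => th2 (th1 x c j) b i * X k l) k i) l j)).
    congr (_ * f _); congr (rop _ _ _ _ _ _); do 2![apply: funext => ?].
    by rewrite rmorphM th2X mul_twist.
  rewrite rop_rop fval_rop -rop_mull; congr (rop _ _ _ _ _ _); do 2![apply: funext => ?].
  by rewrite fval_rop -rop_mull.
transitivity (rop (@act F Q) p^-1 false (fun k i => \sum_b \sum_c 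
    rop (@act F Q) p true (fun l j => M b c * f (th2 (th1 x c j) b i * X k l)) l j) k i).
  by rewrite rop_sum; apply: eq_bigr => b _; rewrite rop_sum.
congr (rop _ _ _ _ _ _); apply: funext => k0; apply: funext => b0.
transitivity (rop (@act F Q) p true (fun l j => \sum_b \sum_c 
    M b c * f (th2 (th1 x c j) b b0 * X k0 l)) l j).
  by rewrite rop_sum; apply: eq_bigr => b _; rewrite rop_sum.
by [].
Qed.

Lemma Xend_RLL i k j l :
  rop (@act F E) p false (fun i k => Xend i j * Xend k l) i k =
  rop (@act F E) p true (fun j l => Xend k l * Xend i j) j l.
Proof.
apply: endo_eq => f x; rewrite !endo_rop.
have := congr1 (fun y => f (x * y)) (@Xplus_RLL F q n i k j l).
rewrite -!rop_mull !fval_rop => E1.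
transitivity (rop (@act F Q) p false (fun i k => f (x * (X i j * X k l))) i k).
  by congr (rop _ _ _ _ _ _); do 2![apply: funext => ?]; rewrite mulrA.
rewrite E1; congr (rop _ _ _ _ _ _); do 2![apply: funext => ?].
by rewrite mulrA.
Qed.

Lemma Xend_Lend_RLL i k j l :
  rop (@act F E) p false (fun i k => Xend i j * Lend k l) i k =
  rop (@act F E) p true (fun j l => Lend k l * Xend i j) j l.
Proof.
have -> : (fun i k => Xend i j * Lend k l) =
  rop (@act F E) p^-1 false (fun i k => rop (@act F E) p true (fun j l => Lend k l * Xend i j) j l).
  by do 2![apply: funext => ?]; exact: Lend_exchange.
by rewrite ropVK.
Qed.

(** With [Lend1], a recursion on words that determines the action of L; the identities between the
    operators L are proved by checking that both sides satisfy it. *)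
Lemma Lend_step f u m t i j :
  Lend i j f (u * X m t) = rop (@act F Q) p^-1 false (fun m i =>
    rop (@act F Q) p true (fun t j => Lend i j (Xend m t f) u) t j) m i.
Proof.
have := congr1 (fun g : E => g f u) (Lend_exchange i j m t).
rewrite endo_rop => E1; rewrite -[LHS]/((Xend m t * Lend i j) f u) E1.
by congr (rop _ _ _ _ _ _); do 2![apply: funext => ?]; rewrite endo_rop.
Qed.

(** In the recursion a triangular coefficient is nonzero only if it raises the row index or lowers
    the column index, so every term stays strictly below the diagonal; at 1 the entry is that of
    M. *)
Lemma Lend_upper (i j : 'I_n) : (j < i)%N -> Lend i j = 0.
Proof.
move=> ji; apply: endo_eq => f x.
rewrite -[RHS]/0; move: x f i j ji; apply: presAlg_right_ind => [|u v Pu Pv|c u Pu|u x Pu] f i j ji.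
- by rewrite Lend1 M_upper // mul0r.
- by rewrite fvalD Pu // Pv // addr0.
- by rewrite -scalC fvalZ Pu // mulr0.
case: x => m t; have -> : pgen (@plus_rel F q n) (m, t) = X m t by rewrite mxE.
rewrite Lend_step /rop /rr (_ : lts false m i = (i < m)%N) // (_ : lts true t j = (t < j)%N) //.
case: (ltnP i m) => im; case: (ltnP t j) => tj;
  by rewrite ?(act0l, addr0) !Pu ?(act0, addr0) //; lia.
Qed.

Lemma Lend_two_step f u m t i j k l :
  (Lend i j * Lend k l) f (u * X m t) =
  op12 (@act F Q) p^-1 false (op13 (@act F Q) p^-1 false (fun m i k =>
    op12 (@act F Q) p true (op13 (@act F Q) p true (fun t j l =>
      (Lend i j * Lend k l) (Xend m t f) u)) t j l)) m i k.
Proof.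
rewrite -[LHS]/(Lend i j (Lend k l f) (u * X m t)) Lend_step.
congr (rop _ _ _ _ _ _); apply: funext => m'; apply: funext => i'.
rewrite [RHS]rop_rop; congr (rop _ _ _ _ _ _); apply: funext => t'; apply: funext => j'.
have := congr1 (fun g : E => (Lend i' j' * g) f u) (Lend_exchange k l m' t').
rewrite -[in X in X -> _]/((Lend i' j' * (Xend m' t' * Lend k l)) f u).
rewrite -rop_mull endo_rop => ->; congr (rop _ _ _ _ _ _); do 2![apply: funext => ?].
by rewrite -rop_mull endo_rop.
Qed.

(** Induction on the word. At 1 this is [MM]. In the inductive step Yang-Baxter is used twice, in
    inverse form on the row indices m, i, k and directly on the column indices t, j, l, to bring R
    next to the relation at u. *)
Lemma Lend_RLL i k j l :
  rop (@act F E) p false (fun i k => Lend i j * Lend k l) i k =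
  rop (@act F E) p true (fun j l => Lend k l * Lend i j) j l.
Proof.
apply: endo_eq => f x; rewrite !endo_rop.
move: x f i k j l; apply: presAlg_right_ind => [|u v Pu Pv|c u Pu|u x Pu] f i k j l.
- transitivity (rop (@act F Q) p false (fun i k => M i j * M k l) i k * f 1).
    rewrite -rop_mulr; congr (rop _ _ _ _ _ _); do 2![apply: funext => ?].
    by rewrite endoM !Lend1 mulrA.
  rewrite MM -rop_mulr; congr (rop _ _ _ _ _ _); do 2![apply: funext => ?].
  by rewrite endoM !Lend1 mulrA.
- have rD s a b (f1 f2 : 'I_n -> 'I_n -> Q) : rop (@act F Q) p s (fun a b => f1 a b + f2 a b) a b =
    rop (@act F Q) p s f1 a b + rop (@act F Q) p s f2 a b by rewrite /rop !actD addrACA.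
  transitivity (rop (@act F Q) p false (fun i k => (Lend i j * Lend k l) f u + (Lend i j * Lend k l) f v) i k).
    by congr (rop _ _ _ _ _ _); do 2![apply: funext => ?]; rewrite fvalD.
  rewrite rD Pu Pv -rD; congr (rop _ _ _ _ _ _); do 2![apply: funext => ?].
  by rewrite fvalD.
- transitivity (rop (@act F Q) p false (fun i k => scal c * (Lend i j * Lend k l) f u) i k).
    by congr (rop _ _ _ _ _ _); do 2![apply: funext => ?]; rewrite -scalC fvalZ.
  rewrite rop_mull Pu -rop_mull; congr (rop _ _ _ _ _ _); do 2![apply: funext => ?].
  by rewrite -scalC fvalZ.
case: x => m t; have -> : pgen (@plus_rel F q n) (m, t) = X m t by rewrite mxE.
pose D m i k t j l := (Lend i j * Lend k l) (Xend m t f) u.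
pose D' m i k t j l := (Lend k l * Lend i j) (Xend m t f) u.
pose G m i k := op12 (@act F Q) p true (op13 (@act F Q) p true (D m i k)) t j l.
transitivity (op23 (@act F Q) p false (op12 (@act F Q) p^-1 false
    (op13 (@act F Q) p^-1 false (fun m i k => G m i k))) m i k).
  by congr (rop _ _ _ _ _ _); do 2![apply: funext => ?]; rewrite Lend_two_step.
transitivity (rop (@act F Q) p true (fun j l =>
    op13 (@act F Q) p^-1 false (op12 (@act F Q) p^-1 false (fun m i k =>
    op13 (@act F Q) p true (op12 (@act F Q) p true (D' m i k)) t j l)) m i k) j l); last first.
  by congr (rop _ _ _ _ _ _); do 2![apply: funext => ?]; rewrite Lend_two_step.
rewrite YBE_inv23 // [RHS]rop_rop; congr (rop _ _ _ _ _ _).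
apply: funext => m'; apply: funext => k'.
rewrite [RHS]rop_rop; congr (rop _ _ _ _ _ _); apply: funext => m''; apply: funext => i'.
rewrite -[RHS]/(op23 (@act F Q) p true (op13 (@act F Q) p true (op12 (@act F Q) p true (D' m'' i' k'))) t j l).
rewrite -YBE // /G /op23 /op12 rop_rop; congr (rop _ _ _ _ _ _).
apply: funext => t'; apply: funext => j'.
rewrite /op13 rop_rop; congr (rop _ _ _ _ _ _); apply: funext => t''; apply: funext => l'.
exact: Pu.
Qed.

(** X a a and L a a both commute with X m t up to a scalar, and the two scalars are inverse to each
    other; triangularity removes the remaining terms of the RLL relations. *)
Lemma XL_diag_comm a m t : Xend a a * Lend a a * Xend m t = Xend m t * (Xend a a * Lend a a).
Proof.
have c0 (i j : 'I_n) : cc p i j != 0 :> F by rewrite /cc; case: ifP; rewrite ?oner_eq0.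
have actI c (x y : E) : c != 0 -> act c x = act c y -> x = y.
  by move=> cn0 /(congr1 (act c^-1)); rewrite !actA mulVf // !act1.
have X0 (i j : 'I_n) : (i < j)%N -> Xend i j = 0.
  move=> ij; apply: endo_eq => f x; rewrite -[RHS]/(0 : Q) /=.
  by rewrite Xplus_lower // mulr0 fval0.
have EL : act (cc p m a) (Xend m t * Lend a a) = act (cc p t a) (Lend a a * Xend m t).
  have := Xend_Lend_RLL m a t a; rewrite /rop /rr.
  rewrite (_ : lts false m a = (a < m)%N) // (_ : lts true t a = (t < a)%N) //.
  have -> : act (if (a < m)%N then p - p^-1 else 0) (Xend a t * Lend m a) = 0.
    by case: ltnP => am; rewrite ?act0l // Lend_upper // mulr0 act0.
  have -> : act (if (t < a)%N then p - p^-1 else 0) (Lend a t * Xend m a) = 0.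
    by case: ltnP => ta; rewrite ?act0l // Lend_upper // mul0r act0.
  by rewrite !addr0.
have EX : act (cc p t a) (Xend m t * Xend a a) = act (cc p m a) (Xend a a * Xend m t).
  have := Xend_RLL m a t a; rewrite /rop /rr.
  rewrite (_ : lts false m a = (a < m)%N) // (_ : lts true t a = (t < a)%N) //.
  case: (eqVneq m a) => [->|ma]; case: (eqVneq t a) => [->|ta] //.
  - rewrite ltnn act0l addr0 !ccxx [cc p t a]/cc (negPf ta) act1.
    case: (ltnP t a) => ta'; last by rewrite X0 ?mul0r ?mulr0 ?act0 // ltn_neqAle eq_sym ta.
    move/(congr1 (fun x => x - act (p - p^-1) (Xend a t * Xend a a))).
    rewrite addrK -actNl -actDl opprB addrCA subrr addr0 => /(congr1 (act p)).
    by rewrite actA mulfV // act1.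
  - rewrite ltnn act0l addr0 !ccxx [cc p m a]/cc (negPf ma) act1.
    case: (ltnP a m) => am'; last by rewrite [Xend m a]X0 ?mul0r ?mulr0 ?act0 // ltn_neqAle ma.
    move=> E2; have : Xend m a * Xend a a = act p^-1 (Xend a a * Xend m a).
      apply: (addIr (act (p - p^-1) (Xend a a * Xend m a))).
      by rewrite E2 -actDl addrCA subrr addr0.
    by move=> ->; rewrite actA mulfV // act1.
  rewrite [cc p m a]/cc (negPf ma) [cc p t a]/cc (negPf ta) !act1.
  case: (ltnP a m) => am; case: (ltnP t a) => tla; rewrite ?act0l ?addr0 //.
  - by move/addIr.
  - by rewrite [Xend a t]X0 ?mul0r ?act0 ?addr0 // ltn_neqAle eq_sym ta.
  - by rewrite [Xend m a]X0 ?mulr0 ?act0 ?addr0 // ltn_neqAle ma.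
apply: (actI _ _ _ (c0 t a)); rewrite -[X in act _ X = _]mulrA [LHS]actMr -EL -[LHS]actMr.
by rewrite [X in act _ X = _]mulrA [LHS]actMl -EX -[LHS]actMl mulrA.
Qed.

(** Since the product commutes with right translations, its value at 1 decides; there equivariance
    turns X a a into P a a, which is inverse to M a a. *)
Lemma XL_diag a : Xend a a * Lend a a = 1.
Proof.
apply: endo_eq => f x; rewrite -[RHS]/(f x).
move: x f; apply: presAlg_right_ind => [|u v Pu Pv|c u Pu|u x Pu] f.
- have -> : (Xend a a * Lend a a) f 1 = Lend a a f (X a a * 1) by rewrite mulr1 -[X a a in RHS]mul1r.
  by rewrite fval_k Lend1 mulrA diagPM mul1r.
- by rewrite !fvalD Pu Pv.
- by rewrite -scalC !fvalZ Pu.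
case: x => m t; have -> : pgen (@plus_rel F q n) (m, t) = X m t by rewrite mxE.
rewrite -[LHS]/((Xend m t * (Xend a a * Lend a a)) f u) -XL_diag_comm.
exact: Pu.
Qed.

Lemma LX_diag a : Lend a a * Xend a a = 1.
Proof.
rewrite -(XL_diag a); have := Xend_Lend_RLL a a a a.
rewrite /rop /rr !ltsxx !act0l !addr0 ccxx => /(congr1 (act p^-1)).
by rewrite !actA mulVf // !act1.
Qed.

Definition Xmx : 'M[E]_n := \matrix_(i, j) Xend i j.
Definition Lmx : 'M[E]_n := \matrix_(i, j) Lend i j.

Lemma verma_level_zero : level_zero q Xmx Lmx.
Proof.
split=> [i k j l|i k j l|i k j l|a b ab|a b ab|a|a]; rewrite /rop ?mxE.
- exact: Xend_RLL.
- exact: Lend_RLL.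
- exact: Xend_Lend_RLL.
- apply: endo_eq => f x; rewrite -[RHS]/(0 : Q) /=.
  by rewrite Xplus_lower // mulr0 fval0.
- exact: Lend_upper.
- exact: XL_diag.
- exact: LX_diag.
Qed.
End VermaAction.

(** * Block subalgebras *)

Section LeviBlocks.
Variables (F : fieldType) (q : F) (n m : nat).
Hypothesis q0 : q != 0.
Notation p := (q^-1).
Variables (sz : 'I_m -> nat) (emb : forall k, 'I_(sz k) -> 'I_n).
Hypothesis emb_lt : forall k (i j : 'I_(sz k)), (emb i < emb j)%N = (i < j)%N.
Hypothesis emb_ltb : forall k k' (i : 'I_(sz k)) (j : 'I_(sz k')), (k < k')%N -> (emb i < emb j)%N.
Hypothesis emb_surj : forall a, exists k (i : 'I_(sz k)), a = emb i.

Let p0 : p != 0. Proof. by rewrite invr_eq0. Qed.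

Lemma emb_inj k : injective (@emb k).
Proof.
move=> i j ij; apply/eqP; rewrite -val_eqE eqn_leq leqNgt -emb_lt ij ltnn /=.
by rewrite leqNgt -emb_lt ij ltnn.
Qed.

Lemma emb_neq k k' (i : 'I_(sz k)) (j : 'I_(sz k')) : k != k' -> emb i != emb j.
Proof.
rewrite -val_eqE neq_ltn => /orP[/emb_ltb|/emb_ltb] h; rewrite -val_eqE neq_ltn h ?orbT //.
Qed.

Lemma emb_ltbE k k' (i : 'I_(sz k)) (j : 'I_(sz k')) : k != k' -> (emb i < emb j)%N = (k < k')%N.
Proof.
rewrite -val_eqE neq_ltn => /orP[kk|kk]; first by rewrite kk emb_ltb.
by rewrite [RHS]ltnNge (ltnW kk) /= ltnNge ltnW // emb_ltb.
Qed.

Lemma cc_emb r k (i j : 'I_(sz k)) : cc r (emb i) (emb j) = cc r i j :> F.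
Proof. by rewrite /cc (inj_eq (@emb_inj k)). Qed.

Lemma rr_emb r s k (i j : 'I_(sz k)) : rr r s (emb i) (emb j) = rr r s i j :> F.
Proof. by rewrite /rr /lts !emb_lt. Qed.

Lemma cc_embN r k k' (i : 'I_(sz k)) (j : 'I_(sz k')) : k != k' -> cc r (emb i) (emb j) = 1 :> F.
Proof. by move=> kk; rewrite /cc (negPf (emb_neq i j kk)). Qed.

Lemma rop_emb (A : pzAlgType F) r s k (T : 'I_n -> 'I_n -> A) (i j : 'I_(sz k)) :
  rop (@act F A) r s T (emb i) (emb j) = rop (@act F A) r s (fun i j => T (emb i) (emb j)) i j.
Proof. by rewrite /rop cc_emb rr_emb. Qed.

Section LeviMap.
Variables (C : pzAlgType F) (P M : 'M[C]_n).
Hypothesis PM : level_zero q P M.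

Lemma level_zero_block k :
  level_zero q (\matrix_(i, j < sz k) P (emb i) (emb j)) (\matrix_(i, j < sz k) M (emb i) (emb j)).
Proof.
have R X Y : RLL p false X Y -> RLL p false (\matrix_(i, j < sz k) (X : 'M[C]_n) (emb i) (emb j))
    (\matrix_(i, j < sz k) (Y : 'M[C]_n) (emb i) (emb j)).
  move=> XY i k' j l; have := XY (emb i) (emb k') (emb j) (emb l).
  by rewrite !rop_emb /rop !mxE.
split; try (apply: R; first [exact: lz_pp PM | exact: lz_mm PM | exact: lz_pm PM]).
- by move=> a b ab; rewrite mxE (lz_lower PM) // emb_lt.
- by move=> a b ab; rewrite mxE (lz_upper PM) // emb_lt.
- by move=> a; rewrite !mxE (lz_diagPM PM).
- by move=> a; rewrite !mxE (lz_diagMP PM).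
Qed.

(** Indices in distinct blocks are distinct, so the diagonal coefficients of R are 1. One of the two
    triangular terms has coefficient zero; the other contains an entry on the wrong side of the
    diagonal, of P in the first matrix or of M in the second. *)
Lemma block_comm k k' (i j : 'I_(sz k)) (a b : 'I_(sz k')) s s' : k != k' ->
  GRing.comm ((if s then M else P) (emb i) (emb j)) ((if s' then M else P) (emb a) (emb b)).
Proof.
have lo := lz_lower PM; have up := lz_upper PM.
have step (X Y : 'M[C]_n) : RLL p false X Y ->
    (X = P \/ Y = M) -> (X = P \/ X = M) -> (Y = P \/ Y = M) ->
    forall k k' (i j : 'I_(sz k)) (a b : 'I_(sz k')), k != k' ->
    GRing.comm (X (emb i) (emb j)) (Y (emb a) (emb b)).
  move=> XY h hX hY {}k {}k' {}i {}j {}a {}b kk'; rewrite /GRing.comm.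
  have := XY (emb i) (emb a) (emb j) (emb b).
  rewrite /rop !cc_embN // !act1 /rr.
  rewrite (_ : lts false (emb i) (emb a) = (emb a < emb i)%N) //.
  rewrite (_ : lts (~~ false) (emb j) (emb b) = (emb j < emb b)%N) //.
  rewrite !emb_ltbE // 1?eq_sym //; case: (ltngtP k k') => [lt|lt|/ord_inj eq]; last by rewrite eq eqxx in kk'.
    rewrite act0l addr0 => ->.
    have ab : (emb i < emb b)%N by exact: emb_ltb.
    have ba : (emb j < emb a)%N by exact: emb_ltb.
    suff -> : Y (emb a) (emb j) * X (emb i) (emb b) = 0 by rewrite act0 addr0.
    case: h => [->|->]; first by rewrite lo // mulr0.
    by rewrite up // mul0r.
  rewrite act0l addr0 => <-.
  have ab : (emb b < emb i)%N by exact: emb_ltb.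
  have ba : (emb a < emb j)%N by exact: emb_ltb.
  suff -> : X (emb a) (emb j) * Y (emb i) (emb b) = 0 by rewrite act0 addr0.
  by case: h => [->|->]; [rewrite lo // mul0r|rewrite up // mulr0].
move=> kk'; case: s; case: s'.
- by apply: step => //; [exact: lz_mm PM|right|right|right].
- apply: commr_sym; apply: step; rewrite 1?eq_sym //; [exact: lz_pm PM|by left|by left|by right].
- by apply: step => //; [exact: lz_pm PM|left|left|right].
- by apply: step => //; [exact: lz_pp PM|left|left|left].
Qed.

Lemma levi_map : exists Phi : {rmorphism tensor (fun k => Ufin q (sz k)) -> C},
  (forall k s (i j : 'I_(sz k)),
     Phi (tensor_in (A := fun k => Ufin q (sz k)) (i := k) (ell q (sz k) s i j)) =
     (if s then M else P) (emb i) (emb j))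
  /\ (forall c : F, Phi (scal c) = scal c).
Proof.
pose f k := projT1 (cid (Ufin_lift q0 (level_zero_block k))).
have fP k : (forall s, map_mx (f k) (ell q (sz k) s) =
    if s then \matrix_(i, j < sz k) M (emb i) (emb j) else \matrix_(i, j < sz k) P (emb i) (emb j))
    /\ (forall c : F, f k (scal c) = scal c) by exact: projT2 (cid (Ufin_lift q0 (level_zero_block k))).
have fE k s i j : f k (ell q (sz k) s i j) = (if s then M else P) (emb i) (emb j).
  have [/(_ s)/matrixP/(_ i j)] := fP k; rewrite mxE => -> _.
  by case: s; rewrite mxE.
have [||Phi [PhiE Phic]] := @tensor_lift F 'I_m (fun k => Ufin q (sz k)) C f.
- by move=> k c; have [_ ->] := fP k.
- move=> k k' u v kk'.
  have gen t : exists s i j, pgen (@fin_rel F q (sz k)) t = ell q (sz k) s i j.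
    by case: t => -[s i] j; exists (~~ s), i, j; rewrite mxE negbK.
  have gen' t : exists s i j, pgen (@fin_rel F q (sz k')) t = ell q (sz k') s i j.
    by case: t => -[s i] j; exists (~~ s), i, j; rewrite mxE negbK.
  move: u; apply: presAlg_ind => [c|u1 u2 h1 h2|u1 u2 h1 h2|x].
  + by have [_ ->] := fP k; exact: scalC.
  + by rewrite rmorphD; apply/commr_sym/commrD; exact: commr_sym.
  + by rewrite rmorphM; apply/commr_sym/commrM; exact: commr_sym.
  move: v; apply: presAlg_ind => [c|u1 u2 h1 h2|u1 u2 h1 h2|y].
  + by have [_ ->] := fP k'; rewrite /GRing.comm scalC.
  + by rewrite rmorphD; exact: commrD.
  + by rewrite rmorphM; exact: commrM.
  have [s [i [j ->]]] := gen x; have [s' [a [b ->]]] := gen' y.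
  by rewrite !fE; exact: block_comm.
by exists Phi; split=> // k s i j; rewrite PhiE fE.
Qed.
End LeviMap.

Notation Q := (tensor (fun k => Ufin q (sz k))).
Notation tin k u := (tensor_in (A := fun k => Ufin q (sz k)) (i := k) u).

(** The block diagonal matrix of the generators of Q. The sum over all blocks avoids computing the
    dependently typed position of an index in its block. *)
Definition levi_mx (s : bool) : 'M[Q]_n :=
  \matrix_(a, b) \sum_k \sum_i \sum_j
    if (a == emb i) && (b == emb j) then tin k (ell q (sz k) s i j) else 0.

Lemma levi_mx_in s k (i j : 'I_(sz k)) : levi_mx s (emb i) (emb j) = tin k (ell q (sz k) s i j).
Proof.
rewrite mxE (bigD1 k) //= (bigD1 i) //= (bigD1 j) //= !eqxx.
rewrite big1 ?addr0 => [|b bj]; last first.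
  by rewrite (inj_eq (@emb_inj k)) [j == b]eq_sym (negPf bj) andbF.
rewrite big1 ?addr0 => [|a ai]; last first.
  by rewrite big1 // => b _; rewrite (inj_eq (@emb_inj k)) [i == a]eq_sym (negPf ai).
rewrite big1 ?addr0 // => k' kk'; rewrite big1 // => a _; rewrite big1 // => b _.
by rewrite (negPf (emb_neq i a _)) // eq_sym.
Qed.

Lemma levi_mx_out s k k' (i : 'I_(sz k)) (j : 'I_(sz k')) : k != k' ->
  levi_mx s (emb i) (emb j) = 0.
Proof.
move=> kk'; rewrite mxE big1 // => t _; rewrite big1 // => a _; rewrite big1 // => b _.
case: (eqVneq t k) => [tk|tk]; last by rewrite (negPf (emb_neq i a _)) // eq_sym.
by rewrite (negPf (emb_neq j b _)) ?andbF // tk eq_sym.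
Qed.

Local Opaque levi_mx.

Lemma levi_mx_comm s s' k k' (i j : 'I_(sz k)) (a b : 'I_(sz k')) : k != k' ->
  levi_mx s (emb i) (emb j) * levi_mx s' (emb a) (emb b) =
  levi_mx s' (emb a) (emb b) * levi_mx s (emb i) (emb j).
Proof. by move=> kk'; rewrite !levi_mx_in; exact: tensor_in_comm. Qed.

Lemma levi_level_zero k :
  level_zero q (\matrix_(i, j < sz k) levi_mx false (emb i) (emb j))
               (\matrix_(i, j < sz k) levi_mx true (emb i) (emb j)).
Proof.
have [iota [iotaE iotac]] := tensor_in_morph (fun k => Ufin q (sz k)) k.
have := level_zero_map iotac (ell_level_zero q (sz k)).
congr level_zero; apply/matrixP => i j; rewrite [LHS]mxE [RHS]mxE levi_mx_in -iotaE //.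
Qed.

Lemma levi_local s s' k : RLL p false (\matrix_(i, j < sz k) levi_mx s (emb i) (emb j))
                                     (\matrix_(i, j < sz k) levi_mx s' (emb i) (emb j)) ->
  forall (i j a b : 'I_(sz k)),
  rop (@act F Q) p false (fun x y => levi_mx s x (emb j) * levi_mx s' y (emb b)) (emb i) (emb a) =
  rop (@act F Q) p true (fun x y => levi_mx s' (emb a) y * levi_mx s (emb i) x) (emb j) (emb b).
Proof.
by move=> R i j a b; rewrite !rop_emb; have := R i a j b; rewrite /rop !mxE.
Qed.

(** When the two entries lie in distinct blocks, a remaining exchange term involves the same product
    on both sides, because both matrices have the same sign. For opposite signs the two products
    differ, hence the restricted form of [levi_exchange]. *)
Lemma levi_RLL s : RLL p false (levi_mx s) (levi_mx s).
Proof.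
move=> a b c d.
have [ka [i ->]] := emb_surj a; have [kb [j ->]] := emb_surj b.
have [kc [k ->]] := emb_surj c; have [kd [l ->]] := emb_surj d.
have out1 : ~~ ((ka == kc) && (kb == kd)) -> forall x y,
    levi_mx x (emb i) (emb k) * levi_mx y (emb j) (emb l) = 0.
  rewrite negb_and => /orP[h|h] x y; first by rewrite levi_mx_out ?mul0r.
  by rewrite [levi_mx y _ _]levi_mx_out ?mulr0.
have out2 : ~~ ((ka == kd) && (kb == kc)) -> forall x y,
    levi_mx x (emb j) (emb k) * levi_mx y (emb i) (emb l) = 0.
  rewrite negb_and => /orP[h|h] x y; last by rewrite levi_mx_out ?mul0r.
  by rewrite [levi_mx y _ _]levi_mx_out ?mulr0.
have out1' : ~~ ((ka == kc) && (kb == kd)) -> forall x y,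
    levi_mx x (emb j) (emb l) * levi_mx y (emb i) (emb k) = 0.
  rewrite negb_and => /orP[h|h] x y; last by rewrite levi_mx_out ?mul0r.
  by rewrite [levi_mx y _ _]levi_mx_out ?mulr0.
rewrite /rop.
case: (boolP ((ka == kc) && (kb == kd))) => h1.
  case/andP: h1 (h1) => /eqP ? /eqP ? h1; subst.
  case: (eqVneq kc kd) => [?|cd]; first by subst; exact: (levi_local (if s as t return RLL _ _ _ _ then lz_mm (levi_level_zero kd) else lz_pp (levi_level_zero kd))).
  by rewrite !out2 ?negb_and ?cd // !act0 !addr0 !cc_embN // !act1 levi_mx_comm.
rewrite out1 // out1' // !act0 !add0r.
case: (boolP ((ka == kd) && (kb == kc))) => h2; last by rewrite out2 // !act0.
case/andP: h2 (h2) => /eqP ? /eqP ? h2; subst.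
have cd : kc != kd by apply: contra h1 => /eqP <-; rewrite eqxx.
rewrite /rr (_ : lts false (emb i) (emb j) = (emb j < emb i)%N) //.
rewrite (_ : lts (~~ false) (emb k) (emb l) = (emb k < emb l)%N) //.
by rewrite !emb_ltbE.
Qed.

Lemma levi_lower (a b : 'I_n) : (a < b)%N -> levi_mx false a b = 0.
Proof.
have [k [i ->]] := emb_surj a; have [k' [j ->]] := emb_surj b.
case: (eqVneq k k') => [?|kk']; last by rewrite levi_mx_out.
by subst=> ij; have := lz_lower (levi_level_zero k') (a := i) (b := j); rewrite mxE; apply; rewrite -emb_lt.
Qed.

Lemma levi_upper (a b : 'I_n) : (b < a)%N -> levi_mx true a b = 0.
Proof.
have [k [i ->]] := emb_surj a; have [k' [j ->]] := emb_surj b.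
case: (eqVneq k k') => [?|kk']; last by rewrite levi_mx_out.
by subst=> ij; have := lz_upper (levi_level_zero k') (a := i) (b := j); rewrite mxE; apply; rewrite -emb_lt.
Qed.

Lemma levi_diag a : levi_mx false a a * levi_mx true a a = 1.
Proof.
have [k [i ->]] := emb_surj a.
by have := lz_diagPM (levi_level_zero k) i; rewrite !mxE.
Qed.

(* The relation X_1 L_2 = R^-1 L_2 X_1 R of the full algebra survives the
   projection on the blocks when the indices of L are in the same block. *)
Lemma levi_exchange kb (i j : 'I_(sz kb)) c d :
  levi_mx false c d * levi_mx true (emb i) (emb j) =
  rop (@act F Q) p^-1 false (fun c i => rop (@act F Q) p true (fun d j =>
    levi_mx true i j * levi_mx false c d) d (emb j)) c (emb i).
Proof.
have [kc [k ->]] := emb_surj c; have [kd [l ->]] := emb_surj d.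
case: (eqVneq kc kd) => [?|cd].
  subst kc; case: (eqVneq kb kd) => [?|bd].
    subst kb; have E (x y : 'I_(sz kd)) : rop (@act F Q) p true (fun d j => levi_mx true (emb y) j * levi_mx false (emb x) d) (emb l) (emb j)
        = rop (@act F Q) p false (fun c i => levi_mx false c (emb l) * levi_mx true i (emb j)) (emb x) (emb y).
      by rewrite (levi_local (lz_pm (levi_level_zero kd))).
    rewrite rop_emb; transitivity (rop (@act F Q) p^-1 false (rop (@act F Q) p false
       (fun x y => levi_mx false (emb x) (emb l) * levi_mx true (emb y) (emb j))) k i).
      by rewrite ropK.
    by congr (rop _ _ _ _ _ _); do 2![apply: funext => ?]; rewrite E rop_emb.
  rewrite /rop [levi_mx true (emb i) (emb l)]levi_mx_out // mul0r act0 addr0.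
  rewrite [levi_mx false (emb i) (emb l)]levi_mx_out // mulr0 act0 add0r.
  rewrite !cc_embN 1?eq_sym // !act1 /rr.
  rewrite (_ : lts false (emb k) (emb i) = (emb i < emb k)%N) //.
  rewrite (_ : lts true (emb l) (emb j) = (emb l < emb j)%N) //.
  rewrite !emb_ltbE // 1?eq_sym // levi_mx_comm 1?eq_sym //.
  by case: (ltngtP kb kd) => h; rewrite ?act0l ?act0 ?addr0.
rewrite levi_mx_out // mul0r /rop.
have O1 x : levi_mx x (emb k) (emb l) = 0 by rewrite levi_mx_out.
have O2 x y : levi_mx x (emb i) (emb l) * levi_mx y (emb k) (emb j) = 0.
  case: (eqVneq kb kd) => [?|h]; last by rewrite levi_mx_out ?mul0r.
  by subst kb; rewrite [levi_mx y _ _]levi_mx_out ?mulr0.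
have O3 x y : levi_mx x (emb k) (emb j) * levi_mx y (emb i) (emb l) = 0.
  case: (eqVneq kb kd) => [?|h]; last by rewrite [levi_mx y _ _]levi_mx_out ?mulr0.
  by subst kb; rewrite levi_mx_out ?mul0r.
by rewrite !O1 O2 O3 !(mulr0, mul0r, act0, addr0).
Qed.

(** Supplies the weight relation [P_M] of the coinduced module: for a diagonal entry, triangularity
    removes the off-diagonal terms of [levi_exchange]. *)
Lemma levi_diag_exchange a i j : levi_mx false a a * levi_mx true i j =
  act (cc p^-1 a i) (act (cc p a j) (levi_mx true i j * levi_mx false a a)).
Proof.
have [kb [i' ->]] := emb_surj i; have [kd [j' ->]] := emb_surj j.
case: (eqVneq kb kd) => [?|bd]; last by rewrite levi_mx_out // mulr0 mul0r !act0.
subst; rewrite levi_exchange /rop /rr.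
rewrite (_ : lts false a (emb i') = (emb i' < a)%N) // (_ : lts true a (emb j') = (a < emb j')%N) //.
have Z1 : (if (a < emb j')%N then p - p^-1 else 0) = 0 \/ levi_mx false a (emb j') = 0.
  by case: ltnP => h; [right; exact: levi_lower|left].
have Z2 : (if (emb i' < a)%N then p^-1 - p^-1^-1 else 0) = 0 \/
    levi_mx false (emb i') a = 0 /\ ((a < emb j')%N -> levi_mx false (emb i') (emb j') = 0).
  by case: ltnP => h; [right; split=> [|h']; apply: levi_lower => //; exact: ltn_trans h'|left].
have -> : act (if (a < emb j')%N then p - p^-1 else 0)
    (levi_mx true (emb i') a * levi_mx false a (emb j')) = 0.
  by case: Z1 => ->; rewrite ?act0l // mulr0 act0.
rewrite addr0; case: Z2 => [->|[-> h]]; first by rewrite act0l addr0.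
rewrite mulr0 act0 add0r; case: ltnP h => h; last by rewrite act0l act0 addr0.
by move=> ->; rewrite // mulr0 !act0 addr0.
Qed.

(** * The projection on the blocks as a vector of the module *)

Section Retraction.
Variables (th1 th2 : {rmorphism Uplus q n -> 'M[Uplus q n]_n}).
Hypothesis th1X : forall i j, th1 (Xplus q n i j) = twist p true (Xplus q n i) j.
Hypothesis th1c : forall c : F, th1 (scal c) = scal c.
Hypothesis th2X : forall i j, th2 (Xplus q n i j) = twist p^-1 false (fun i => Xplus q n i j) i.
Hypothesis th2c : forall c : F, th2 (scal c) = scal c.

Variable pi : {rmorphism Uplus q n -> Q}.
Hypothesis piX : forall i j, pi (Xplus q n i j) = levi_mx false i j.
Hypothesis pic : forall c : F, pi (scal c) = scal c.

Notation V := (functional (fun a => Xplus q n a a) (fun a => levi_mx false a a)).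
Notation L := (Lend levi_diag_exchange th1X th1c th2X th2c).
Notation X := (@Xend F q n Q (levi_mx false)).

Program Definition pifun : V := @Functional _ _ _ _ _ _ (fun x => pi x) _ _ _.
Next Obligation. by rewrite rmorphD. Qed.
Next Obligation. by rewrite rmorphM pic. Qed.
Next Obligation. by rewrite rmorphM piX. Qed.

Lemma X_pifun i j : X i j pifun = fmulr pifun (levi_mx false i j).
Proof. by apply: functional_eq => x /=; rewrite rmorphM piX. Qed.

(** [Lend_step] on the left and [levi_exchange] on the right give the same recursion in x, with
    equal values at 1. *)
Lemma L_pifun k (i j : 'I_(sz k)) : L (emb i) (emb j) pifun = fmulr pifun (levi_mx true (emb i) (emb j)).
Proof.
apply: functional_eq => x; rewrite -[RHS]/(pi x * levi_mx true (emb i) (emb j)).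
move: x k i j; apply: presAlg_right_ind => [|u v Pu Pv|c u Pu|u x Pu] k i j.
- by rewrite Lend1 /= rmorph1 mulr1 mul1r.
- by rewrite fvalD Pu Pv rmorphD mulrDl.
- by rewrite -scalC fvalZ Pu rmorphM pic mulrA.
case: x => c d; have -> : pgen (@plus_rel F q n) (c, d) = Xplus q n c d by rewrite mxE.
rewrite rmorphM piX -mulrA levi_exchange // Lend_step.
have EL a b c' d' : L a b (X c' d' pifun) u = L a b pifun u * levi_mx false c' d'.
  by rewrite X_pifun efunM.
have U (a b : 'I_n) : (b < a)%N -> L a b pifun u = 0.
  by move=> ba; rewrite (Lend_upper q0 levi_upper).
(* The induction hypothesis only covers indices of L in one block. Every other term vanishes on both
   sides: the accompanying generator is off the blocks, or L is strictly below the diagonal. *)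
have agree (a b c' d' : 'I_n) : levi_mx false c' d' = 0 \/ (b < a)%N \/
      (exists k' (i' j' : 'I_(sz k')), a = emb i' /\ b = emb j') ->
    L a b (X c' d' pifun) u = pi u * (levi_mx true a b * levi_mx false c' d').
  case=> [h|[h|[k' [i' [j' [-> ->]]]]]]; rewrite EL.
  - by rewrite h !mulr0.
  - by rewrite U // levi_upper // !(mul0r, mulr0).
  - by rewrite Pu mulrA.
have [kc [i' ->]] := emb_surj c; have [kd [j' ->]] := emb_surj d.
have same k' (x y : 'I_(sz k')) : exists k'' (x' y' : 'I_(sz k'')), emb x = emb x' /\ emb y = emb y'.
  by exists k', x, y.
rewrite -rop_mull /rop [in RHS]mulrDr -!actMr [in RHS]mulrDr -!actMr.
rewrite /rr (_ : lts false (emb i') (emb i) = (emb i < emb i')%N) //.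
rewrite (_ : lts true (emb j') (emb j) = (emb j' < emb j)%N) //.
congr (act _ (act _ _ + _) + _).
- by apply: agree; right; right; exact: same.
- case: ltnP => ji; rewrite ?act0l //; congr act; apply: agree.
  case: (eqVneq k kd) => [?|kk]; first by subst; right; right; exact: same.
  case: (eqVneq kc k) => [?|kk']; last by left; exact: levi_mx_out.
  by subst; right; left; move: ji; rewrite !emb_ltbE // eq_sym.
case: ltnP => ic; rewrite ?act0l //; congr (act _ (act _ _ + _)).
- apply: agree; case: (eqVneq k kc) => [?|kk]; first by subst; right; right; exact: same.
  by right; left; move: ic; rewrite !emb_ltbE // eq_sym.
case: ltnP => ji; rewrite ?act0l //; congr act; apply: agree.
case: (eqVneq kd kc) => [?|kk]; first by subst; right; right; exact: same.
have le k1 k2 (x : 'I_(sz k1)) (y : 'I_(sz k2)) : (emb x < emb y)%N -> (k1 <= k2)%N.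
  by case: (eqVneq k1 k2) => [?|k12]; [subst|rewrite emb_ltbE // => /ltnW].
by right; left; rewrite emb_ltbE // ltn_neqAle kk (leq_trans (le _ _ _ _ ji) (le _ _ _ _ ic)).
Qed.

Notation E := (endo (fun a => Xplus q n a a) (fun a => levi_mx false a a)).
Notation Xm := (Xmx q (levi_mx false)).
Notation Lm := (Lmx levi_diag_exchange th1X th1c th2X th2c).

Lemma retraction_level_zero : level_zero q Xm Lm.
Proof. exact: (verma_level_zero q0 (levi_RLL true) levi_upper levi_diag). Qed.

Lemma retraction_ell s k (i j : 'I_(sz k)) :
  (if s then Lm else Xm) (emb i) (emb j) pifun = fmulr pifun (levi_mx s (emb i) (emb j)).
Proof. by case: s; rewrite mxE; [exact: L_pifun|exact: X_pifun]. Qed.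

Lemma retraction_eval (W : {rmorphism Q -> E}) :
    (forall c : F, W (scal c) = scal c) ->
    (forall k s (i j : 'I_(sz k)), W (tin k (ell q (sz k) s i j)) = (if s then Lm else Xm) (emb i) (emb j)) ->
  injective W.
Proof.
move=> Wc WE; have WP y : W y pifun = fmulr pifun y.
  move: y; apply: tensor_ind => [c|u v hu hv|u v hu hv|k a].
  - by rewrite Wc.
  - by rewrite rmorphD -[LHS]/(W u pifun + W v pifun) hu hv; apply: functional_eq => x /=; rewrite mulrDr.
  - by rewrite rmorphM -[LHS]/(W u (W v pifun)) hv efunM hu fmulrA.
  have [iota [iotaE iotac]] := tensor_in_morph (fun k => Ufin q (sz k)) k.
  rewrite -iotaE; move: a; apply: presAlg_ind => [c|u v hu hv|u v hu hv|x].
  - by rewrite iotac Wc.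
  - by rewrite !rmorphD -[LHS]/(W (iota u) pifun + W (iota v) pifun) hu hv; apply: functional_eq => x /=; rewrite mulrDr.
  - by rewrite !rmorphM -[LHS]/(W (iota u) (W (iota v) pifun)) hv efunM hu fmulrA.
  case: x => -[s i] j; have -> : pgen (@fin_rel F q (sz k)) (s, i, j) = ell q (sz k) (~~ s) i j.
    by rewrite mxE negbK.
  by rewrite iotaE WE retraction_ell levi_mx_in.
move=> x y /(congr1 (fun w : E => w pifun 1)).
by rewrite !WP /= rmorph1 !mul1r.
Qed.
End Retraction.

(** C is only required to map to every algebra carrying level-zero data. Applied to the operators of
    the coinduced module, this gives a W whose composite with Phi is injective. *)
Lemma levi_injective (C : pzAlgType F) (P M : 'M[C]_n) (Phi : {rmorphism Q -> C}) :
    (forall c : F, Phi (scal c) = scal c) ->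
    (forall k s (i j : 'I_(sz k)), Phi (tin k (ell q (sz k) s i j)) = (if s then M else P) (emb i) (emb j)) ->
    (forall (A : pzAlgType F) (P' M' : 'M[A]_n), level_zero q P' M' ->
       exists W : {rmorphism C -> A},
         [/\ map_mx W P = P', map_mx W M = M' & forall c : F, W (scal c) = scal c]) ->
  injective Phi.
Proof.
move=> Phic PhiE lift.
have [th1 [th1X th1c]] := theta1_exists n q0.
have [th2 [th2X th2c]] := theta2_exists n q0.
have [pi [piX pic]] : exists phi : {rmorphism Uplus q n -> Q},
    (forall i j, phi (Xplus q n i j) = levi_mx false i j) /\ (forall c : F, phi (scal c) = scal c).
  by apply: Uplus_lift; [exact: levi_RLL|exact: levi_lower].
have [W [WP WM Wc]] := lift _ _ _ (retraction_level_zero th1X th1c th2X th2c).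
pose W' : {rmorphism Q -> _} := W \o Phi.
apply: (@inj_compr _ _ _ W Phi).
apply: (@retraction_eval _ _ th1X th1c th2X th2c _ piX pic W') => [c|k s i j].
  by rewrite /= Phic Wc.
by rewrite /= PhiE -WP -WM; case: s; rewrite [RHS]mxE.
Qed.
End LeviBlocks.

(** * Power series *)

(** A name of its own for sequences, to which the convolution ring structure is attached. *)
Definition pser (A : Type) : Type := nat -> A.

Section SeriesRing.
Variable R : pzRingType.
Implicit Types f g h : pser R.

HB.instance Definition _ := gen_eqMixin (pser R).
HB.instance Definition _ := gen_choiceMixin (pser R).

Definition sadd f g : pser R := fun k => f k + g k.
Definition sopp f : pser R := fun k => - f k.
Definition scst (a : R) : pser R := fun k => if k is 0 then a else 0.
Definition spmul f g : pser R := fun k => \sum_(i < k.+1) f i * g (k - i)%N.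

Fact saddA : associative sadd.
Proof. by move=> f g h; apply: funext => k; rewrite /sadd addrA. Qed.
Fact saddC : commutative sadd.
Proof. by move=> f g; apply: funext => k; rewrite /sadd addrC. Qed.
Fact sadd0 : left_id (scst 0) sadd.
Proof. by move=> f; apply: funext => -[|k]; rewrite /sadd add0r. Qed.
Fact saddN : left_inverse (scst 0) sopp sadd.
Proof. by move=> f; apply: funext => -[|k]; rewrite /sadd addNr. Qed.
HB.instance Definition _ := GRing.isZmodule.Build (pser R) saddA saddC sadd0 saddN.

Lemma spmul_rev f g k : spmul f g k = \sum_(i < k.+1) f (k - i)%N * g i.
Proof.
rewrite /spmul (reindex_inj rev_ord_inj) /=; apply: eq_bigr => i _.
by rewrite subSS subKn // -ltnS.
Qed.

Fact spmulA : associative spmul.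
Proof.
move=> f g h; apply: funext => i; rewrite [RHS]spmul_rev.
pose coef3 j k := f j * (g (i - j - k)%N * h k).
transitivity (\sum_(j < i.+1) \sum_(k < i.+1 | (k <= i - j)%N) coef3 j k).
  apply: eq_bigr => /= j _; rewrite spmul_rev big_distrr /=.
  by rewrite (big_ord_narrow_leq (leq_subr _ _)).
rewrite (exchange_big_dep predT) //=; apply: eq_bigr => k _.
transitivity (\sum_(j < i.+1 | (j <= i - k)%N) coef3 j k).
  apply: eq_bigl => j; rewrite -ltnS -(ltnS j) -!subSn ?leq_ord //.
  by rewrite -subn_gt0 -(subn_gt0 j) -!subnDA addnC.
rewrite (big_ord_narrow_leq (leq_subr _ _)) /spmul big_distrl /=.
by apply: eq_bigr => j _; rewrite /coef3 -!subnDA addnC mulrA.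
Qed.

Fact spmul1l : left_id (scst 1) spmul.
Proof.
move=> f; apply: funext => k; rewrite /spmul big_ord_recl /= mul1r subn0 big1 ?addr0 // => i _.
by rewrite mul0r.
Qed.
Fact spmul1r : right_id (scst 1) spmul.
Proof.
move=> f; apply: funext => k; rewrite spmul_rev big_ord_recl /= mulr1 subn0 big1 ?addr0 // => i _.
by rewrite mulr0.
Qed.
Fact spmulDl : left_distributive spmul sadd.
Proof.
move=> f g h; apply: funext => k; rewrite /sadd /spmul -big_split; apply: eq_bigr => i _.
by rewrite mulrDl.
Qed.
Fact spmulDr : right_distributive spmul sadd.
Proof.
move=> f g h; apply: funext => k; rewrite /sadd /spmul -big_split; apply: eq_bigr => i _.
by rewrite mulrDr.
Qed.
HB.instance Definition _ :=
  GRing.Zmodule_isPzRing.Build (pser R) spmulA spmul1l spmul1r spmulDl spmulDr.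

Lemma serM f g k : (f * g) k = \sum_(i < k.+1) f i * g (k - i)%N. Proof. by []. Qed.
Lemma serD f g k : (f + g) k = f k + g k. Proof. by []. Qed.
Lemma serN f k : (- f) k = - f k. Proof. by []. Qed.
Lemma ser0 k : (0 : pser R) k = 0. Proof. by case: k. Qed.
Lemma ser1 k : (1 : pser R) k = (k == 0)%:R. Proof. by case: k. Qed.
Lemma serM0 f g : (f * g) 0%N = f 0%N * g 0%N.
Proof. by rewrite serM big_ord1. Qed.
Lemma ser_sum I (r : seq I) (P : pred I) (F : I -> pser R) k :
  (\sum_(i <- r | P i) F i) k = \sum_(i <- r | P i) F i k.
Proof. by elim/big_rec2: _ => [|i x y _ <-]; rewrite ?ser0. Qed.

Lemma scstMl a f k : (scst a * f) k = a * f k.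
Proof. by rewrite serM big_ord_recl /= subn0 big1 ?addr0 // => i _; rewrite mul0r. Qed.
Lemma scstMr a f k : (f * scst a) k = f k * a.
Proof. by rewrite [LHS]spmul_rev big_ord_recl /= subn0 big1 ?addr0 // => i _; rewrite mulr0. Qed.

Fact scst_is_zmod_morphism : zmod_morphism scst.
Proof. by move=> a b; apply: funext => -[|k]; rewrite serD serN //= subrr. Qed.
Fact scst_is_monoid_morphism : monoid_morphism scst.
Proof.
by split=> // a b; apply: funext => k; rewrite scstMl; case: k => //= k; rewrite mulr0.
Qed.
HB.instance Definition _ := GRing.isZmodMorphism.Build _ _ scst scst_is_zmod_morphism.
HB.instance Definition _ := GRing.isMonoidMorphism.Build _ _ scst scst_is_monoid_morphism.

Lemma ser_expr_small h m k : h 0%N = 0 -> (k < m)%N -> (h ^+ m) k = 0.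
Proof.
move=> h0; elim: m k => // m IHm k km; rewrite exprS serM big1 // => -[[|i] ik] _ /=.
  by rewrite h0 mul0r.
by rewrite IHm ?mulr0 //; lia.
Qed.

(** The geometric series: h^m has no coefficient below m, so each coefficient is a finite sum and
    both products telescope. *)
Lemma ser_geometric h : h 0%N = 0 -> exists g, (1 - h) * g = 1 /\ g * (1 - h) = 1.
Proof.
move=> h0; pose g : pser R := fun k => \sum_(m < k.+1) (h ^+ m) k.
have gE (k l : nat) : (k <= l)%N -> g k = \sum_(m < l.+1) (h ^+ m) k.
  move=> kl; rewrite /g (big_ord_widen l.+1 (fun m => (h ^+ m) k)) ?ltnS //.
  rewrite [LHS]big_mkcond; apply: eq_bigr => m _; case: ltnP => // km.
  by rewrite ser_expr_small.
have tele k : g k - \sum_(m < k.+1) (h ^+ m.+1) k = (1 : pser R) k.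
  rewrite /g big_ord_recl expr0 big_ord_recr /= [(h ^+ k.+1) k]ser_expr_small // addr0.
  by rewrite -addrA -sumrB big1 ?addr0 // => i _; rewrite /bump subrr.
exists g; split; apply: funext => k.
  rewrite mulrBl mul1r serD serN -[RHS]tele; congr (_ - _).
  rewrite serM; under eq_bigr => i _ do rewrite (gE _ k) ?leq_subr // mulr_sumr.
  rewrite exchange_big; apply: eq_bigr => m _.
  by rewrite exprS serM.
rewrite mulrBr mulr1 serD serN -[RHS]tele; congr (_ - _).
rewrite serM; under eq_bigr => i _ do rewrite (gE _ k) -1?ltnS // mulr_suml.
rewrite exchange_big; apply: eq_bigr => m _.
by rewrite exprSr serM.
Qed.

Lemma ser_inverse f u : f 0%N * u = 1 -> u * f 0%N = 1 -> exists g, f * g = 1 /\ g * f = 1.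
Proof.
(* u f has constant term 1, so it is of the form 1 - h. From its inverse G, the inverse of f is G u;
   it is two-sided because u is invertible. *)
move=> fu uf; have [|G [G1 G2]] := @ser_geometric (1 - scst u * f).
  by rewrite serD serN scstMl uf subrr.
rewrite opprB addrCA subrr addr0 in G1 G2.
exists (G * scst u); split; last by rewrite -mulrA.
have fuK x : scst (f 0%N) * (scst u * x) = x by rewrite mulrA -rmorphM fu rmorph1 mul1r.
have -> : f * (G * scst u) = scst (f 0%N) * (scst u * f * G) * scst u.
  by rewrite -[scst u * f * G]mulrA fuK mulrA.
by rewrite G1 mulr1 -rmorphM fu rmorph1.
Qed.

Definition sX : pser R := fun k => (k == 1)%:R.

Lemma sXM f k : (sX * f) k = if k is k'.+1 then f k' else 0.
Proof.
rewrite serM; case: k => [|k]; first by rewrite big_ord1 mul0r.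
rewrite !big_ord_recl /= !mul0r add0r /bump /= mul1r subn1 /= big1 ?addr0 // => i _.
by rewrite mul0r.
Qed.

Lemma sMX f k : (f * sX) k = if k is k'.+1 then f k' else 0.
Proof.
rewrite [LHS]spmul_rev; case: k => [|k]; first by rewrite big_ord1 mulr0.
rewrite !big_ord_recl /= !mulr0 add0r /bump /= mulr1 subn1 /= big1 ?addr0 // => i _.
by rewrite mulr0.
Qed.

Lemma sXC f : sX * f = f * sX.
Proof. by apply: funext => k; rewrite sXM sMX. Qed.

Lemma sX_inj : injective (fun f => sX * f).
Proof. by move=> f g /= fg; apply: funext => k; have := congr1 (fun h : pser R => h k.+1) fg; rewrite !sXM. Qed.
End SeriesRing.

Section SeriesAlgebra.
Variables (F : fieldType) (A : pzAlgType F).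

Let sscal (c : F) : pser A := scst (scal c).
Fact sscal1 : sscal 1 = 1.
Proof. by rewrite /sscal scal1. Qed.
Fact sscalD : {morph sscal : c d / c + d}.
Proof. by move=> c d; rewrite /sscal scalD rmorphD. Qed.
Fact sscalM : {morph sscal : c d / c * d}.
Proof. by move=> c d; rewrite /sscal scalM rmorphM. Qed.
Fact sscalC (c : F) (x : pser A) : sscal c * x = x * sscal c.
Proof. by apply: funext => k; rewrite scstMl scstMr scalC. Qed.
HB.instance Definition _ := hasScalars.Build F (pser A) sscal1 sscalD sscalM sscalC.

Lemma ser_act (c : F) (x : pser A) k : act c x k = act c (x k).
Proof. exact: scstMl. Qed.

Definition spoly (P : {poly F}) : pser A := fun k => scal P`_k.

Lemma spolyZ c P : spoly (c *: P) = act c (spoly P).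
Proof. by apply: funext => k; rewrite ser_act /spoly coefZ /act -scalM. Qed.

Lemma spolyM P1 P2 : spoly (P1 * P2) = spoly P1 * spoly P2.
Proof.
apply: funext => k; rewrite /spoly coefM serM.
have ssum I (r : seq I) (f : I -> F) : scal (\sum_(i <- r) f i) = \sum_(i <- r) scal (f i) :> A.
  by elim/big_rec2: _ => [|i x y _ <-]; rewrite ?scal0 ?scalD.
by rewrite ssum; apply: eq_bigr => i _; rewrite scalM.
Qed.

Lemma spolyC P x : spoly P * x = x * spoly P.
Proof.
apply: funext => k; rewrite serM [RHS]spmul_rev; apply: eq_bigr => i _.
by rewrite scalC.
Qed.

Lemma spolyX : spoly 'X = sX A.
Proof. by apply: funext => k; rewrite /spoly coefX /sX; case: (k == 1%N); rewrite ?scal0 ?scal1. Qed.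
End SeriesAlgebra.

Section MatrixSeriesRing.
Variables (A : pzRingType) (n : nat).
Implicit Types f g : nat -> 'M[A]_n.

(** Turns the convolution [smul] into a matrix product over series, so that the RLL lemmas apply to
    the monodromy matrices. *)
Definition smx f : 'M[pser A]_n := \matrix_(i, j) (fun k => f k i j).

Lemma smx_inj : injective smx.
Proof.
move=> f g fg; apply: funext => k; apply/matrixP => i j.
by have := congr1 (fun M : 'M[pser A]_n => M i j k) fg; rewrite !mxE.
Qed.

Lemma smxM f g : smx (smul f g) = smx f *m smx g.
Proof.
apply/matrixP => i j; apply: funext => k; rewrite !mxE ser_sum /smul summxE.
under eq_bigr do rewrite mxE; rewrite exchange_big; apply: eq_bigr => m _.
by rewrite !mxE serM.
Qed.

Lemma smx1 : smx (@sone A n) = 1%:M.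
Proof.
apply/matrixP => i j; apply: funext => k; rewrite !mxE /sone.
by case: (i == j); case: k => [|k]; rewrite ?mulr1n ?mulr0n ?ser0 //= mul0rn.
Qed.

Lemma smxX : smx (@svar A n) = (sX A)%:M.
Proof.
apply/matrixP => i j; apply: funext => k; rewrite !mxE /svar /sX.
by case: (i == j); rewrite ?mulr1n ?mulr0n ?ser0.
Qed.

Lemma smul_inverse f u : f 0%N *m u = 1%:M -> u *m f 0%N = 1%:M ->
  exists g, smul f g = sone A n /\ smul g f = sone A n.
Proof.
move=> fu uf; have [g [fg gf]] := @ser_inverse 'M[A]_n f u fu uf.
have one : (1 : pser 'M[A]_n) = sone A n.
  by apply: funext => -[|k]; rewrite /sone /= ?eqxx // raddf0.
by exists g; rewrite -one -fg; split=> //; rewrite fg -gf.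
Qed.

Lemma sinvP f g : smul f g = sone A n -> smul g f = sone A n -> sinv f = g.
Proof.
move=> fg gf; rewrite /sinv; case: xgetP => [h _ [fh hf]|/(_ g)]; last by case.
apply: smx_inj; have := congr1 smx fh; have := congr1 smx gf.
rewrite !smxM !smx1 => Gf Fh.
by rewrite -[smx h]mul1mx -Gf -mulmxA Fh mulmx1.
Qed.

(** Uniqueness: for two candidates g and h, both g X and X h equal g f h, and the variable X is
    central and regular. *)
Lemma svarinvP f g : smul f g = svar A n -> smul g f = svar A n -> svarinv f = g.
Proof.
move=> fg gf; rewrite /svarinv; case: xgetP => [h _ [fh hf]|/(_ g)]; last by case.
apply: smx_inj; have := congr1 smx fh; have := congr1 smx gf.
rewrite !smxM !smxX => Gf Fh; apply/matrixP => i j; apply: sX_inj => /=.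
have XE (M : 'M[pser A]_n) a b : ((sX A)%:M *m M) a b = sX A * M a b.
  rewrite mxE (bigD1 a) //= mxE eqxx mulr1n big1 ?addr0 // => c /negPf ca.
  by rewrite mxE eq_sym ca mul0r.
have EX (M : 'M[pser A]_n) a b : (M *m (sX A)%:M) a b = M a b * sX A.
  rewrite mxE (bigD1 b) //= mxE eqxx mulr1n big1 ?addr0 // => c /negPf ca.
  by rewrite mxE ca mulr0.
by rewrite -XE -Gf -mulmxA Fh EX sXC.
Qed.
End MatrixSeriesRing.

(** * The monodromy matrices *)

Section SeriesRLL.
Variables (F : fieldType) (A : pzAlgType F) (n : nat) (p : F) (s : bool).

Lemma ser_rop r t (T : 'I_n -> 'I_n -> pser A) a b k :
  rop (@act F (pser A)) r t T a b k = rop (@act F A) r t (fun a b => T a b k) a b.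
Proof. by rewrite /rop serD !ser_act. Qed.

Lemma RLL_serl (X : 'M[A]_n) (Y : nat -> 'M[A]_n) :
  RLL p s (map_mx (@scst A) X) (smx Y) <-> forall k, RLL p s X (Y k).
Proof.
have E i k j l d : (rop (@act F (pser A)) p s (fun i k => map_mx (@scst A) X i j * smx Y k l) i k) d
    = rop (@act F A) p s (fun i k => X i j * Y d k l) i k.
  by rewrite ser_rop /rop !mxE !scstMl.
have E' i k j l d : (rop (@act F (pser A)) p (~~ s) (fun j l => smx Y k l * map_mx (@scst A) X i j) j l) d
    = rop (@act F A) p (~~ s) (fun j l => Y d k l * X i j) j l.
  by rewrite ser_rop /rop !mxE !scstMr.
split=> [XY d i k j l|XY i k j l]; first by rewrite -E XY E'.
by apply: funext => d; rewrite E XY E'.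
Qed.

Lemma RLL_serr (X : nat -> 'M[A]_n) (Y : 'M[A]_n) :
  RLL p s (smx X) (map_mx (@scst A) Y) <-> forall k, RLL p s (X k) Y.
Proof.
have E i k j l d : (rop (@act F (pser A)) p s (fun i k => smx X i j * map_mx (@scst A) Y k l) i k) d
    = rop (@act F A) p s (fun i k => X d i j * Y k l) i k.
  by rewrite ser_rop /rop !mxE !scstMr.
have E' i k j l d : (rop (@act F (pser A)) p (~~ s) (fun j l => map_mx (@scst A) Y k l * smx X i j) j l) d
    = rop (@act F A) p (~~ s) (fun j l => Y k l * X d i j) j l.
  by rewrite ser_rop /rop !mxE !scstMl.
split=> [XY d i k j l|XY i k j l]; first by rewrite -E XY E'.
by apply: funext => d; rewrite E XY E'.
Qed.
End SeriesRLL.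

Section Monodromy.
Variables (F : fieldType) (q : F) (n N : nat).
Hypothesis q0 : q != 0.
Notation p := (q^-1).
Notation C := (chainAlg q n N).
Notation tin i u := (tensor_in (A := fun _ : 'I_N => Uaff q n) (i := i) u).

Let site (i : 'I_N) (s : bool) (k : nat) : 'M[C]_n :=
  map_mx (tensor_in (A := fun _ : 'I_N => Uaff q n) (i := i)) (Lgen q n s k).
Let mon (r : seq 'I_N) (s : bool) : nat -> 'M[C]_n :=
  \big[@smul C n/@sone C n]_(i <- r) site i s.

Let mon_cons i r s : mon (i :: r) s = smul (site i s) (mon r s).
Proof. by rewrite /mon big_cons. Qed.

Let smul0 (f g : nat -> 'M[C]_n) : smul f g 0%N = f 0%N *m g 0%N.
Proof. by rewrite /smul big_ord1. Qed.

Let site_level_zero i : level_zero q (site i true 0) (site i false 0).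
Proof.
have [iota [iotaE iotac]] := tensor_in_morph (fun _ : 'I_N => Uaff q n) i.
have E s : site i s 0 = map_mx iota (Lgen q n s 0).
  by apply/matrixP => a b; rewrite [LHS]mxE [RHS]mxE iotaE.
by rewrite !E; exact: level_zero_map iotac (Lgen_level_zero n q0).
Qed.

Let site_plus i s k : RLL p false (site i true 0) (site i s k).
Proof.
have [iota [iotaE iotac]] := tensor_in_morph (fun _ : 'I_N => Uaff q n) i.
have E t d : site i t d = map_mx iota (Lgen q n t d).
  by apply/matrixP => a b; rewrite [LHS]mxE [RHS]mxE iotaE.
by rewrite !E; exact: (RLL_map iotac (@RLL_Lgen_plus F q n q0 s k)).
Qed.

Let site_minus i s k : RLL p false (site i s k) (site i false 0).
Proof.
have [iota [iotaE iotac]] := tensor_in_morph (fun _ : 'I_N => Uaff q n) i.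
have E t d : site i t d = map_mx iota (Lgen q n t d).
  by apply/matrixP => a b; rewrite [LHS]mxE [RHS]mxE iotaE.
by rewrite !E; exact: (RLL_map iotac (@RLL_Lgen_minus F q n q0 s k)).
Qed.

Let mon_comm i r s k a b (u : Uaff q n) : i \notin r -> GRing.comm (tin i u) (mon r s k a b).
Proof.
elim: r k a b => [|j r IHr] k a b.
  rewrite /mon big_nil /sone mxE => _.
  by case: (k == _); case: (a == _); rewrite ?mulr1n ?mulr0n;
    first [exact: commr1|exact: commr0].
rewrite inE negb_or => /andP[ij ir]; rewrite mon_cons /smul summxE.
apply: commr_sum => d _; rewrite mxE; apply: commr_sum => c _.
apply: commrM; last exact: IHr.
by rewrite mxE; exact: tensor_in_comm.
Qed.

Let site_mon_comm i r s s' k k' a b c d : i \notin r ->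
  GRing.comm (site i s k a b) (mon r s' k' c d).
Proof. by move=> ir; rewrite [site _ _ _ _ _]mxE; exact: mon_comm. Qed.

Let ser_comm (x : C) (f : pser C) : (forall k, GRing.comm x (f k)) -> GRing.comm (scst x) f.
Proof. by move=> xf; apply: funext => k; rewrite scstMl scstMr xf. Qed.

Let map_scstM (X Y : 'M[C]_n) : map_mx (@scst C) (X *m Y) = map_mx (@scst C) X *m map_mx (@scst C) Y.
Proof. by rewrite map_mxM. Qed.

Let RLL1 : RLL p false (1%:M : 'M[pser C]_n) 1%:M.
Proof. exact: (lz_pp (level_zero1 q n (pser C))). Qed.

Let mon_nil s : mon [::] s = sone C n. Proof. by rewrite /mon big_nil. Qed.

Let map_scst_sone : map_mx (@scst C) (sone C n 0) = 1%:M.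
Proof. by rewrite /sone eqxx; exact: map_mx1. Qed.

(** Distinctness of the sites in r gives the commutation required by [RLL_mul]. *)
Let mon_plus r s : uniq r -> RLL p false (map_mx (@scst C) (mon r true 0)) (smx (mon r s)).
Proof.
elim: r => [|i r IHr] /=.
  by move=> _; rewrite !mon_nil map_scst_sone smx1; exact: RLL1.
case/andP=> ir /IHr{}IHr; rewrite !mon_cons smul0 map_scstM smxM.
apply: RLL_mul; [by apply/RLL_serl => k; exact: site_plus|exact: IHr| |].
- by move=> a b c d; rewrite [map_mx _ _ _ _]mxE; apply: ser_comm => k; rewrite [smx _ _ _]mxE; exact: site_mon_comm.
- move=> a b c d; rewrite [map_mx _ _ _ _]mxE; apply: ser_comm => k; rewrite [smx _ _ _]mxE.
  by apply: commr_sym; exact: site_mon_comm.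
Qed.

Let mon_minus r s : uniq r -> RLL p false (smx (mon r s)) (map_mx (@scst C) (mon r false 0)).
Proof.
elim: r => [|i r IHr] /=.
  by move=> _; rewrite !mon_nil map_scst_sone smx1; exact: RLL1.
case/andP=> ir /IHr{}IHr; rewrite !mon_cons smul0 map_scstM smxM.
apply: RLL_mul; [by apply/RLL_serr => k; exact: site_minus|exact: IHr| |].
- move=> a b c d; rewrite [map_mx _ _ _ _]mxE; apply/commr_sym/ser_comm => k; rewrite [smx _ _ _]mxE.
  by apply: commr_sym; exact: site_mon_comm.
- move=> a b c d; rewrite [map_mx _ _ _ _]mxE; apply/commr_sym/ser_comm => k; rewrite [smx _ _ _]mxE.
  exact: site_mon_comm.
Qed.

Let mon0_lower r (a b : 'I_n) : (a < b)%N -> mon r true 0 a b = 0.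
Proof.
elim: r a b => [|i r IHr] a b ab.
  by rewrite /mon big_nil /sone eqxx mxE; case: eqP ab => // ->; rewrite ltnn.
rewrite mon_cons smul0 mxE big1 // => c _; case: (ltnP a c) => ac.
  by rewrite (lz_lower (site_level_zero i)) // mul0r.
by rewrite IHr ?mulr0 // (leq_ltn_trans ac).
Qed.

Let mon0_upper r (a b : 'I_n) : (b < a)%N -> mon r false 0 a b = 0.
Proof.
elim: r a b => [|i r IHr] a b ab.
  by rewrite /mon big_nil /sone eqxx mxE; case: eqP ab => // ->; rewrite ltnn.
rewrite mon_cons smul0 mxE big1 // => c _; case: (ltnP c a) => ac.
  by rewrite (lz_upper (site_level_zero i)) // mul0r.
by rewrite IHr ?mulr0 // (leq_trans ab).
Qed.

Let mon0_diagE i r s a : mon (i :: r) s 0 a a = site i s 0 a a * mon r s 0 a a.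
Proof.
rewrite mon_cons smul0 mxE (bigD1 a) //= big1 ?addr0 // => c ca.
have := lz_lower (site_level_zero i); have := lz_upper (site_level_zero i) => up lo.
move: ca; rewrite -val_eqE neq_ltn => /orP[ca|ca]; case: s.
- by rewrite mon0_lower // mulr0.
- by rewrite up // mul0r.
- by rewrite lo // mul0r.
- by rewrite mon0_upper // mulr0.
Qed.

Let mon0_diag r s a : uniq r -> mon r s 0 a a * mon r (~~ s) 0 a a = 1.
Proof.
elim: r => [|i r IHr] /=; first by rewrite /mon !big_nil /sone eqxx !mxE eqxx mulr1.
case/andP=> ir /IHr{}IHr; rewrite !mon0_diagE.
rewrite -mulrA [mon r s 0 a a * _]mulrA -[mon r s 0 a a * site _ _ _ _ _]site_mon_comm //.
rewrite -[_ * mon r s 0 a a * _]mulrA IHr mulr1.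
by case: s {IHr}; [rewrite (lz_diagPM (site_level_zero i))|rewrite (lz_diagMP (site_level_zero i))].
Qed.

Let monE s : monodromy q n N s = mon (index_enum 'I_N) s.
Proof. by []. Qed.

Lemma monodromy_plus s :
  RLL p false (map_mx (@scst C) (monodromy q n N true 0)) (smx (monodromy q n N s)).
Proof. by rewrite !monE; exact/mon_plus/index_enum_uniq. Qed.

Lemma monodromy_minus s :
  RLL p false (smx (monodromy q n N s)) (map_mx (@scst C) (monodromy q n N false 0)).
Proof. by rewrite !monE; exact/mon_minus/index_enum_uniq. Qed.

Lemma monodromy_level_zero : level_zero q (monodromy q n N true 0) (monodromy q n N false 0).
Proof.
split.
- by have /RLL_serl := monodromy_plus true.
- by have /RLL_serr := monodromy_minus false.
- by have /RLL_serl := monodromy_plus false.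
- by move=> a b; rewrite monE; exact: mon0_lower.
- by move=> a b; rewrite monE; exact: mon0_upper.
- by move=> a; rewrite !monE; exact/(mon0_diag true)/index_enum_uniq.
- by move=> a; rewrite !monE; exact/(mon0_diag false)/index_enum_uniq.
Qed.

(* The tensor factors other than the first one are mapped to scalars by the
   counit. *)
Lemma chain_lift (A : pzAlgType F) (P M : 'M[A]_n) : (0 < N)%N -> level_zero q P M ->
  exists W : {rmorphism C -> A},
    [/\ map_mx W (monodromy q n N true 0) = P, map_mx W (monodromy q n N false 0) = M
      & forall c : F, W (scal c) = scal c].
Proof.
move=> N0 PM; pose i0 := Ordinal N0.
have [f0 [f0P f0M _ f0c]] := Uaff_lift q0 PM.
have [f1 [f1P f1M f1L f1c]] := Uaff_lift q0 (level_zero1 q n A).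
pose f (i : 'I_N) : {rmorphism Uaff q n -> A} := if i == i0 then f0 else f1.
(* f1 sends every generator to 0 or 1, so its image is central; [tensor_lift] requires the images of
   distinct sites to commute. *)
have f1comm u x : GRing.comm (f1 u) x.
  apply: commr_sym; move: u; apply: presAlg_ind => [c|u v hu hv|u v hu hv|[[[s k] a] b]].
  - by rewrite f1c; apply: commr_sym; exact: scalC.
  - by rewrite rmorphD; exact: commrD.
  - by rewrite rmorphM; exact: commrM.
  have := f1L s k => /matrixP/(_ a b); rewrite [LHS]mxE [X in f1 X]mxE => ->.
  have c1 : GRing.comm x ((1%:M : 'M[A]_n) a b).
    by rewrite mxE; case: (a == b); [exact: commr1|exact: commr0].
  rewrite /evalL; case: ifP => _; first by case: s.
  case: ifP => _; first by case: s.
  by rewrite mxE; exact: commr0.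
have [||W [WE Wc]] := @tensor_lift F 'I_N (fun _ => Uaff q n) A f.
- by move=> i c; rewrite /f; case: ifP.
- move=> i j u v ij; rewrite /f; case: (eqVneq i i0) => [ii|_]; last exact: f1comm.
  case: (eqVneq j i0) => [jj|_]; first by rewrite ii jj eqxx in ij.
  by apply: commr_sym; exact: f1comm.
have WM s : map_mx W (monodromy q n N s 0) = if s then P else M.
  have site0 i : map_mx W (site i s 0) = if i == i0 then (if s then P else M) else 1%:M.
    have -> : map_mx W (site i s 0) = map_mx (f i) (Lgen q n s 0).
      apply/matrixP => a b; rewrite [LHS]mxE [RHS]mxE [X in W X]mxE; exact: WE.
    by rewrite /f; case: (i == i0); case: s => //=.
  have monr r : uniq r -> map_mx W (mon r s 0) = if i0 \in r then (if s then P else M) else 1%:M.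
    elim: r => [|i r IHr] /=; first by rewrite /mon big_nil /sone eqxx map_mx1.
    case/andP=> ir /IHr{}IHr; rewrite mon_cons smul0 map_mxM site0 IHr inE [i0 == i]eq_sym.
    by case: eqP ir => [->|_ _] /=; [move/negPf->; rewrite mulmx1|rewrite mul1mx].
  by rewrite monE monr ?mem_index_enum ?index_enum_uniq.
by exists W; rewrite !WM.
Qed.
End Monodromy.

(** * Inverses of triangular matrices over a noncommutative ring *)

Section TriangularInverse.
Variables (A : pzRingType) (n : nat) (s : bool).

(** After division by the diagonal, D X = 1 - h with h strictly triangular, hence nilpotent; the
    geometric sum G gives the inverse G D, triangular because every power of h is. *)
Lemma lts_triangular_inverse (X : 'M[A]_n) (d : 'I_n -> A) :
    (forall a b, lts s b a -> X a b = 0) ->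
    (forall a, X a a * d a = 1) -> (forall a, d a * X a a = 1) ->
  exists Y : 'M[A]_n, [/\ X *m Y = 1%:M, Y *m X = 1%:M & forall a b, lts s b a -> Y a b = 0].
Proof.
move=> X0 Xd dX; pose D : 'M[A]_n := diag_mx (\row_a d a).
pose D' : 'M[A]_n := diag_mx (\row_a X a a).
have DE (Z : 'M[A]_n) a b : (D *m Z) a b = d a * Z a b.
  rewrite mxE (bigD1 a) //= !mxE eqxx mulr1n big1 ?addr0 // => c /negPf ca.
  by rewrite !mxE eq_sym ca mul0r.
have ZD (Z : 'M[A]_n) a b : (Z *m D) a b = Z a b * d b.
  rewrite mxE (bigD1 b) //= !mxE eqxx mulr1n big1 ?addr0 // => c /negPf ca.
  by rewrite !mxE ca mulr0.
have D'D : D' *m D = 1%:M.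
  by apply/matrixP => a b; rewrite ZD !mxE; case: eqP => [->|_]; rewrite ?mulr1n ?Xd // mul0r.
have DD' : D *m D' = 1%:M.
  by apply/matrixP => a b; rewrite DE !mxE; case: eqP => [->|_]; rewrite ?mulr1n ?dX // mulr0.
pose h : 'M[A]_n := 1 - D *m X.
(* A rank that increases along [lts s] for either s, so that upper and lower triangular matrices are
   treated together. *)
pose rk (a : 'I_n) : nat := if s then (a : nat) else (n - a)%N.
have rk_lts a b : lts s a b = (rk a < rk b)%N.
  by rewrite /rk /lts; case: s => //; have := ltn_ord a; have := ltn_ord b; lia.
have rk_n a : (rk a <= n)%N by rewrite /rk; case: s; have := ltn_ord a; lia.
have h0 m a b : (rk b < rk a + m)%N -> (h ^+ m) a b = 0.
  elim: m a b => [|m IHm] a b ab.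
    by rewrite mxE; case: eqP ab => // ->; rewrite addn0 ltnn.
  rewrite exprS mxE big1 // => c _; case: (ltnP (rk a) (rk c)) => ac.
    by rewrite IHm ?mulr0 //; lia.
  suff -> : h a c = 0 by rewrite mul0r.
  rewrite [LHS]mxE [X in X + _]mxE [X in _ + X]mxE DE; case: (eqVneq a c) => [<-|nac]; first by rewrite dX mulr1n subrr.
  rewrite mulr0n X0 ?mulr0 ?subrr //.
  by move: (lts_total s nac); rewrite !rk_lts ltnNge ac.
have hn : h ^+ n.+1 = 0 by apply/matrixP => a b; rewrite h0 ?mxE //; have := rk_n b; lia.
pose G : 'M[A]_n := \sum_(m < n.+1) h ^+ m.
have DXh : D *m X = 1 - h by rewrite /h opprB addrCA subrr addr0.
have G1 : D *m X *m G = 1.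
  have := subrX1 h n.+1; rewrite hn sub0r -[h - 1]opprB mulNr => /oppr_inj E.
  by rewrite DXh; exact: esym.
have G2 : G *m (D *m X) = 1.
  rewrite -G1 DXh; apply/esym; rewrite -[LHS]/((1 - h) * G) -[RHS]/(G * (1 - h)).
  rewrite mulrBl mulrBr mul1r mulr1; congr (_ - _).
  by apply: commr_sum => m _; exact: commrX.
exists (G *m D); split.
- by rewrite -[X]mul1mx -D'D -mulmxA [X in _ *m X]mulmxA -[X in _ *m X]mulmxA -mulmxA [D *m _]mulmxA [D *m X *m _]mulmxA G1 mul1mx.
- by rewrite -mulmxA G2.
move=> a b ba; rewrite ZD summxE big1 ?mul0r // => m _.
by apply: h0; move: ba; rewrite rk_lts; lia.
Qed.
End TriangularInverse.

(** * Commutation with the transfer matrix *)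

Section BlockCommutation.
Variables (F : fieldType) (S : pzAlgType F) (n : nat) (p : F) (s : bool).
Hypothesis p0 : p != 0.
Variables (g : 'I_n -> nat).
Hypothesis g_mono : forall a b : 'I_n, (a <= b)%N -> (g a <= g b)%N.

Variables (l T T' U : 'M[S]_n) (K kappa : 'I_n -> S).
Hypothesis lT : RLL p s l T.
Hypothesis lT' : RLL p s l T'.
Hypothesis T'U : T' *m U = 1%:M.
Hypothesis UT' : U *m T' = 1%:M.
Hypothesis l_tri : forall a b, lts s b a -> l a b = 0.
Hypothesis K_central : forall a x, K a * x = x * K a.
Hypothesis K_block : forall a b, g a = g b -> K a = K b.
Hypothesis kappa_central : forall a x, kappa a * x = x * kappa a.
(** Cancellation of the coefficient of B_im l_mj in the commutator of l_ij with the weighted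
    trace. *)
Hypothesis kappa_block : forall i m, g i = g m -> lts s i m ->
  \sum_k act (rr p s i k * rr p s k m) (kappa k) =
  act (rr p s i m) (act p^-1 (kappa i) - act p (kappa m)).

Let B : 'M[S]_n := T *m diag_mx (\row_a K a) *m U.

(* The blocks in the second space of R l_1 and of l_1 R. *)
Let Rl i j : 'M[S]_n := \matrix_(k, m)
  (act (cc p i k) ((k == m)%:R * l i j) + act (rr p s i k) ((i == m)%:R * l k j)).
Let lR i j : 'M[S]_n := \matrix_(k, m)
  (act (cc p j m) ((k == m)%:R * l i j) + act (rr p (~~ s) j m) ((k == j)%:R * l i m)).

Let RlE i j (X : 'M[S]_n) k m :
  (Rl i j *m X) k m = act (cc p i k) (l i j * X k m) + act (rr p s i k) (l k j * X i m).
Proof.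
rewrite mxE; under eq_bigr do rewrite mxE mulrDl -!actMl -!mulrA.
rewrite big_split /=; congr (_ + _).
  rewrite (bigD1 k) //= eqxx mul1r big1 ?addr0 // => t /negPf tk.
  by rewrite eq_sym tk mul0r act0.
rewrite (bigD1 i) //= eqxx mul1r big1 ?addr0 // => t /negPf tk.
by rewrite eq_sym tk mul0r act0.
Qed.

Let ElR i j (X : 'M[S]_n) k m :
  (X *m lR i j) k m = act (cc p j m) (X k m * l i j) + act (rr p (~~ s) j m) (X k j * l i m).
Proof.
rewrite mxE; under eq_bigr do rewrite mxE mulrDr -!actMr !mulrA.
rewrite big_split /=; congr (_ + _).
  rewrite (bigD1 m) //= eqxx mulr1 big1 ?addr0 // => t /negPf tk.
  by rewrite tk mulr0 mul0r act0.
rewrite (bigD1 j) //= eqxx mulr1 big1 ?addr0 // => t /negPf tk.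
by rewrite tk mulr0 mul0r act0.
Qed.

Let ERl i j (X : 'M[S]_n) k m :
  (X *m Rl i j) k m = act (cc p i m) (X k m * l i j) +
    (if i == m then \sum_t act (rr p s i t) (X k t * l t j) else 0).
Proof.
rewrite mxE; under eq_bigr do rewrite mxE mulrDr -!actMr !mulrA.
rewrite big_split /=; congr (_ + _).
  rewrite (bigD1 m) //= eqxx mulr1 big1 ?addr0 // => t /negPf tk.
  by rewrite tk mulr0 mul0r act0.
case: (i == m); first by apply: eq_bigr => t _; rewrite mulr1.
by rewrite big1 // => t _; rewrite mulr0 mul0r act0.
Qed.

Let Rl_lR X : RLL p s l X -> forall i j, Rl i j *m X = X *m lR i j.
Proof.
by move=> lX i j; apply/matrixP => k m; rewrite RlE ElR; exact: lX.
Qed.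

Lemma block_between a b c : lts s a b -> lts s b c -> g a = g c -> g b = g a.
Proof.
rewrite /lts; case: s => /= ab bc ac.
  by apply/eqP; rewrite eqn_leq {1}ac !g_mono // ltnW.
by apply/eqP; rewrite eqn_leq {2}ac !g_mono // ltnW.
Qed.

Let RlB i j : g i = g j -> Rl i j *m B = B *m Rl i j.
Proof.
(* An off-diagonal entry of lR i j contains l i m with m strictly before j in the order s; it
   vanishes unless m = i or m lies after i. So m is in the block of i and j, where K is constant. *)
move=> ij; have KlR : diag_mx (\row_a K a) *m lR i j = lR i j *m diag_mx (\row_a K a).
  apply/matrixP => k m; rewrite !mxE (bigD1 k) //= [RHS](bigD1 m) //= !mxE !eqxx !mulr1n.
  rewrite [X in _ + X]big1 ?addr0 => [|t /negPf tk]; last by rewrite !mxE eq_sym tk mul0r.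
  rewrite [X in _ = _ + X]big1 ?addr0 => [|t /negPf tk]; last by rewrite !mxE tk mulr0.
  rewrite K_central !mulrDl -!actMl; congr (_ + _).
    by case: (eqVneq k m) => [->//|_]; rewrite !mul0r.
  case: (eqVneq k j) => [->|_]; last by rewrite !mul0r.
  rewrite /rr ltsC; case: ifP => mj; last by rewrite !act0l.
  case: (eqVneq i m) => [<-|im]; first by rewrite (K_block ij).
  case/orP: (lts_total s im) => h; last by rewrite l_tri // mulr0 !mul0r.
  by rewrite (K_block (a := m) (b := j)) // -ij (block_between h mj).
have UlR : U *m Rl i j = lR i j *m U.
  rewrite -[LHS]mulmx1 -T'U -mulmxA [Rl i j *m _]mulmxA (Rl_lR lT').
  by rewrite !mulmxA UT' mul1mx.
by rewrite /B -[RHS]mulmxA UlR !mulmxA (Rl_lR lT) -[T *m lR i j *m _]mulmxA -KlR !mulmxA.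
Qed.

Let comm_diag_ne i j k : g i = g j -> k != i ->
  l i j * B k k - B k k * l i j = - act (rr p s i k) (l k j * B i k).
Proof.
move=> ij ki; have := congr1 (fun M : 'M[S]_n => M k k) (RlB ij).
rewrite RlE ERl [i == k]eq_sym (negPf ki) addr0 /cc [i == k]eq_sym (negPf ki) !act1 => <-.
by rewrite opprD addrA subrr sub0r.
Qed.

Let rr_le (a b : 'I_n) : lts s a b = false -> rr p s a b = 0.
Proof. by rewrite /rr => ->. Qed.

Let y i j m := B i m * l m j.

Let comm_diag_eq i j : g i = g j ->
  l i j * B i i - B i i * l i j = act p^-1 (\sum_m act (rr p s i m) (y i j m)).
Proof.
move=> ij; have := congr1 (fun M : 'M[S]_n => M i i) (RlB ij).
rewrite RlE ERl eqxx ccxx (rr_le (ltsxx s i)) act0l addr0 => E.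
transitivity (act p^-1 (act p (l i j * B i i) - act p (B i i * l i j))).
  by rewrite actD actN !actA mulVf // !act1.
by rewrite E addrC addKr.
Qed.

(** Puts every product in the order B l. If k is in the block of j, [RlB] applies to k and j;
    otherwise k lies beyond j, and every term contains an entry of l that is zero by
    triangularity. *)
Let offdiag i j k : g i = g j -> lts s i k ->
  l k j * B i k = act p (y i j k) + \sum_m act (rr p s k m) (y i j m).
Proof.
move=> ij ik; case: (eqVneq (g k) (g j)) => [kj|kj].
  have := congr1 (fun M : 'M[S]_n => M i k) (RlB kj).
  rewrite RlE ERl eqxx ccxx (rr_le (ltsF ik)) act0l addr0.
  by rewrite /cc eq_sym (negPf (lts_neq ik)) act1.
have jk : lts s j k.
  case: (eqVneq j k) kj => [->|jk]; first by rewrite eqxx.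
  case/orP: (lts_total s jk) => // kj /eqP[].
  by rewrite (block_between ik kj).
rewrite l_tri // mul0r /y l_tri // mulr0 act0 add0r big1 // => m _.
rewrite /rr; case: ifP => km; last by rewrite act0l.
by rewrite l_tri ?mulr0 ?act0 // (lts_trans jk km).
Qed.

(** The diagonal entries of [RlB] express the commutator through the products l_kj B_ik and B_im
    l_mj. Once [offdiag] has reordered the former, the coefficient of B_im l_mj is zero by
    [kappa_block] for m in the block; outside it, l_mj is zero or the coefficient is. *)
Lemma block_comm_trace i j : g i = g j ->
  GRing.comm (l i j) (\sum_k kappa k * B k k).
Proof.
move=> ij; apply/eqP; rewrite -subr_eq0; apply/eqP.
rewrite mulr_sumr mulr_suml -sumrB.
transitivity (\sum_k kappa k * (l i j * B k k - B k k * l i j)).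
  by apply: eq_bigr => k _; rewrite mulrBr !mulrA -[l i j * kappa k]kappa_central.
rewrite (bigD1 i) //= comm_diag_eq //.
transitivity (\sum_m act (rr p s i m) (act p^-1 (kappa i) * y i j m) -
   \sum_k act (rr p s i k) (kappa k * (l k j * B i k))).
  congr (_ + _).
    by rewrite act_sum mulr_sumr; apply: eq_bigr => m _; rewrite -!actMr -actMl !actA mulrC.
  rewrite [X in _ = - X](bigD1 i) //= {1}/rr ltsxx act0l add0r -sumrN.
  by apply: eq_bigr => k ki; rewrite comm_diag_ne // mulrN -actMr.
have E k : act (rr p s i k) (kappa k * (l k j * B i k)) =
  act (rr p s i k) (act p (kappa k) * y i j k) +
  \sum_m act (rr p s i k * rr p s k m) (kappa k) * y i j m.
  case: (boolP (lts s i k)) => ik; last first.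
    rewrite {1 2}/rr (negPf ik) !act0l add0r big1 // => m _.
    by rewrite {1}/rr (negPf ik) mul0r act0l mul0r.
  rewrite offdiag // mulrDr actD; congr (_ + _); first by rewrite -actMr actMl.
  rewrite mulr_sumr act_sum; apply: eq_bigr => m _.
  by rewrite -actMr -actMl actA.
under [X in _ - X]eq_bigr do rewrite E.
rewrite big_split /= exchange_big opprD addrA -!sumrB big1 // => m _.
rewrite -mulr_suml -actN -mulNr -actD -mulrDl actMl -mulrBl.
case: (boolP (lts s i m)) => im; last first.
  rewrite {1}/rr (negPf im) act0l sub0r big1 ?oppr0 ?mul0r // => k _.
  rewrite /rr; case: ifP => ik; rewrite ?mul0r ?act0l //.
  case: ifP => km; rewrite ?mulr0 ?act0l //.
  by rewrite (lts_trans ik km) in im.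
case: (eqVneq (g i) (g m)) => gim; first by rewrite kappa_block // subrr mul0r.
rewrite /y l_tri ?mulr0 //.
case: (eqVneq j m) gim => [jm|jm]; first by rewrite -jm -ij eqxx.
case/orP: (lts_total s jm) => // mj /eqP[].
by rewrite (block_between im mj).
Qed.
End BlockCommutation.

(** * Weights of the quantum trace *)

Section QuantumTraceWeights.
Variables (F : fieldType) (q : F) (n : nat).
Hypothesis q0 : q != 0.

(* The hypothesis [kappa_block] of [block_comm_trace] for the weights of the
   quantum trace: multiplied by q - 1/q, they telescope. *)
Lemma qtrace_weights s (i m : 'I_n) : lts s i m ->
  let p := rpar q s in
  \sum_k rr p s i k * rr p s k m * q ^- (2 * k.+1) =
  rr p s i m * (p^-1 * q ^- (2 * i.+1) - p * q ^- (2 * m.+1)).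
Proof.
have mul2S k : (2 * k.+1)%N = (2 * k).+2 by lia.
have tele (a b : nat) : (a < b)%N ->
    \sum_(a.+1 <= k < b) (q - q^-1) * q ^- (2 * k.+1) = q^-1 * q ^- (2 * a.+1) - q * q ^- (2 * b.+1).
  (* (q - 1/q) q^(-2k-2) = q^(-2k-1) - q^(-2k-3). *)
  move=> ab; transitivity (\sum_(a.+1 <= k < b) (- q ^- (2 * k.+1).+1 - - q ^- (2 * k).+1)).
    apply: eq_bigr => k _; rewrite mulrBl opprK [RHS]addrC -!exprVn mul2S -exprS.
    by congr (_ - _); rewrite exprS mulrA mulfV // mul1r.
  rewrite telescope_sumr // opprK addrC -!exprVn -exprS !mul2S; congr (_ - _).
  by rewrite [in RHS]exprS mulrA mulfV // mul1r.
have sumI (a b : 'I_n) (w : nat -> F) : \sum_(k < n | (a < k < b)%N) w k = \sum_(a.+1 <= k < b) w k.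
  rewrite [RHS](big_nat_widen _ _ n) ?(ltnW (ltn_ord b)) //.
  rewrite [RHS](big_nat_widenl _ 0) // big_mkord.
  by apply: eq_bigl => k; rewrite andbC.
case: s => /= im.
  transitivity (\sum_(k < n | (i < k < m)%N) (q - q^-1) * ((q - q^-1) * q ^- (2 * k.+1))).
    rewrite [RHS]big_mkcond; apply: eq_bigr => k _; rewrite /rr /=.
    by case: (i < k)%N; case: (k < m)%N; rewrite ?mul0r ?mulr0 ?mul0r // mulrA.
  by rewrite -mulr_sumr (sumI _ _ (fun k => (q - q^-1) * q ^- (2 * k.+1))) tele // /rr /= im.
transitivity (\sum_(k < n | (m < k < i)%N) (q^-1 - q^-1^-1) * ((q^-1 - q^-1^-1) * q ^- (2 * k.+1))).
  rewrite [RHS]big_mkcond; apply: eq_bigr => k _; rewrite /rr /= andbC.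
  by case: (k < i)%N; case: (m < k)%N; rewrite ?mul0r ?mulr0 ?mul0r // mulrA.
rewrite -mulr_sumr /rr /= im invrK; congr (_ * _).
transitivity (- \sum_(k < n | (m < k < i)%N) (q - q^-1) * q ^- (2 * k.+1)).
  by rewrite -sumrN; apply: eq_bigr => k _; rewrite -mulNr opprB.
by rewrite (sumI _ _ (fun k => (q - q^-1) * q ^- (2 * k.+1))) tele // opprB.
Qed.
End QuantumTraceWeights.

(** * The open chain: commutation and symmetry algebra *)

Section OpenChainSymmetry.
Variables (F : fieldType) (q xi xip rho : F) (n N M Mp : nat).
Hypothesis q0 : q != 0.
Hypothesis N0 : (0 < N)%N.
Hypothesis xi0 : xi != 0.
Hypothesis Mn : (M <= n)%N.
Hypothesis Mpn : (Mp <= n)%N.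
Notation C := (chainAlg q n N).
Notation Tp := (monodromy q n N true).
Notation Tm := (monodromy q n N false).
Notation b := (transfer q n N xi M rho xip Mp).
Notation "X %:S" := (map_mx (@scst C) X) (at level 2, format "X %:S").

Let qV0 : q^-1 != 0. Proof. by rewrite invr_eq0. Qed.
Let LZ := monodromy_level_zero n N q0.

(* Two indices have the same image iff they are in the same block. *)
Definition blk (a : 'I_n) : nat := (M <= a)%N + (Mp <= a)%N.

Lemma blk_mono (a c : 'I_n) : (a <= c)%N -> (blk a <= blk c)%N.
Proof. by rewrite /blk; lia. Qed.

Lemma blkP (a c : 'I_n) : blk a = blk c -> (M <= a)%N = (M <= c)%N /\ (Mp <= a)%N = (Mp <= c)%N.
Proof. by rewrite /blk; lia. Qed.

Lemma smx_diag (d : 'I_n -> {poly F}) :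
  smx (diag_series q N d) = diag_mx (\row_a spoly C (d a)).
Proof.
apply/matrixP => i j; apply: funext => k; rewrite !mxE.
by case: (i == j); rewrite ?mulr1n ?mulr0n ?ser0.
Qed.

Lemma tr_smx (X : nat -> 'M[C]_n) k : \tr (X k) = (\tr (smx X)) k.
Proof. by rewrite /mxtrace ser_sum; apply: eq_bigr => i _; rewrite mxE. Qed.

Lemma smul_coef0 (f g : nat -> 'M[C]_n) : smul f g 0%N = f 0%N *m g 0%N.
Proof. by rewrite /smul big_ord1. Qed.

Let minus_inverse : exists V : 'M[C]_n,
  [/\ Tm 0 *m V = 1%:M, V *m Tm 0 = 1%:M & forall a c, lts true c a -> V a c = 0].
Proof.
apply: (lts_triangular_inverse (d := fun a => Tp 0 a a)).
- by move=> a c /= ca; rewrite (lz_upper LZ).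
- by move=> a; exact: lz_diagMP LZ _.
- by move=> a; exact: lz_diagPM LZ _.
Qed.

Let plus_inverse : exists V : 'M[C]_n,
  [/\ Tp 0 *m V = 1%:M, V *m Tp 0 = 1%:M & forall a c, lts false c a -> V a c = 0].
Proof.
apply: (lts_triangular_inverse (d := fun a => Tm 0 a a)).
- by move=> a c /= ca; rewrite (lz_lower LZ).
- by move=> a; exact: lz_diagPM LZ _.
- by move=> a; exact: lz_diagMP LZ _.
Qed.

Let series_inverse (f : nat -> 'M[C]_n) V : f 0%N *m V = 1%:M -> V *m f 0%N = 1%:M ->
  exists g, [/\ smul f g = sone C n, smul g f = sone C n & g 0%N = V].
Proof.
move=> fV Vf; have [g [fg gf]] := smul_inverse fV Vf.
exists g; split=> //; have := congr1 (fun h => h 0%N) fg.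
rewrite smul_coef0 /sone eqxx => E.
by rewrite -[LHS]mul1mx -Vf -mulmxA E mulmx1.
Qed.

Lemma transferE k : b k = (\sum_a spoly C (Kplusdiag q rho xip Mp a) * smx (Bser q n N xi M) a a) k.
Proof.
rewrite /transfer tr_smx smxM smx_diag /mxtrace; congr (_ k); apply: eq_bigr => a _.
rewrite mxE (bigD1 a) //= !mxE eqxx mulr1n big1 ?addr0 // => c /negPf ca.
by rewrite !mxE eq_sym ca mul0r.
Qed.

(** Between two indices of a block, the entries of K^+ share one polynomial factor and differ only
    by the powers q^(-2k), which reduces the claim to [qtrace_weights]. *)
Lemma Kplus_weights t (i m : 'I_n) : blk i = blk m -> lts t i m ->
  \sum_k act (rr (rpar q t) t i k * rr (rpar q t) t k m) (spoly C (Kplusdiag q rho xip Mp k)) =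
  act (rr (rpar q t) t i m) (act (rpar q t)^-1 (spoly C (Kplusdiag q rho xip Mp i)) -
                             act (rpar q t) (spoly C (Kplusdiag q rho xip Mp m))).
Proof.
move=> im tim; pose K (a : 'I_n) : {poly F} := if (a < Mp)%N then 1 - (rho * xip) ^+ 2 *: 'X
   else (rho ^+ 2 *: 'X) * (rho ^+ 2 *: 'X - (xip ^+ 2)%:P).
have KE a : spoly C (Kplusdiag q rho xip Mp a) = act (q ^+ n.+1 * q ^- (2 * a.+1)) (spoly C (K a)).
  by rewrite /Kplusdiag spolyZ.
have KK a : blk i = blk a -> K a = K i.
  by move=> /blkP[_ ia]; rewrite /K !ltnNge ia.
rewrite !KE (KK m im) !actA -actNl -actDl actA.
transitivity (act (\sum_k q ^+ n.+1 * (rr (rpar q t) t i k * rr (rpar q t) t k m * q ^- (2 * k.+1))) (spoly C (K i))).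
  have act_suml (r : seq 'I_n) (f : 'I_n -> F) x : act (\sum_(k <- r) f k) x = \sum_(k <- r) act (f k) x :> pser C.
    by elim/big_rec2: _ => [|k u v _ <-]; rewrite ?act0l ?actDl.
  rewrite act_suml; apply: eq_bigr => k _; rewrite KE actA /rr.
  case: ifP => ik; last by rewrite !mul0r mulr0 !act0l.
  case: ifP => km; last by rewrite mulr0 !mul0r mulr0 !act0l.
  by rewrite (KK k) ?(block_between blk_mono ik km im) // mulrCA mulrA.
rewrite -mulr_sumr qtrace_weights //; congr act; ring.
Qed.

Lemma block_transfer_comm s (i j : 'I_n) k : blk i = blk j ->
  GRing.comm (monodromy q n N s 0 i j) (b k).
Proof.
move=> ij; have [V [TV VT _]] := minus_inverse.
have [Ti [TTi TiT _]] := series_inverse TV VT.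
have BE : smx (Bser q n N xi M) =
    smx Tp *m diag_mx (\row_a spoly C (Kdiag xi M a)) *m smx Ti.
  by rewrite /Bser !smxM (sinvP TTi TiT) smx_diag.
have sT : smx Tm *m smx Ti = 1%:M by rewrite -smxM TTi smx1.
have sT' : smx Ti *m smx Tm = 1%:M by rewrite -smxM TiT smx1.
(* The triangle of R has to match that of l: the level-zero part of T^+ is lower triangular and goes
   with 1/q, that of T^- is upper triangular and goes with q. *)
pose t := ~~ s; have p0 : rpar q t != 0 by rewrite /rpar; case: t.
have lT u : RLL (rpar q t) t (monodromy q n N s 0)%:S (smx (monodromy q n N u)).
  rewrite {}/t in p0 *; case: s p0 => /= p0; first exact: monodromy_plus.
  by have := RLL_flip qV0 (@monodromy_minus F q n N q0 u); rewrite invrK.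
have ltri a c : lts t c a -> (monodromy q n N s 0)%:S a c = 0.
  rewrite /t [X in _ -> X = _]mxE; clear lT p0 t; case: s => /= h; by rewrite ?(lz_lower LZ) ?(lz_upper LZ) // rmorph0.
have Kc (P : {poly F}) (x : pser C) : spoly C P * x = x * spoly C P by exact: spolyC.
have Kb a c : blk a = blk c -> spoly C (Kdiag xi M a) = spoly C (Kdiag xi M c).
  by move=> /blkP[ac _]; rewrite /Kdiag !ltnNge ac.
have := @block_comm_trace F (pser C) n (rpar q t) t p0 blk blk_mono (monodromy q n N s 0)%:S
  (smx Tp) (smx Tm) (smx Ti) (fun a => spoly C (Kdiag xi M a))
  (fun a => spoly C (Kplusdiag q rho xip Mp a)) (lT true) (lT false) sT sT' ltri
  (fun a => Kc _) Kb (fun a => Kc _) (@Kplus_weights t) i j ij.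
rewrite -BE => E; rewrite transferE /GRing.comm.
have := congr1 (fun f : pser C => f k) E.
by rewrite [map_mx _ _ _ _]mxE scstMl scstMr.
Qed.

(** Both V x and x V are compared as V (x X) V and V (X x) V. Triangularity confines the inner
    indices to the interval between a and c, hence to one block, where the entries of X commute with
    x. *)
Lemma inverse_block_comm s (X V : 'M[C]_n) (x : C) :
    X *m V = 1%:M -> V *m X = 1%:M ->
    (forall a c, lts s c a -> X a c = 0) -> (forall a c, lts s c a -> V a c = 0) ->
    (forall a c, blk a = blk c -> GRing.comm (X a c) x) ->
  forall a c, blk a = blk c -> GRing.comm (V a c) x.
Proof.
move=> XV VX X0 V0 Xx a c ac.
have Sx (Z : 'M[C]_n) : (Z *m x%:M) a c = Z a c * x.
  rewrite mxE (bigD1 c) //= mxE eqxx mulr1n big1 ?addr0 // => d /negPf dc.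
  by rewrite mxE dc mulr0.
have xS (Z : 'M[C]_n) u v : (x%:M *m Z) u v = x * Z u v.
  rewrite mxE (bigD1 u) //= mxE eqxx mulr1n big1 ?addr0 // => d /negPf dc.
  by rewrite mxE eq_sym dc mul0r.
have XS u v : (X *m x%:M) u v = X u v * x.
  rewrite mxE (bigD1 v) //= mxE eqxx mulr1n big1 ?addr0 // => d /negPf dc.
  by rewrite mxE dc mulr0.
rewrite /GRing.comm -Sx -xS -[V *m x%:M]mulmx1 -XV -[x%:M *m V]mul1mx -VX.
rewrite -[V *m X *m _]mulmxA [X *m (_ *m _)]mulmxA -[V *m x%:M *m _]mulmxA [x%:M *m (_ *m _)]mulmxA.
rewrite [LHS]mxE [RHS]mxE; apply: eq_bigr => d _.
case: (boolP (lts s d a)) => [da|da]; first by rewrite V0 // !mul0r.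
congr (_ * _); rewrite [LHS]mxE [RHS]mxE; apply: eq_bigr => e _; rewrite xS XS.
case: (boolP (lts s e d)) => [ed|ed]; first by rewrite X0 // mulr0 !mul0r.
case: (boolP (lts s c e)) => [ce|ce]; first by rewrite V0 // !mulr0.
rewrite Xx //; have := ac; move: da ed ce; rewrite /lts; case: s {X0 V0}; rewrite -!leqNgt => ad de ec.
  by have := blk_mono ad; have := blk_mono de; have := blk_mono ec; lia.
by have := blk_mono ad; have := blk_mono de; have := blk_mono ec; lia.
Qed.

Let Xdiag (d : 'I_n -> C) (X Y : 'M[C]_n) i j :
  (X *m diag_mx (\row_a d a) *m Y) i j = \sum_k X i k * d k * Y k j.
Proof.
rewrite mxE; apply: eq_bigr => k _; congr (_ * _).
rewrite mxE (bigD1 k) //= !mxE eqxx mulr1n big1 ?addr0 // => c /negPf ck.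
by rewrite !mxE ck mulr0.
Qed.

Lemma Bser0_transfer_comm (i j : 'I_n) k : (i < Mp)%N -> (j < Mp)%N ->
  GRing.comm (Bser q n N xi M 0 i j) (b k).
Proof.
move=> iM jM; have [V [TV VT V0]] := minus_inverse.
have [Ti [TTi TiT Ti0]] := series_inverse TV VT.
rewrite /Bser !smul_coef0 (sinvP TTi TiT) Ti0 Xdiag.
apply/commr_sym/commr_sum => c _; apply: commr_sym.
(* The first M entries of K vanish at 0. *)
have [cM|Mc] := ltnP c M.
  rewrite /Kdiag cM coefXM scal0 mulr0 mul0r; exact/commr_sym/commr0.
have [ic|ci] := ltnP i c; first by rewrite (lz_lower LZ) // !mul0r; exact/commr_sym/commr0.
have [jc|cj] := ltnP j c; first by rewrite V0 // mulr0; exact/commr_sym/commr0.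
(* Here M <= c <= i, j < Mp: all three indices are in the middle block. *)
have bi : blk i = blk c by rewrite /blk; move: iM jM Mc ci cj; lia.
have bj : blk c = blk j by rewrite /blk; move: iM jM Mc ci cj; lia.
apply/commr_sym/commrM; last first.
  apply/commr_sym/(inverse_block_comm TV VT _ V0 _ bj) => [u v /= uv|u v uv]; first by rewrite (lz_upper LZ).
  exact: block_transfer_comm.
apply: commrM; first exact/commr_sym/block_transfer_comm.
by apply: commr_sym; exact: scalC.
Qed.

(** D is x divided by an entry of K, with x the series variable. For a < M the factor x cancels and
    leaves 1/(x - xi^2), a power series since xi is nonzero; otherwise x remains and the constant
    term is zero. *)
Let Kdiag_inverse (a : 'I_n) : exists D : pser C,
  [/\ spoly C (Kdiag xi M a) * D = sX C, D * spoly C (Kdiag xi M a) = sX C,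
     exists c : F, D 0%N = scal c & (M <= a)%N -> D 0%N = 0].
Proof.
have inv (P : {poly F}) : P`_0 != 0 -> exists D : pser C,
    [/\ spoly C P * D = 1, D * spoly C P = 1 & exists c : F, D 0%N = scal c].
  move=> P0; have P0l : (spoly C P) 0%N * scal ((P`_0)^-1) = 1 by rewrite -scalM mulfV // scal1.
  have P0r : scal ((P`_0)^-1) * (spoly C P) 0%N = 1 by rewrite -scalM mulVf // scal1.
  have [D [PD DP]] := ser_inverse P0l P0r.
  exists D; split=> //; exists ((P`_0)^-1).
  by rewrite -[LHS]mul1r -P0r -mulrA -serM0 PD ser1 mulr1.
rewrite /Kdiag; case: ltnP => aM.
  have [|D [PD DP Dc]] := inv ('X - (xi ^+ 2)%:P).
    by rewrite coefB coefX coefC /= sub0r oppr_eq0 expf_neq0.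
  by exists D; split=> //; rewrite spolyM spolyX; [rewrite -mulrA PD mulr1|rewrite sXC mulrA DP mul1r].
have [|D [PD DP Dc]] := inv (1 - xi ^+ 2 *: 'X).
  by rewrite coefB coef1 coefZ coefX /= mulr0 subr0 oner_eq0.
exists (sX C * D); split.
- by rewrite sXC mulrA PD mul1r.
- by rewrite -mulrA DP mulr1.
- by exists 0; rewrite sXM scal0.
- by rewrite sXM.
Qed.

Lemma Bhat0_transfer_comm (i j : 'I_n) k : (Mp <= i)%N -> (Mp <= j)%N ->
  GRing.comm (Bhat q n N xi M 0 i j) (b k).
Proof.
move=> Mi Mj; have [V [TV VT V0]] := minus_inverse.
have [Ti [TTi TiT _]] := series_inverse TV VT.
have [W [TW WT W0]] := plus_inverse.
have [Si [TSi SiT Si0]] := series_inverse TW WT.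
pose D a := projT1 (cid (Kdiag_inverse a)).
have DP a : [/\ spoly C (Kdiag xi M a) * D a = sX C, D a * spoly C (Kdiag xi M a) = sX C,
     exists c : F, D a 0%N = scal c & (M <= a)%N -> D a 0%N = 0] := projT2 (cid (Kdiag_inverse a)).
pose Ds (d : nat) : 'M[C]_n := diag_mx (\row_a D a d).
have DsE : smx Ds = diag_mx (\row_a D a).
  apply/matrixP => u v; apply: funext => d; rewrite !mxE.
  by case: (u == v); rewrite ?mulr1n ?mulr0n ?ser0.
(* The inverse of B is T^- K^-1 (T^+)^-1; the factor x is absorbed in the diagonal matrix. *)
pose H := smul (smul Tm Ds) Si.
have BE : smx (Bser q n N xi M) =
    smx Tp *m diag_mx (\row_a spoly C (Kdiag xi M a)) *m smx Ti.
  by rewrite /Bser !smxM (sinvP TTi TiT) smx_diag.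
have dd (e f : 'I_n -> pser C) : (forall a, e a * f a = sX C) ->
    diag_mx (\row_a e a) *m diag_mx (\row_a f a) = (sX C)%:M :> 'M[pser C]_n.
  move=> ef; apply/matrixP => u v; rewrite mxE (bigD1 u) //= !mxE eqxx mulr1n big1 ?addr0 => [|c /negPf cu].
    by case: eqP => [->|_]; rewrite ?mulr1n ?ef // !mulr0n mulr0.
  by rewrite !mxE eq_sym cu mul0r.
have Xc (Y : 'M[pser C]_n) : (sX C)%:M *m Y = Y *m (sX C)%:M.
  apply/matrixP => u v; rewrite mxE [RHS]mxE (bigD1 u) //= [RHS](bigD1 v) //= !mxE !eqxx !mulr1n.
  rewrite [X in _ + X]big1 ?addr0 => [|t /negPf tk]; last by rewrite !mxE eq_sym tk mul0r.
  rewrite [X in _ = _ + X]big1 ?addr0 => [|t /negPf tk]; last by rewrite !mxE tk mulr0.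
  exact: sXC.
have sm1 f g : smul f g = sone C n -> smx f *m smx g = 1%:M by move=> E; rewrite -smxM E smx1.
have BH : smul (Bser q n N xi M) H = svar C n.
  apply: smx_inj; rewrite smxM BE /H !smxM smxX DsE.
  rewrite -!mulmxA [smx Ti *m _]mulmxA (sm1 _ _ TiT) mul1mx [diag_mx _ *m (_ *m _)]mulmxA.
  rewrite dd => [|a]; last by have [] := DP a.
  by rewrite mulmxA -Xc -mulmxA (sm1 _ _ TSi) mulmx1.
have HB : smul H (Bser q n N xi M) = svar C n.
  apply: smx_inj; rewrite smxM BE /H !smxM smxX DsE.
  rewrite -!mulmxA [smx Si *m _]mulmxA (sm1 _ _ SiT) mul1mx [diag_mx _ *m (_ *m _)]mulmxA.
  rewrite dd => [|a]; last by have [] := DP a.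
  by rewrite mulmxA -Xc -mulmxA (sm1 _ _ TTi) mulmx1.
rewrite /Bhat (svarinvP BH HB) /H !smul_coef0 Si0 Xdiag.
apply/commr_sym/commr_sum => c _; apply: commr_sym.
have [_ _ [d Dd] D0] := DP c.
(* At infinity only the first M diagonal entries survive, and the triangular factors now require c
   >= i, j; so Mp <= i, j <= c < M, again the middle block. *)
have [cM|Mc] := ltnP c M; last by rewrite D0 // mulr0 mul0r; exact/commr_sym/commr0.
have [ci|ic] := ltnP c i; first by rewrite (lz_upper LZ) // !mul0r; exact/commr_sym/commr0.
have [cj|jc] := ltnP c j; first by rewrite W0 // mulr0; exact/commr_sym/commr0.
have bi : blk i = blk c by rewrite /blk; move: Mi Mj cM ic jc; lia.
have bj : blk c = blk j by rewrite /blk; move: Mi Mj cM ic jc; lia.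
apply/commr_sym/commrM; last first.
  apply/commr_sym/(inverse_block_comm TW WT _ W0 _ bj) => [u v /= uv|u v uv]; first by rewrite (lz_lower LZ).
  exact: block_transfer_comm.
apply: commrM; first exact/commr_sym/block_transfer_comm.
by rewrite Dd; apply: commr_sym; exact: scalC.
Qed.

Let block_bound (k : 'I_3) (i : 'I_(block_size n M Mp k)) : (block_start M Mp k + i < n)%N.
Proof.
case: k i => -[|[|[|//]]] k3 [i /=]; rewrite /block_start /block_size /=; move: Mn Mpn; lia.
Qed.

Definition block_emb (k : 'I_3) (i : 'I_(block_size n M Mp k)) : 'I_n := Ordinal (block_bound i).

Lemma block_emb_ltb (k k' : 'I_3) (i : 'I_(block_size n M Mp k)) (j : 'I_(block_size n M Mp k')) :
  (k < k')%N -> (block_emb i < block_emb j)%N.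
Proof.
case: k i => -[|[|[|//]]] k3 [i /=]; case: k' j => -[|[|[|//]]] k3' [j /=];
  rewrite /block_start /block_size /=; move: Mn Mpn; lia.
Qed.

Lemma block_emb_surj (a : 'I_n) : exists k (i : 'I_(block_size n M Mp k)), a = block_emb i.
Proof.
have ha := ltn_ord a.
case: (ltnP a (minn M Mp)) => a1.
  by exists (@Ordinal 3 0 isT), (@Ordinal (minn M Mp) a a1); apply: val_inj.
case: (ltnP a (maxn M Mp)) => a2.
  have h : (a - minn M Mp < maxn M Mp - minn M Mp)%N by lia.
  by exists (@Ordinal 3 1 isT), (@Ordinal (maxn M Mp - minn M Mp) _ h); apply: val_inj; rewrite /= /block_start /=; lia.
have h : (a - maxn M Mp < n - maxn M Mp)%N by lia.
by exists (@Ordinal 3 2 isT), (@Ordinal (n - maxn M Mp) _ h); apply: val_inj; rewrite /= /block_start /=; lia.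
Qed.

Lemma blk_block_emb (k : 'I_3) (i j : 'I_(block_size n M Mp k)) : blk (block_emb i) = blk (block_emb j).
Proof.
case: k i j => -[|[|[|//]]] k3 [i /=] hi [j /=] hj; move: hi hj;
  rewrite /blk /block_emb /block_start /block_size /=; move: Mn Mpn; lia.
Qed.

Lemma block_symmetry : exists Phi : {rmorphism block_alg q n M Mp -> chainAlg q n N},
  [/\ forall c : F, Phi (scal c) = scal c,
      injective Phi,
      forall (k : 'I_3) (s : bool) (i j : 'I_(block_size n M Mp k)) (i' j' : 'I_n),
        i' = (block_start M Mp k + i)%N :> nat ->
        j' = (block_start M Mp k + j)%N :> nat ->
        Phi (block_ell q s i j) = ell_chain q n N s i' j' &
      forall (x : block_alg q n M Mp) (k : nat), GRing.comm (Phi x) (b k)].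
Proof.
have embl (k : 'I_3) (i j : 'I_(block_size n M Mp k)) : (block_emb i < block_emb j)%N = (i < j)%N.
  by rewrite /= ltn_add2l.
have [Phi [PhiE Phic]] := levi_map q0 embl block_emb_ltb LZ.
have PhiE' (k : 'I_3) (s : bool) (i j : 'I_(block_size n M Mp k)) :
    Phi (block_ell q s i j) = ell_chain q n N s (block_emb i) (block_emb j).
  by rewrite [LHS]PhiE; case: s.
exists Phi; split=> //.
- apply: (levi_injective q0 embl block_emb_ltb block_emb_surj Phic PhiE) => A P' M' PM.
  exact: chain_lift.
- move=> k s i j i' j' hi hj; rewrite PhiE'.
  by congr (ell_chain _ _ _ _ _ _); apply: val_inj.
move=> x d; move: x; apply: tensor_ind => [c|u v hu hv|u v hu hv|k a].
- by rewrite Phic; exact: scalC.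
- by rewrite rmorphD; apply/commr_sym/commrD; exact: commr_sym.
- by rewrite rmorphM; apply/commr_sym/commrM; exact: commr_sym.
have [iota [iotaE iotac]] := tensor_in_morph (fun k => Ufin q (block_size n M Mp k)) k.
rewrite -iotaE; move: a; apply: presAlg_ind => [c|u v hu hv|u v hu hv|x].
- by rewrite iotac Phic; exact: scalC.
- by rewrite !rmorphD; apply/commr_sym/commrD; exact: commr_sym.
- by rewrite !rmorphM; apply/commr_sym/commrM; exact: commr_sym.
case: x => -[s i] j; have -> : pgen (@fin_rel F q _) (s, i, j) = ell q _ (~~ s) i j.
  by rewrite mxE negbK.
by rewrite iotaE PhiE'; apply: block_transfer_comm; exact: blk_block_emb.
Qed.
End OpenChainSymmetry.

Theorem mainTheorem3 (R : realType) (q xi xip rho : R[i]) (n N M Mp : nat)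
    (n_ge2 : (2 <= n)%N) (N_gt0 : (0 < N)%N)
    (q_neq0 : q != 0) (q2_neq1 : q ^+ 2 != 1)
    (xi_neq0 : xi != 0) (M_le : (M <= n)%N) (Mp_le : (Mp <= n)%N)
    (rhoE : rho ^+ 2 = q ^+ n) :
  let b := transfer q n N xi M rho xip Mp in
  (forall (i j : 'I_n), (i < Mp)%N -> (j < Mp)%N ->
     forall k : nat, GRing.comm (Bser q n N xi M 0 i j) (b k)) /\
  (forall (i j : 'I_n), (Mp <= i)%N -> (Mp <= j)%N ->
     forall k : nat, GRing.comm (Bhat q n N xi M 0 i j) (b k)) /\
  exists Phi : {rmorphism block_alg q n M Mp -> chainAlg q n N},
    [/\ forall c : R[i], Phi (scal c) = scal c,
        injective Phi,
        forall (k : 'I_3) (s : bool) (i j : 'I_(block_size n M Mp k)) (i' j' : 'I_n),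
          i' = (block_start M Mp k + i)%N :> nat ->
          j' = (block_start M Mp k + j)%N :> nat ->
          Phi (block_ell q s i j) = ell_chain q n N s i' j' &
        forall (x : block_alg q n M Mp) (k : nat), GRing.comm (Phi x) (b k)].
Proof.
move=> b; split; first by move=> i j iM jM k; exact: Bser0_transfer_comm.
split; first by move=> i j iM jM k; exact: Bhat0_transfer_comm.
exact: block_symmetry.
Qed.
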